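(* There is a polynomial-time $2$-approximation algorithm for bipartite Stackelberg Vertex Cover Pricing (with a single follower), i.e., an algorithm that on any instance outputs a price function whose revenue is at least half the maximum achievable revenue.
   Context: Bipartite Stackelberg Vertex Cover Pricing (single follower): a bipartite graph $G=(A\cup B,E)$ whose vertices are partitioned into priceable vertices $V_p$ (which may lie in both $A$ and $B$) and fixed-price vertices $V_f$ with costs $c(v)\ge0$. The leader assigns prices $p(v)\ge0$ to $v\in V_p$. The weight of a vertex set $C$ is $\sum_{v\in C\cap V_f}c(v)+\sum_{v\in C\cap V_p}p(v)$. The follower chooses a minimum-weight vertex cover of $G$, breaking ties in favor of higher revenue for the leader; the leader's revenue is the sum of prices of priceable vertices in the chosen cover. A vertex cover consisting only of fixed-price vertices is assumed to exist. *)

(* Defs.v *)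
From mathcomp Require Import all_boot all_order all_algebra reals.
Set Implicit Arguments.
Unset Strict Implicit.
Unset Printing Implicit Defensive.
Import Order.TTheory GRing.Theory Num.Theory.

(* ** Model of computation

   First-order call-by-value LISP without atoms other than nil (the language
   F+ of N. D. Jones, "Computability and Complexity from a Programming
   Perspective", with several variables).  Data are binary trees and every
   elementary operation costs one unit.  Sharing subtrees, a Turing machine
   simulates t steps in time polynomial in t and the input size, and conversely,
   so the functions computable in polynomial time with polynomially large
   output are those of the Turing machine model. *)

Inductive tree := Nil | Cons of tree & tree.

Fixpoint tsize (x : tree) : nat :=
  if x is Cons l r then (tsize l + tsize r).+1 else 1.

Definition thd (x : tree) : tree := if x is Cons l _ then l else Nil.
Definition ttl (x : tree) : tree := if x is Cons _ r then r else Nil.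

(* Variables are de Bruijn indices: [ELet a b] evaluates [b] with the value of
   [a] as variable 0, and [ECall f es] evaluates the body of function [f] with
   the values of [es] as variables 0, 1, ... *)
Inductive expr :=
  | EVar of nat
  | ENil
  | ECons of expr & expr
  | EHd of expr
  | ETl of expr
  | EIf of expr & expr & expr
  | ELet of expr & expr
  | ECall of nat & seq expr.

(* A program lists the bodies of its functions; function 0 is the entry point. *)
Definition program := seq expr.

Section Semantics.
Variable P : program.

(* [eval env e v t]: in [env], [e] evaluates to [v] at cost [t]. *)
Inductive eval : seq tree -> expr -> tree -> nat -> Prop :=
  | eval_var env i : eval env (EVar i) (nth Nil env i) 1
  | eval_nil env : eval env ENil Nil 1
  | eval_cons env a b u v s t :
      eval env a u s -> eval env b v t ->
      eval env (ECons a b) (Cons u v) (s + t).+1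
  | eval_hd env a u s : eval env a u s -> eval env (EHd a) (thd u) s.+1
  | eval_tl env a u s : eval env a u s -> eval env (ETl a) (ttl u) s.+1
  | eval_if_nil env a b c v s t :
      eval env a Nil s -> eval env c v t -> eval env (EIf a b c) v (s + t).+1
  | eval_if_cons env a b c l r v s t :
      eval env a (Cons l r) s -> eval env b v t ->
      eval env (EIf a b c) v (s + t).+1
  | eval_let env a b u v s t :
      eval env a u s -> eval (u :: env) b v t -> eval env (ELet a b) v (s + t).+1
  | eval_call env f es us v s t :
      evals env es us s -> eval us (nth ENil P f) v t ->
      eval env (ECall f es) v (s + t).+1
with evals : seq tree -> seq expr -> seq tree -> nat -> Prop :=
  | evals_nil env : evals env [::] [::] 0
  | evals_cons env e es u us s t :
      eval env e u s -> evals env es us t ->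
      evals env (e :: es) (u :: us) (s + t).

Definition run (inp out : tree) (t : nat) : Prop :=
  eval [:: inp] (nth ENil P 0) out t.

End Semantics.

Scheme eval_mut := Minimality for eval Sort Prop
  with evals_mut := Minimality for evals Sort Prop.

Lemma run_det P inp out1 t1 out2 t2 :
  run P inp out1 t1 -> run P inp out2 t2 -> out1 = out2 /\ t1 = t2.
Proof.
rewrite /run => h1; move: out2 t2.
apply: (@eval_mut P
  (fun env e v t => forall v' t', eval P env e v' t' -> v = v' /\ t = t')
  (fun env es vs t => forall vs' t', evals P env es vs' t' -> vs = vs' /\ t = t'))
  h1 => {inp out1 t1}; intros;
  match goal with
  | h : eval _ _ _ ?v ?t |- _ = ?v /\ _ = ?t => inversion h; subst
  | h : evals _ _ _ ?v ?t |- _ = ?v /\ _ = ?t => inversion h; subst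
  end;
  repeat match goal with
  | ih : (forall v t, eval ?Q ?env ?e v t -> _), h : eval ?Q ?env ?e _ _ |- _ =>
      have [? ?] := ih _ _ h; clear h; subst
  | ih : (forall v t, evals ?Q ?env ?e v t -> _), h : evals ?Q ?env ?e _ _ |- _ =>
      have [? ?] := ih _ _ h; clear h; subst
  end; by [].
Qed.

(* ** Instances *)

Record instance := Instance {
  nA : nat;
  nB : nat;
  adj : 'I_nA -> 'I_nB -> bool;
  priceable : pred ('I_nA + 'I_nB);
  cost : 'I_nA + 'I_nB -> rat  (* meaningful on fixed-price vertices only *)
}.

Definition vertex (I : instance) : finType := ('I_(nA I) + 'I_(nB I))%type.

Definition vertex_cover (I : instance) (C : {set vertex I}) : bool :=
  [forall i, forall j, adj i j ==> ((inl i \in C) || (inr j \in C))].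

Definition well_formed (I : instance) : Prop :=
  (forall v : vertex I, ~~ priceable v -> (0 <= cost v)%R) /\
  (exists2 C : {set vertex I},
     vertex_cover C & {in C, forall v, ~~ priceable v}).

Section Pricing.
Local Open Scope ring_scope.
Variables (R : realType) (I : instance) (p : vertex I -> R).

Definition valid_prices : Prop := forall v, priceable v -> 0 <= p v.

Definition weight (C : {set vertex I}) : R :=
  \sum_(v in C | ~~ priceable v) ratr (cost v) + \sum_(v in C | priceable v) p v.

Definition revenue_of (C : {set vertex I}) : R :=
  \sum_(v in C | priceable v) p v.

Definition min_weight_cover (C : {set vertex I}) : bool :=
  vertex_cover C && [forall D, vertex_cover D ==> (weight C <= weight D)].

(* The inner [arg min] only supplies a minimum-weight cover to start from. *)
Definition follower_cover : {set vertex I} :=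
  [arg max_(C > [arg min_(C < setT | vertex_cover C) weight C]%O
            | min_weight_cover C) revenue_of C]%O.

Definition revenue : R := revenue_of follower_cover.

End Pricing.

(* ** Encodings *)

(* Binary expansion, least significant bit first, without leading zeros:
   [up_log 2 n.+1] is the number of binary digits of n. *)
Definition nat_bits (n : nat) : bitseq :=
  [seq odd (n %/ 2 ^ i) | i <- iota 0 (up_log 2 n.+1)].

Definition enc_bool (b : bool) : tree := if b then Cons Nil Nil else Nil.

Definition enc_seq (T : Type) (enc : T -> tree) (s : seq T) : tree :=
  foldr (fun x => Cons (enc x)) Nil s.

Definition enc_nat (n : nat) : tree := enc_seq enc_bool (nat_bits n).

Definition enc_frac (x : nat * nat) : tree := Cons (enc_nat x.1) (enc_nat x.2).

Definition enc_vertices (I : instance) (enc : vertex I -> tree) : tree :=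
  Cons (enc_seq (fun i => enc (inl i)) (enum 'I_(nA I)))
       (enc_seq (fun j => enc (inr j)) (enum 'I_(nB I))).

(* Nil marks a priceable vertex; costs, being nonnegative, need no sign. *)
Definition enc_vertex (I : instance) (v : vertex I) : tree :=
  if priceable v then Nil
  else enc_frac (absz (numq (cost v)), absz (denq (cost v))).

Definition enc_instance (I : instance) : tree :=
  Cons (enc_vertices (@enc_vertex I))
       (enc_seq (fun i => enc_seq (fun j => enc_bool (adj i j))
                                  (enum 'I_(nB I)))
                (enum 'I_(nA I))).

(* ** Algorithms *)

(* The output size is bounded as well because, by sharing, t steps can denote
   a tree of size exponential in t. *)
Definition polynomial_time (alg : program) : Prop :=
  exists c k : nat, forall I : instance, well_formed I ->
    exists out t, run alg (enc_instance I) out t /\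
      t + tsize out <= c * tsize (enc_instance I) ^ k.

(* The prices are output as fractions, not necessarily in lowest terms; the
   entries at fixed-price vertices are present but irrelevant. *)
Definition outputs_prices (alg : program) (I : instance) (p : vertex I -> rat)
  : Prop :=
  exists (x : vertex I -> nat * nat) (t : nat),
    run alg (enc_instance I) (enc_vertices (fun v => enc_frac (x v))) t /\
    forall v, 0 < (x v).2 /\ p v = ((x v).1%:R / (x v).2%:R)%R.

(* Main.v *)
(* After clearing denominators, consider the network with an arc from each vertex
   of A to each of its neighbours in B and four terminals 0, 1, 2, 3: terminal 0
   feeds the fixed vertices of A and terminal 1 the priceable ones, the fixed
   vertices of B are drained into terminal 3 and the priceable ones into terminal
   2; terminal arcs of fixed vertices have their costs as capacities, all other
   arcs are uncapacitated.  A flow without residual path from a terminal to one of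
   larger index maximizes simultaneously the throughput of the fixed vertices of A,
   the total flow F, and the throughput of the fixed vertices of B.

   Charge every priceable vertex the flow through it.  By duality every cover
   weighs at least F.  For k = 1, 2, 3 the set of nodes reachable from terminals of
   index < k is a cut whose associated vertex cover weighs exactly F; for k = 1 its
   revenue is the whole flow P_A through priceable vertices of A, for k = 3 the
   flow P_B through those of B, and for k = 2 it has no priceable vertex.  Hence
   the revenue is at least max(P_A, P_B).  Under any other prices the cover for
   k = 2 still weighs F, while the fixed vertices of any cover cost at least
   F - P_A - P_B, so no revenue exceeds P_A + P_B.

   The flow is found by bit scaling: doubling an optimal flow and appending one bit
   to each capacity leaves at most one unit to gain per arc and cut, so that each
   bit costs at most three unit augmentations per arc. *)
Require Import Defs.
From mathcomp Require Import all_boot all_order all_algebra reals zify ring lra.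
(* tuple.v also defines [tsize]. *)
Import Defs.
Set Implicit Arguments.
Unset Strict Implicit.
Unset Printing Implicit Defensive.
Import Order.TTheory GRing.Theory Num.Theory.

(** * Programs computing functions in polynomial time *)

(** The theorem asks for a concrete program, yet none is written out: [computable] says that a
    function on encoded data has one, with polynomial bounds on both time and output size, and
    closure lemmas assemble it along the functional definitions. The size bound makes composition
    work, since the time of a call is measured in the size of its arguments. Iteration is the
    obstacle: polynomially many polynomial steps can still build exponentially large values. So
    every loop runs over a list, and the general loop lemmas demand a bound on all intermediate
    states. For the flow this bound comes from the capacities: a push preserves [fw + bw] on each
    arc, so only the doublings add digits. Nodes are written in unary and amounts in binary, as node
    numbers are linear in the input size while costs may be exponential. An uncapacitated arc gets
    the largest number with the available digits, which exceeds the sum of all fixed costs. This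
    acts as infinity, because the assumed cover by fixed vertices keeps every flow value below
    it. *)

Definition polyb (U : Type) (m g : U -> nat) : Prop :=
  exists k, forall u, g u <= (m u).+2 ^ k.

Lemma leq_expr m n e : m <= n -> m ^ e <= n ^ e.
Proof. by case: e => // e le_mn; rewrite leq_exp2r. Qed.

Section Polyb.
Variables (U : Type) (m : U -> nat).
Implicit Types g h : U -> nat.

Lemma polyb_le g h : (forall u, g u <= h u) -> polyb m h -> polyb m g.
Proof. by move=> le_gh [k hk]; exists k => u; apply: leq_trans (hk u). Qed.

Lemma polyb_const c : polyb m (fun=> c).
Proof.
exists c => u; apply: leq_trans (ltnW (ltn_expl c (ltnSn 1))) _.
exact: leq_expr.
Qed.

Lemma polyb_id : polyb m m.
Proof. by exists 1 => u; rewrite expn1; apply: leqW. Qed.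

Lemma polyb_mul g h : polyb m g -> polyb m h -> polyb m (fun u => g u * h u).
Proof.
by move=> [k hk] [l hl]; exists (k + l) => u; rewrite expnD leq_mul.
Qed.

(** Both powers are at least 1, so the sum is at most twice their product; as the base is at least
    2, the extra exponent pays for that factor. *)
Lemma polyb_add g h : polyb m g -> polyb m h -> polyb m (fun u => g u + h u).
Proof.
move=> [k hk] [l hl]; exists (k + l).+1 => u.
have le1 j : 0 < (m u).+2 ^ j by rewrite expn_gt0.
rewrite expnS expnD; apply: (@leq_trans (2 * ((m u).+2 ^ k * (m u).+2 ^ l))).
  by move: (hk u) (hl u) (le1 k) (le1 l); nia.
by rewrite leq_mul2r orbC.
Qed.

Lemma polyb_exp c g : polyb m g -> polyb m (fun u => g u ^ c).
Proof.
by move=> [k hk]; exists (k * c) => u; rewrite expnM leq_expr ?hk.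
Qed.

Lemma polyb_poly g c d : polyb m g -> polyb m (fun u => (g u + c) ^ d).
Proof. by move=> hg; apply/polyb_exp/polyb_add/polyb_const. Qed.
End Polyb.

Lemma polyb_pre (U V : Type) (h : V -> U) (m g : U -> nat) :
  polyb m g -> polyb (m \o h) (g \o h).
Proof. by move=> [k hk]; exists k => u; apply: hk. Qed.

Lemma polyb_trans (U : Type) (m m' g : U -> nat) :
  polyb m m' -> polyb m' g -> polyb m g.
Proof.
move=> hm [k hk]; apply: polyb_le hk _.
by apply: polyb_le (polyb_poly 2 k hm) => u; rewrite addn2.
Qed.

Definition esize (env : seq tree) : nat := sumn (map tsize env).

Lemma tsize_gt0 x : 0 < tsize x. Proof. by case: x. Qed.

Lemma tsize_nth env i : tsize (nth Nil env i) <= (esize env).+1.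
Proof.
elim: env i => [|x env IH] [|i] //=; rewrite /esize /=; first by lia.
by move: (IH i); rewrite /esize; lia.
Qed.

(* Quantifying over the size of the prefix alone, rather than over a fixed
   program, lets programs be linked by concatenation without renumbering. *)
Definition computable (T : Type) (cx : T -> seq tree) (F : T -> tree) : Prop :=
  polyb (esize \o cx) (tsize \o F) /\
  forall n, exists (Q : program) (e : expr) (b : T -> nat),
    polyb (esize \o cx) b /\
    forall P Q' : program, size P = n -> forall x,
      exists2 t, eval (P ++ Q ++ Q') (cx x) e (F x) t & t <= b x.

Fixpoint computables (T : Type) (cx : T -> seq tree) (Fs : seq (T -> tree)) :=
  if Fs is F :: Fs' then computable cx F /\ computables cx Fs' else True.

Lemma nth_middle (S : Type) (d e : S) P Q Q' :
  nth d ((P ++ Q) ++ e :: Q') (size P + size Q) = e.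
Proof. by rewrite -size_cat nth_cat ltnn subnn. Qed.

Section Closure.
Variables (T : Type) (cx : T -> seq tree).
Implicit Types F G : T -> tree.

Lemma eq_computable F G : (forall x, F x = G x) -> computable cx F -> computable cx G.
Proof.
move=> eqFG [hb h]; split.
  by apply: polyb_le hb => x /=; rewrite eqFG.
move=> n; have [Q [e [b [pb hQ]]]] := h n; exists Q, e, b; split=> // P Q' hP x.
by have [t ht hle] := hQ P Q' hP x; exists t; rewrite -?eqFG.
Qed.

Lemma c_var i : computable cx (fun x => nth Nil (cx x) i).
Proof.
split=> [|n]; first by exists 1 => x /=; rewrite expn1 ltnW // ltnS tsize_nth.
exists [::], (EVar i), (fun=> 1); split; first exact: polyb_const.
by move=> P Q' _ x; exists 1 => //; constructor.
Qed.

Lemma c_nil : computable cx (fun=> Nil).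
Proof.
split=> [|n]; first exact: polyb_const.
exists [::], ENil, (fun=> 1); split; first exact: polyb_const.
by move=> P Q' _ x; exists 1 => //; constructor.
Qed.

Lemma c_cons F G : computable cx F -> computable cx G ->
  computable cx (fun x => Cons (F x) (G x)).
Proof.
move=> [bF hF] [bG hG]; split=> [|n].
  apply: (@polyb_le _ _ _ (fun x => tsize (F x) + tsize (G x) + 1)) => [x /=|].
    by rewrite addn1.
  by apply/polyb_add/polyb_const/polyb_add.
have [Q1 [e1 [b1 [pb1 h1]]]] := hF n.
(* [Q2] is obtained for a prefix longer by [size Q1], so that its calls stay correct after
   concatenation. *)
have [Q2 [e2 [b2 [pb2 h2]]]] := hG (n + size Q1).
exists (Q1 ++ Q2), (ECons e1 e2), (fun x => b1 x + b2 x + 1); split.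
  by apply/polyb_add/polyb_const/polyb_add.
move=> P Q' hP x.
have [t1 ev1 le1] := h1 P (Q2 ++ Q') hP x.
have [|t2 ev2 le2] := h2 (P ++ Q1) Q' _ x; first by rewrite size_cat hP.
exists (t1 + t2).+1; last by lia.
by rewrite -!catA in ev2 *; constructor.
Qed.

Lemma c_hd F : computable cx F -> computable cx (fun x => thd (F x)).
Proof.
move=> [bF hF]; split=> [|n].
  by apply: polyb_le bF => x /=; case: (F x) => //= l r; lia.
have [Q [e [b [pb h]]]] := hF n.
exists Q, (EHd e), (fun x => b x + 1); split; first by apply/polyb_add/polyb_const.
move=> P Q' hP x; have [t ev le] := h P Q' hP x.
by exists t.+1; [constructor | lia].
Qed.

Lemma c_tl F : computable cx F -> computable cx (fun x => ttl (F x)).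
Proof.
move=> [bF hF]; split=> [|n].
  by apply: polyb_le bF => x /=; case: (F x) => //= l r; lia.
have [Q [e [b [pb h]]]] := hF n.
exists Q, (ETl e), (fun x => b x + 1); split; first by apply/polyb_add/polyb_const.
move=> P Q' hP x; have [t ev le] := h P Q' hP x.
by exists t.+1; [constructor | lia].
Qed.

Definition is_cons (x : tree) : bool := if x is Cons _ _ then true else false.

Lemma c_if C F G : computable cx C -> computable cx F -> computable cx G ->
  computable cx (fun x => if is_cons (C x) then F x else G x).
Proof.
move=> [bC hC] [bF hF] [bG hG]; split=> [|n].
  apply: (@polyb_le _ _ _ (fun x => tsize (F x) + tsize (G x))) => [x /=|].
    by case: is_cons; lia.
  exact: polyb_add.
have [Q0 [e0 [b0 [pb0 h0]]]] := hC n.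
have [Q1 [e1 [b1 [pb1 h1]]]] := hF (n + size Q0).
have [Q2 [e2 [b2 [pb2 h2]]]] := hG (n + size Q0 + size Q1).
exists (Q0 ++ Q1 ++ Q2), (EIf e0 e1 e2), (fun x => b0 x + (b1 x + b2 x) + 1); split.
  by apply/polyb_add/polyb_const/polyb_add/polyb_add.
move=> P Q' hP x.
have [t0 ev0 le0] := h0 P (Q1 ++ Q2 ++ Q') hP x.
have [|t1 ev1 le1] := h1 (P ++ Q0) (Q2 ++ Q') _ x; first by rewrite size_cat hP.
have [|t2 ev2 le2] := h2 (P ++ Q0 ++ Q1) Q' _ x; first by rewrite !size_cat hP addnA.
move: ev0 ev1 ev2; rewrite -!catA; case: (C x) => [|l r] ev0 ev1 ev2 /=.
  by exists (t0 + t2).+1; [apply: eval_if_nil ev0 ev2 | lia].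
by exists (t0 + t1).+1; [apply: eval_if_cons ev0 ev1 | lia].
Qed.

Lemma computables_eval Fs : computables cx Fs ->
  polyb (esize \o cx) (fun x => esize [seq F x | F <- Fs]) /\
  forall n, exists (Q : program) (es : seq expr) (b : T -> nat),
    polyb (esize \o cx) b /\
    forall P Q' : program, size P = n -> forall x,
      exists2 t, evals (P ++ Q ++ Q') (cx x) es [seq F x | F <- Fs] t & t <= b x.
Proof.
elim: Fs => [_|F Fs IH /= [[bF hF] /IH[bFs hFs]]].
  split=> [|n]; first exact: polyb_const.
  exists [::], [::], (fun=> 0); split; first exact: polyb_const.
  by move=> P Q' _ x; exists 0 => //; constructor.
split=> [|n]; first exact: polyb_add bF bFs.
have [Q1 [e1 [b1 [pb1 h1]]]] := hF n.
have [Q2 [e2 [b2 [pb2 h2]]]] := hFs (n + size Q1).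
exists (Q1 ++ Q2), (e1 :: e2), (fun x => b1 x + b2 x); split; first exact: polyb_add.
move=> P Q' hP x.
have [t1 ev1 le1] := h1 P (Q2 ++ Q') hP x.
have [|t2 ev2 le2] := h2 (P ++ Q1) Q' _ x; first by rewrite size_cat hP.
exists (t1 + t2); last by lia.
by rewrite -!catA in ev2 *; constructor.
Qed.
End Closure.

Lemma c_pre (S T : Type) (h : S -> T) (cx : T -> seq tree) F :
  computable cx F -> computable (fun s => cx (h s)) (fun s => F (h s)).
Proof.
move=> [bF hF]; split=> [|n]; first exact: (polyb_pre h bF).
have [Q [e [b [pb hQ]]]] := hF n; exists Q, e, (b \o h); split.
  exact: (polyb_pre h pb).
by move=> P Q' hP s; apply: hQ.
Qed.

(** The callee becomes a new function, placed after the code of its arguments and its own helpers.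
    Its bounds are polynomial in the size of [cx'], which the output bounds on [Fs] make polynomial
    in the size of [cx]. *)
Lemma c_call (T : Type) (cx cx' : T -> seq tree) (Fs : seq (T -> tree)) F :
  (forall x, cx' x = [seq G x | G <- Fs]) -> computables cx Fs ->
  computable cx' F -> computable cx F.
Proof.
move=> eq_cx' /computables_eval[bFs hFs] [bF hF].
have bC : polyb (esize \o cx) (esize \o cx').
  by apply: polyb_le bFs => x /=; rewrite eq_cx'.
split=> [|n]; first exact: polyb_trans bC bF.
have [Q1 [es [b1 [pb1 h1]]]] := hFs n.
have [Q2 [e [b2 [pb2 h2]]]] := hF (n + size Q1).
exists (Q1 ++ Q2 ++ [:: e]), (ECall (n + size Q1 + size Q2) es).
exists (fun x => b1 x + b2 x + 1); split.
  by apply/polyb_add/polyb_const/polyb_add => //; apply: polyb_trans bC pb2.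
move=> P Q' hP x.
have [t1 ev1 le1] := h1 P (Q2 ++ [:: e] ++ Q') hP x.
have [|t2 ev2 le2] := h2 (P ++ Q1) ([:: e] ++ Q') _ x; first by rewrite size_cat hP.
exists (t1 + t2).+1; last by lia.
rewrite -!catA in ev1 ev2 *; apply: eval_call ev1 _.
have -> : P ++ Q1 ++ Q2 ++ [:: e] ++ Q' = (P ++ (Q1 ++ Q2)) ++ e :: Q' by rewrite -!catA.
by rewrite -hP -addnA -size_cat nth_middle -!catA -eq_cx'.
Qed.

Lemma evals_vars P env s :
  evals P env [seq EVar i | i <- s] [seq nth Nil env i | i <- s] (size s).
Proof.
elim: s => [|i s IH] /=; first exact: evals_nil.
by rewrite -add1n; apply: evals_cons IH; apply: eval_var.
Qed.

(** * Recursion along a list *)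

Section Recursion.
Variables (X T U : Type) (ex : X -> tree) (cx : T -> seq tree).
Variables (F : seq X -> T -> tree) (H : X -> T -> T) (Hs : seq (X * seq X * T -> tree)).
Variables (l : U -> seq X) (a : U -> T).

Let cxl (z : X * seq X * T) := enc_seq ex (z.1.1 :: z.1.2) :: cx z.2.
Let cxr (z : X * seq X * T) := F z.1.2 (H z.1.1 z.2) :: cxl z.
Let cxu (u : U) := enc_seq ex (l u) :: cx (a u).

Variable m : nat.
Hypothesis Hm : forall b, size (cx b) = m.
Hypothesis Hbase : computable (fun b => Nil :: cx b) (F [::]).
Hypothesis Hstep : computable cxr (fun z => F (z.1.1 :: z.1.2) z.2).
Hypothesis Hpar : computables cxl Hs.
Hypothesis HparE : forall z, cx (H z.1.1 z.2) = [seq h z | h <- Hs].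
(** Required at every stage of the recursion, because iterating a step of polynomial growth may lead
    to exponential size. *)
Hypothesis Hbound : exists k, forall u pre s, l u = pre ++ s ->
  let b := foldl (fun a x => H x a) (a u) pre in
  tsize (F s b) + esize (cx b) <= (esize (cxu u)).+2 ^ k.

(* The parameter changes from [a] to [H x a] on the way down the list; results
   are combined on the way up. *)
Lemma c_rec : computable cxu (fun u => F (l u) (a u)).
Proof.
have [k hk] := Hbound; split=> [|n].
  by exists k => u; move: (hk u [::] (l u) erefl) => /=; lia.
have [bB hB] := Hbase; have [bG hG] := Hstep.
have [bH hH] := computables_eval Hpar.
have [Q1 [e1 [b1 [[k1 pb1] h1]]]] := hB n.
have [Q2 [e2 [b2 [[k2 pb2] h2]]]] := hG (n + size Q1).
have [Q3 [e3 [b3 [[k3 pb3] h3]]]] := hH (n + size Q1 + size Q2).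
pose f := n + size (Q1 ++ Q2 ++ Q3).
(* The function at index [f] calls itself on the tail, with the new parameters computed by [e3].
   [ELet] makes the result variable 0, so that [e2] runs in exactly the environment [cxr]. *)
pose body := EIf (EVar 0) (ELet (ECall f (ETl (EVar 0) :: e3)) e2) e1.
pose S u := (esize (cxu u)).+2.
(* [W] dominates every environment met, with room for the 2 in [polyb]. The list fits in [S u];
   [S u ^ k] occurs twice because the recursive result is bounded at the next stage and the
   parameters at the current one. [C] then bounds the cost of one level. *)
pose W u := S u + 2 * S u ^ k + 4.
pose C u := W u ^ k1 + W u ^ k2 + W u ^ k3 + 9.
exists (Q1 ++ Q2 ++ Q3 ++ [:: body]), (ECall f [seq EVar i | i <- iota 0 m.+1]).
exists (fun u => S u * C u + m + 3); split.
  have pS : polyb (esize \o cxu) S.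
    by apply: polyb_le (polyb_add (polyb_id _) (polyb_const _ 2)) => u /=; rewrite addn2.
  have pW : polyb (esize \o cxu) W.
    apply/polyb_add/polyb_const/polyb_add => //.
    by apply/polyb_mul/polyb_exp => //; apply: polyb_const.
  do 2![apply/polyb_add/polyb_const]; apply/polyb_mul => //.
  by apply/polyb_add/polyb_const/polyb_add/polyb_exp => //; apply/polyb_add; apply/polyb_exp.
move=> P Q' hP u; set Prog := P ++ _.
have body_f : nth ENil Prog f = body.
  rewrite -[RHS](nth_middle ENil body P (Q1 ++ Q2 ++ Q3) Q') hP.
  by rewrite /Prog -!catA.
(* Induction on the unread suffix; the prefix already read is kept so that [Hbound] applies to the
   current parameters. *)
have main : forall s pre, l u = pre ++ s ->
    let b := foldl (fun a x => H x a) (a u) pre in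
    exists2 t, eval Prog (enc_seq ex s :: cx b) body (F s b) t & t <= (size s).+1 * C u.
  elim=> [|x s IH] pre eq_l b.
    have [t ev le] := h1 P (Q2 ++ Q3 ++ [:: body] ++ Q') hP b.
    have := hk u _ _ eq_l; cbv zeta; rewrite -/b -/(S u) => le_b.
    exists (1 + t).+1; first by apply: eval_if_nil; [exact: eval_var | rewrite /Prog -!catA].
    have: b1 b <= W u ^ k1.
      apply: leq_trans (pb1 b) _; apply: leq_expr.
      have -> : (esize \o (fun b => Nil :: cx b)) b = (esize (cx b)).+1 by [].
      rewrite /W; lia.
    by rewrite /C /=; lia.
  have eq_l' : l u = rcons pre x ++ s by rewrite cat_rcons.
  have [t1 ev1 le1] := IH _ eq_l'.
  move: ev1; rewrite foldl_rcons -/b => ev1.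
  have := hk u _ _ eq_l; have := hk u _ _ eq_l'; cbv zeta.
  rewrite foldl_rcons -/b -/(S u) => le_b' le_b.
  pose z := (x, s, b).
  have le_xs : tsize (enc_seq ex (x :: s)) <= S u.
    rewrite /S /cxu eq_l /esize /= !ltnS.
    elim: (pre) => [|y p' IHp] /=; [lia|].
    by move: IHp; rewrite /=; lia.
  have [|t3 ev3 le3] := h3 (P ++ Q1 ++ Q2) ([:: body] ++ Q') _ z.
    by rewrite !size_cat hP addnA.
  have [|t2 ev2 le2] := h2 (P ++ Q1) (Q3 ++ [:: body] ++ Q') _ z.
    by rewrite size_cat hP.
  exists (1 + (((2 + t3) + t1).+1 + t2).+1).+1.
    apply: eval_if_cons; first exact: eval_var.
    apply: eval_let; last by rewrite /Prog; rewrite -!catA in ev2 *; exact: ev2.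
    apply: eval_call.
      apply: evals_cons; first by apply: eval_tl; apply: eval_var.
      by rewrite /Prog; rewrite -!catA in ev3 *; exact: ev3.
    by rewrite body_f -HparE /=.
  have size_l : esize (cxl z) = tsize (enc_seq ex (x :: s)) + esize (cx b) by [].
  have size_r : esize (cxr z) = tsize (F s (H x b)) + esize (cxl z) by [].
  have le_b3 : b3 z <= W u ^ k3.
    apply: leq_trans (pb3 z) _; apply: leq_expr; rewrite [_ z]size_l /W.
    by lia.
  have le_b2 : b2 z <= W u ^ k2.
    apply: leq_trans (pb2 z) _; apply: leq_expr; rewrite [_ z]size_r size_l /W.
    by lia.
  by move: le1 le2 le3 le_b2 le_b3; rewrite /= !mulSn /C; lia.
have [t ev le] := main (l u) [::] erefl.
have size_cxu : size (cxu u) = m.+1 by rewrite /= Hm.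
have evs : evals Prog (cxu u) [seq EVar i | i <- iota 0 m.+1] (cxu u) m.+1.
  have := evals_vars Prog (cxu u) (iota 0 (size (cxu u))).
  by move: (mkseq_nth Nil (cxu u)); rewrite /mkseq size_iota size_cxu => ->.
exists (m.+1 + t).+1.
  by apply: eval_call evs _; rewrite body_f.
have le_l : (size (l u)).+1 <= S u.
  have : size (l u) <= tsize (enc_seq ex (l u)) by elim: (l u) => //= x s; lia.
  by rewrite /S /cxu /esize /=; lia.
by have := leq_mul le_l (leqnn (C u)); lia.
Qed.
End Recursion.

Lemma computables_map (T : Type) (cx : T -> seq tree) (I : Type) (G : I -> T -> tree) s :
  (forall i, computable cx (G i)) -> computables cx [seq G i | i <- s].
Proof. by move=> hG; elim: s => //= i s IH; split. Qed.

Lemma nth_env (env : seq tree) m : size env = m ->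
  env = [seq nth Nil env i | i <- iota 0 m].
Proof. by move=> <-; rewrite -{1}(mkseq_nth Nil env). Qed.

Definition enc_pair (A B : Type) (ea : A -> tree) (eb : B -> tree) (p : A * B) : tree :=
  Cons (ea p.1) (eb p.2).

Lemma tsize_enc_cat (X : Type) (ex : X -> tree) s1 s2 :
  (tsize (enc_seq ex (s1 ++ s2))).+1 = tsize (enc_seq ex s1) + tsize (enc_seq ex s2).
Proof. by elim: s1 => [|x s IH] //=; lia. Qed.

Lemma tsize_enc_prefix (X : Type) (ex : X -> tree) s1 s2 :
  tsize (enc_seq ex s1) <= tsize (enc_seq ex (s1 ++ s2)).
Proof. by rewrite -ltnS tsize_enc_cat; have := tsize_gt0 (enc_seq ex s2); lia. Qed.

Lemma tsize_enc_suffix (X : Type) (ex : X -> tree) s1 s2 :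
  tsize (enc_seq ex s2) <= tsize (enc_seq ex (s1 ++ s2)).
Proof. by rewrite -ltnS tsize_enc_cat; have := tsize_gt0 (enc_seq ex s1); lia. Qed.

Lemma tsize_enc_size (X : Type) (ex : X -> tree) s : size s < tsize (enc_seq ex s).
Proof. by elim: s => //= x s IH; lia. Qed.

Section Combinators.
Variables (T : Type) (cx : T -> seq tree).

Lemma c_ifb (Y : Type) (ey : Y -> tree) b f g :
  computable cx (fun z => enc_bool (b z)) ->
  computable cx (fun z => ey (f z)) -> computable cx (fun z => ey (g z)) ->
  computable cx (fun z => ey (if b z then f z else g z)).
Proof.
move=> hb hf hg; apply: eq_computable (c_if hb hf hg) => z.
by case: (b z).
Qed.

Lemma c_true : computable cx (fun=> enc_bool true).
Proof. exact: c_cons (c_nil cx) (c_nil cx). Qed.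

Lemma c_false : computable cx (fun=> enc_bool false).
Proof. exact: c_nil. Qed.

Lemma c_and a b : computable cx (fun z => enc_bool (a z)) ->
  computable cx (fun z => enc_bool (b z)) -> computable cx (fun z => enc_bool (a z && b z)).
Proof. by move=> ha hb; apply: (c_ifb ha hb c_false). Qed.

Lemma c_or a b : computable cx (fun z => enc_bool (a z)) ->
  computable cx (fun z => enc_bool (b z)) -> computable cx (fun z => enc_bool (a z || b z)).
Proof. by move=> ha hb; apply: (c_ifb ha c_true hb). Qed.

Lemma c_not a : computable cx (fun z => enc_bool (a z)) ->
  computable cx (fun z => enc_bool (~~ a z)).
Proof. by move=> ha; apply: (c_ifb ha c_false c_true). Qed.

Lemma c_app1 (A : Type) (ea : A -> tree) (F : A -> tree) (a : T -> A) :
  computable (fun y => [:: ea y]) F -> computable cx (fun z => ea (a z)) ->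
  computable cx (fun z => F (a z)).
Proof.
move=> hF ha; apply: (c_call (Fs := [:: fun z => ea (a z)]) (cx' := fun z => [:: ea (a z)])) => //.
exact: (c_pre a hF).
Qed.

Lemma c_app2 (A B : Type) (ea : A -> tree) (eb : B -> tree) (F : A * B -> tree) a b :
  computable (fun y : A * B => [:: ea y.1; eb y.2]) F ->
  computable cx (fun z => ea (a z)) -> computable cx (fun z => eb (b z)) ->
  computable cx (fun z => F (a z, b z)).
Proof.
move=> hF ha hb.
apply: (c_call (Fs := [:: fun z => ea (a z); fun z => eb (b z)])
               (cx' := fun z => [:: ea (a z); eb (b z)])) => //.
exact: (c_pre (fun z => (a z, b z)) hF).
Qed.

End Combinators.

Section Folds.
Variables (T : Type) (cx : T -> seq tree) (X : Type) (ex : X -> tree) (l : T -> seq X) (m : nat).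
Hypothesis cx_m : forall z, size (cx z) = m.
Hypothesis hl : computable cx (fun z => enc_seq ex (l z)).

(** Instance of [c_rec] with the accumulator as part of the parameter: all work happens on the way
    down, and the final accumulator is handed back unchanged. *)
Lemma c_foldl (S : Type) (es : S -> tree) (f : T -> S -> X -> S) (i : T -> S) (b : T -> nat) :
  computable cx (fun z => es (i z)) ->
  computable (fun w : X * S * T => ex w.1.1 :: es w.1.2 :: cx w.2)
             (fun w => es (f w.2 w.1.2 w.1.1)) ->
  polyb (esize \o cx) b ->
  (forall z pre suf, l z = pre ++ suf -> tsize (es (foldl (f z) (i z) pre)) <= b z) ->
  computable cx (fun z => es (foldl (f z) (i z) (l z))).
Proof.
move=> hi hf pb hb.
pose Vs (W : Type) (g : W -> T) := [seq (fun w => nth Nil (cx (g w)) j) | j <- iota 0 m].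
apply: (c_call (Fs := [:: fun z => enc_seq ex (l z), fun z => es (i z) & Vs T id])
               (cx' := fun z => [:: enc_seq ex (l z), es (i z) & cx z])).
- by move=> z /=; rewrite -map_comp {1}(nth_env (cx_m z)).
- by split=> //; split=> //; apply: computables_map => j; apply: c_var.
pose H x (st : S * T) := (f st.2 st.1 x, st.2).
apply: (@c_rec X (S * T) T ex (fun st => es st.1 :: cx st.2)
  (fun s st => es (foldl (f st.2) st.1 s)) H
  [:: fun w : X * seq X * (S * T) => es (f w.2.2 w.2.1 w.1.1)
    & Vs _ (fun w : X * seq X * (S * T) => w.2.2)] l (fun z => (i z, z)) m.+1).
- by move=> st /=; rewrite cx_m.
- exact: (c_var _ 1).
- exact: (c_var _ 0).
- split; last by apply: computables_map => j; exact: (c_var _ j.+2).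
  pose C (w : X * seq X * (S * T)) := [:: enc_seq ex (w.1.1 :: w.1.2), es w.2.1 & cx w.2.2].
  pose C' (w : X * seq X * (S * T)) := [:: ex w.1.1, es w.2.1 & cx w.2.2].
  apply: (c_call (Fs := [:: fun w : X * seq X * (S * T) => ex w.1.1,
     fun w : X * seq X * (S * T) => es w.2.1 &
     Vs _ (fun w : X * seq X * (S * T) => w.2.2)]) (cx' := C')).
  + by move=> w; rewrite /C' /=; rewrite -map_comp {1}(nth_env (cx_m w.2.2)).
  + split; first exact: (c_hd (c_var C 0)).
    split; first exact: (c_var _ 1).
    by apply: computables_map => j; exact: (c_var _ j.+2).
  exact: (c_pre (fun w : X * seq X * (S * T) => (w.1.1, w.2.1, w.2.2)) hf).
- by move=> [[x s] [st z]] /=; rewrite -map_comp {1}(nth_env (cx_m z)).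
have [k hk] : polyb (esize \o cx) (fun z => b z + b z + esize (cx z)).
  by apply/polyb_add/polyb_id/polyb_add.
exists k => z pre s eq_l; cbv zeta.
have -> : foldl (fun a x => H x a) (i z, z) pre = (foldl (f z) (i z) pre, z).
  by elim: pre {eq_l} (i z) => //= x pre IH s0; rewrite IH.
rewrite /= -foldl_cat -eq_l; apply: leq_trans (_ : b z + b z + esize (cx z) <= _).
  have := hb z _ _ eq_l; have := hb z (l z) [::]; rewrite cats0 => /(_ erefl).
  by rewrite /esize /=; lia.
by apply: leq_trans (hk z) _; apply: leq_expr; rewrite /esize /=; lia.
Qed.

(** Instance of [c_rec] with a constant parameter, working on the way up: a paramorphism, whose step
    sees the remaining list next to the result for it. *)
Lemma c_para (F : T -> seq X -> tree) (b : T -> nat) :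
  computable cx (fun z => F z [::]) ->
  computable (fun w : X * seq X * T => [:: F w.2 w.1.2, ex w.1.1, enc_seq ex w.1.2 & cx w.2])
             (fun w => F w.2 (w.1.1 :: w.1.2)) ->
  polyb (esize \o cx) b ->
  (forall z pre suf, l z = pre ++ suf -> tsize (F z suf) <= b z) ->
  computable cx (fun z => F z (l z)).
Proof.
move=> hF hS pb hb.
pose Vs (W : Type) (g : W -> T) := [seq (fun w => nth Nil (cx (g w)) j) | j <- iota 0 m].
apply: (c_call (Fs := [:: fun z => enc_seq ex (l z) & Vs T id])
               (cx' := fun z => [:: enc_seq ex (l z) & cx z])).
- by move=> z /=; rewrite -map_comp {1}(nth_env (cx_m z)).
- by split=> //; apply: computables_map => j; apply: c_var.
apply: (@c_rec X T T ex cx (fun s z => F z s) (fun _ z => z)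
  (Vs _ (fun w : X * seq X * T => w.2)) l id m) => //.
- apply: (c_call (Fs := Vs T id) (cx' := cx)) hF.
    by move=> z; rewrite -map_comp {1}(nth_env (cx_m z)).
  by apply: computables_map => j; exact: (c_var _ j.+1).
- pose C (w : X * seq X * T) := [:: F w.2 w.1.2, enc_seq ex (w.1.1 :: w.1.2) & cx w.2].
  apply: (c_call (Fs := [:: fun w : X * seq X * T => F w.2 w.1.2,
     fun w : X * seq X * T => ex w.1.1, fun w : X * seq X * T => enc_seq ex w.1.2 &
     Vs _ (fun w : X * seq X * T => w.2)])) hS.
  + by move=> w /=; rewrite -map_comp {1}(nth_env (cx_m w.2)).
  + split; first exact: (c_var _ 0).
    split; first exact: (c_hd (c_var C 1)).
    split; first exact: (c_tl (c_var C 1)).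
    by apply: computables_map => j; exact: (c_var _ j.+2).
- by apply: computables_map => j; exact: (c_var _ j.+1).
- by move=> w; rewrite -map_comp {1}(nth_env (cx_m w.2)).
have [k hk] : polyb (esize \o cx) (fun z => b z + esize (cx z)).
  by apply/polyb_add/polyb_id.
exists k => z pre s eq_l; cbv zeta.
have -> : foldl (fun a _ => a) (id z) pre = z by elim: pre {eq_l}.
apply: leq_trans (_ : b z + esize (cx z) <= _).
  by have := hb z _ _ eq_l; lia.
by apply: leq_trans (hk z) _; apply: leq_expr; rewrite /esize /=; lia.
Qed.

(** No bound need be supplied here: each image depends only on its entry and the environment, so its
    own size bound times the length of the list suffices. *)
Lemma c_map (Y : Type) (ey : Y -> tree) (f : T -> X -> Y) :
  computable (fun w : X * T => ex w.1 :: cx w.2) (fun w => ey (f w.2 w.1)) ->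
  computable cx (fun z => enc_seq ey [seq f z x | x <- l z]).
Proof.
move=> hf; have [[k hk] _] := hf; have [pl _] := hl.
pose L z := tsize (enc_seq ex (l z)).
apply: (@c_para (fun z s => enc_seq ey [seq f z x | x <- s])
  (fun z => L z * ((L z + esize (cx z) + 2) ^ k + 1) + 1)).
- exact: c_nil.
- apply: c_cons; last exact: (c_var _ 0).
  apply: (c_call (Fs := (fun w : X * seq X * T => ex w.1.1) ::
    [seq (fun w => nth Nil (cx w.2) j) | j <- iota 0 m])
    (cx' := fun w : X * seq X * T => ex w.1.1 :: cx w.2)).
  + by move=> w /=; rewrite -map_comp {1}(nth_env (cx_m w.2)).
  + split; first exact: (c_var _ 1).
    by apply: computables_map => j; exact: (c_var _ j.+3).
  exact: (c_pre (fun w : X * seq X * T => (w.1.1, w.2)) hf).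
- apply/polyb_add/polyb_const/polyb_mul => //; apply/polyb_add/polyb_const.
  by apply/polyb_poly/polyb_add/polyb_id.
move=> z pre suf eq_l.
have le_suf : tsize (enc_seq ex suf) <= L z.
  rewrite /L eq_l -ltnS tsize_enc_cat.
  by have := tsize_gt0 (enc_seq ex pre); lia.
have: size suf <= L z by apply: leq_trans le_suf; apply/ltnW/tsize_enc_size.
suff: tsize (enc_seq ey [seq f z x | x <- suf]) <=
      size suf * ((L z + esize (cx z) + 2) ^ k + 1) + 1.
  by move=> h1 h2; apply: leq_trans h1 _; rewrite leq_add2r leq_mul2r h2 orbT.
elim: suf le_suf {eq_l} => //= x suf IH le_suf.
have := IH (leq_trans _ le_suf); move=> /(_ ltac:(lia)).
have := hk (x, z); rewrite /= mulSn => hx.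
have: tsize (ey (f z x)) <= (L z + esize (cx z) + 2) ^ k.
  apply: leq_trans hx _; apply: leq_expr.
  by rewrite /esize /=; lia.
by lia.
Qed.

Lemma c_filter (p : T -> pred X) :
  computable (fun w : X * T => ex w.1 :: cx w.2) (fun w => enc_bool (p w.2 w.1)) ->
  computable cx (fun z => enc_seq ex [seq x <- l z | p z x]).
Proof.
move=> hp; have [pl _] := hl.
apply: (@c_para (fun z s => enc_seq ex [seq x <- s | p z x]) _ _ _ pl).
- exact: c_nil.
- apply: (@eq_computable _ _ (fun w : X * seq X * T => enc_seq ex (if p w.2 w.1.1
    then w.1.1 :: [seq x <- w.1.2 | p w.2 x] else [seq x <- w.1.2 | p w.2 x]))) => //.
  apply: c_ifb; last 2 first.
  + by apply: c_cons; [exact: (c_var _ 1) | exact: (c_var _ 0)].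
  + exact: (c_var _ 0).
  apply: (c_call (Fs := (fun w : X * seq X * T => ex w.1.1) ::
    [seq (fun w => nth Nil (cx w.2) j) | j <- iota 0 m])
    (cx' := fun w : X * seq X * T => ex w.1.1 :: cx w.2)).
  + by move=> w /=; rewrite -map_comp {1}(nth_env (cx_m w.2)).
  + split; first exact: (c_var _ 1).
    by apply: computables_map => j; exact: (c_var _ j.+3).
  exact: (c_pre (fun w : X * seq X * T => (w.1.1, w.2)) hp).
move=> z pre suf /= ->; rewrite -ltnS tsize_enc_cat.
have := tsize_gt0 (enc_seq ex pre).
suff: tsize (enc_seq ex [seq x <- suf | p z x]) <= tsize (enc_seq ex suf) by lia.
by elim: suf => //= x suf IH; case: ifP => _ /=; lia.
Qed.

Lemma c_has (p : T -> pred X) :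
  computable (fun w : X * T => ex w.1 :: cx w.2) (fun w => enc_bool (p w.2 w.1)) ->
  computable cx (fun z => enc_bool (has (p z) (l z))).
Proof.
move=> hp.
apply: (@c_para (fun z s => enc_bool (has (p z) s)) (fun=> 3)).
- exact: c_nil.
- apply: c_or; last exact: (c_var _ 0).
  apply: (c_call (Fs := (fun w : X * seq X * T => ex w.1.1) ::
    [seq (fun w => nth Nil (cx w.2) j) | j <- iota 0 m])
    (cx' := fun w : X * seq X * T => ex w.1.1 :: cx w.2)).
  + by move=> w /=; rewrite -map_comp {1}(nth_env (cx_m w.2)).
  + split; first exact: (c_var _ 1).
    by apply: computables_map => j; exact: (c_var _ j.+3).
  exact: (c_pre (fun w : X * seq X * T => (w.1.1, w.2)) hp).
- exact: polyb_const.
by move=> z pre suf _; case: has.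
Qed.

Lemma c_cat (l' : T -> seq X) : computable cx (fun z => enc_seq ex (l' z)) ->
  computable cx (fun z => enc_seq ex (l z ++ l' z)).
Proof.
move=> hl'; have [pl _] := hl; have [pl' _] := hl'.
apply: (@c_para (fun z s => enc_seq ex (s ++ l' z)) _ _ _ (polyb_add pl pl')) => //.
  by apply: c_cons; [exact: (c_var _ 1) | exact: (c_var _ 0)].
move=> z pre suf /= ->; have := tsize_enc_cat ex pre suf.
have := tsize_enc_cat ex suf (l' z); have := tsize_gt0 (enc_seq ex pre); lia.
Qed.
End Folds.

(** * Unary and binary numbers *)

Definition enc_una (n : nat) : tree := enc_seq (fun _ : unit => Nil) (nseq n tt).

Lemma tsize_una n : tsize (enc_una n) = n.*2.+1.
Proof. by elim: n => //= n IH; rewrite -/(enc_una n) IH; lia. Qed.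

Section Unary.
Variables (T : Type) (cx : T -> seq tree).
Implicit Types m n : T -> nat.

Lemma c_unaS n : computable cx (fun z => enc_una (n z)) ->
  computable cx (fun z => enc_una (n z).+1).
Proof. by move=> hn; apply: (c_cons (c_nil cx) hn). Qed.

Lemma c_una_const k : computable cx (fun=> enc_una k).
Proof. by elim: k => [|k]; [apply: c_nil | apply: c_unaS]. Qed.
End Unary.

Lemma una_sub : computable (fun y : nat * nat => [:: enc_una y.1; enc_una y.2])
  (fun y => enc_una (y.1 - y.2)).
Proof.
apply: (@eq_computable _ _ (fun y : nat * nat => enc_una
    (foldl (fun n (_ : unit) => n.-1) y.1 (nseq y.2 tt)))).
  by move=> [m n] /=; elim: n m => [|n IH] m /=; rewrite ?subn0 // IH; congr enc_una; lia.
apply: (@c_foldl _ _ unit (fun=> Nil) (fun y => nseq y.2 tt) 2 _ _ nat enc_una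
  (fun _ n _ => n.-1) (fun y => y.1) (fun y => tsize (enc_una y.1))).
- by [].
- exact: (c_var _ 1).
- exact: (c_var _ 0).
- apply: (@eq_computable _ _ (fun w : unit * nat * (nat * nat) => ttl (enc_una w.1.2))).
    by move=> [[[] [|n]] ?].
  exact: (c_tl (c_var _ 1)).
- exact: (c_var _ 0).1.
move=> [m n] pre suf _ /=; rewrite !tsize_una ltnS leq_double.
by elim: pre m => //= _ pre IH m; apply: leq_trans (IH _) (leq_pred _).
Qed.

Section Unary2.
Variables (T : Type) (cx : T -> seq tree) (m n : T -> nat).
Hypothesis hm : computable cx (fun z => enc_una (m z)).
Hypothesis hn : computable cx (fun z => enc_una (n z)).

Lemma c_una_leq : computable cx (fun z => enc_bool (m z <= n z)).
Proof.
apply: (eq_computable _ (c_if (c_app2 una_sub hm hn) (c_false cx) (c_true cx))) => z /=.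
by rewrite -subn_eq0; case: (_ - _).
Qed.
End Unary2.

Lemma c_una_eq (T : Type) (cx : T -> seq tree) (m n : T -> nat) :
  computable cx (fun z => enc_una (m z)) -> computable cx (fun z => enc_una (n z)) ->
  computable cx (fun z => enc_bool (m z == n z)).
Proof.
move=> hm hn.
by apply: (eq_computable _ (c_and (c_una_leq hm hn) (c_una_leq hn hm))) => z; rewrite -eqn_leq.
Qed.

(** * Binary arithmetic *)

Lemma nat_bits0 : nat_bits 0 = [::].
Proof. by []. Qed.

(** Recovers the recursion on the least significant bit from the closed form of [nat_bits];
    positivity excludes a leading zero. *)
Lemma nat_bits_cons (b : bool) n : 0 < b + n.*2 -> nat_bits (b + n.*2) = b :: nat_bits n.
Proof.
move=> pos; rewrite /nat_bits.
have -> : up_log 2 (b + n.*2).+1 = (up_log 2 n.+1).+1.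
  apply/eqP; rewrite eqn_leq; apply/andP; split.
    rewrite up_log_min // expnS -[X in _ < X]/(2 * _).
    by have := @up_logP 2 n.+1 isT; case: (b); lia.
  rewrite ltnNge; apply/negP => le.
  have := @up_logP 2 (b + n.*2).+1 isT.
  case: (up_log 2 (b + n.*2).+1) le => [|j] le; first by rewrite expn0; lia.
  rewrite expnS => lt; have : n.+1 <= 2 ^ j by lia.
  by move=> /(up_log_min (isT : 1 < 2)); have := leq_ltn_trans le; lia.
rewrite /= divn1 oddD odd_double addbF oddb; congr (_ :: _).
rewrite -[1]/(1 + 0) iotaDl -map_comp; apply: eq_map => i /=.
by rewrite expnS divnMA divn2 half_bit_double.
Qed.

Definition bits_val (l : bitseq) : nat := foldr (fun (b : bool) n => b + n.*2) 0 l.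

Lemma nat_half_rec (P : nat -> Prop) :
  P 0 -> (forall (b : bool) n, 0 < b + n.*2 -> P n -> P (b + n.*2)) -> forall n, P n.
Proof.
move=> P0 PS n; elim/ltn_ind: n => n IH; case: (posnP n) => [-> //|n_gt0].
by rewrite -(odd_double_half n); apply: PS; [lia | apply: IH; lia].
Qed.

Lemma nat_bitsK n : bits_val (nat_bits n) = n.
Proof.
by elim/nat_half_rec: n => // b n pos IH; rewrite nat_bits_cons //= IH.
Qed.

Lemma bits_val_lt l : bits_val l < 2 ^ size l.
Proof. by elim: l => //= b l IH; rewrite expnS; case: b; lia. Qed.

Lemma enc_nat_cons (b : bool) n : 0 < b + n.*2 ->
  enc_nat (b + n.*2) = Cons (enc_bool b) (enc_nat n).
Proof. by move=> pos; rewrite /enc_nat nat_bits_cons. Qed.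

(** A digit costs at most four tree nodes: one [Cons] and an encoded bit of size at most 3. Together
    with [enc_nat_lt] this translates between magnitude and size, so that sizes of results are
    bounded by plain arithmetic. *)
Lemma tsize_enc_nat n k : n < 2 ^ k -> tsize (enc_nat n) <= (4 * k).+1.
Proof.
elim/nat_half_rec: n k => [k _|b n pos IH [|k]]; first by rewrite /enc_nat nat_bits0.
  by rewrite expn0; case: b n pos {IH} => [] [|n].
rewrite expnS enc_nat_cons //= => lt; have /IH : n < 2 ^ k by lia.
by case: b {lt pos}; rewrite /=; lia.
Qed.

Lemma enc_nat_lt n : n < 2 ^ tsize (enc_nat n).
Proof.
rewrite -{1}(nat_bitsK n); apply: leq_trans (bits_val_lt _) _.
by rewrite leq_exp2l //; apply/ltnW/tsize_enc_size.
Qed.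

Lemma is_cons_nat n : is_cons (enc_nat n) = (0 < n).
Proof. by elim/nat_half_rec: n => [|b n pos _]; rewrite ?enc_nat_cons // pos. Qed.

Section BinaryBasics.
Variables (T : Type) (cx : T -> seq tree).

Lemma c_pos n : computable cx (fun z => enc_nat (n z)) ->
  computable cx (fun z => enc_bool (0 < n z)).
Proof.
move=> hn; apply: eq_computable (c_if hn (c_true cx) (c_false cx)) => z /=.
by rewrite is_cons_nat; case: posnP.
Qed.

(** Prepending a zero bit to 0 must give [Nil], since encodings have no leading zeros; hence the
    test. *)
Lemma c_bcons b n : computable cx (fun z => enc_bool (b z)) ->
  computable cx (fun z => enc_nat (n z)) ->
  computable cx (fun z => enc_nat (b z + (n z).*2)).
Proof.
move=> hb hn.
apply: (eq_computable _ (c_if (c_or hb (c_pos hn)) (c_cons hb hn) (c_nil cx))) => z /=.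
case: (posnP (b z + (n z).*2)) => [|pos].
  by case: (b z) (n z) => [] [|k].
by rewrite enc_nat_cons //; case: (b z) (n z) pos => [] [].
Qed.

Lemma c_double n : computable cx (fun z => enc_nat (n z)) ->
  computable cx (fun z => enc_nat (n z).*2).
Proof. exact: (c_bcons (c_false cx)). Qed.

Lemma c_half n : computable cx (fun z => enc_nat (n z)) ->
  computable cx (fun z => enc_nat (n z)./2).
Proof.
move=> hn; apply: eq_computable (c_tl hn) => z.
elim/nat_half_rec: (n z) => [|b k pos _]; first by rewrite /enc_nat nat_bits0.
by rewrite enc_nat_cons //= half_bit_double.
Qed.

Lemma c_odd n : computable cx (fun z => enc_nat (n z)) ->
  computable cx (fun z => enc_bool (odd (n z))).
Proof.
move=> hn; apply: eq_computable (c_hd hn) => z.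
elim/nat_half_rec: (n z) => [|b k pos _]; first by rewrite /enc_nat nat_bits0.
by rewrite enc_nat_cons //= oddD odd_double addbF; case: b {pos}.
Qed.

Lemma c_nat0 : computable cx (fun=> enc_nat 0).
Proof. by rewrite /enc_nat nat_bits0; apply: c_nil. Qed.

Lemma c_nat1 : computable cx (fun=> enc_nat 1).
Proof. exact: (c_bcons (c_true cx) c_nat0). Qed.
End BinaryBasics.

Lemma c_addb (T : Type) (cx : T -> seq tree) a b :
  computable cx (fun z => enc_bool (a z)) -> computable cx (fun z => enc_bool (b z)) ->
  computable cx (fun z => enc_bool (a z (+) b z)).
Proof.
move=> ha hb; apply: (eq_computable _ (c_ifb ha (c_not hb) hb)) => z.
by case: (a z).
Qed.

Lemma add_carry : computable (fun y : nat * bool => [:: enc_nat y.1; enc_bool y.2])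
  (fun y => enc_nat (y.1 + y.2)).
Proof.
apply: (@eq_computable _ _ (fun y : nat * bool => enc_nat (bits_val (nat_bits y.1) + y.2))).
  by move=> y; rewrite nat_bitsK.
apply: (@c_rec bool bool (nat * bool) enc_bool (fun c => [:: enc_bool c])
  (fun l (c : bool) => enc_nat (bits_val l + c)) (fun x c => x && c)
  [:: fun w => enc_bool (w.1.1 && w.2)] (fun y => nat_bits y.1) (fun y => y.2) 1) => //.
- apply: (@eq_computable _ _ (fun c : bool => enc_nat (c + 0.*2))).
    by move=> c; rewrite addn0.
  by apply: c_bcons; [exact: (c_var _ 1) | exact: c_nat0].
- apply: (@eq_computable _ _ (fun z : bool * bitseq * bool =>
     enc_nat ((z.1.1 (+) z.2) + (bits_val z.1.2 + (z.1.1 && z.2)).*2))).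
    by move=> [[x s] c] /=; congr enc_nat; case: x c => [] []; lia.
  apply: c_bcons; last exact: (c_var _ 0).
  pose C (z : bool * bitseq * bool) :=
    [:: enc_nat (bits_val z.1.2 + (z.1.1 && z.2)); enc_seq enc_bool (z.1.1 :: z.1.2); enc_bool z.2].
  by apply: c_addb; [exact: (c_hd (c_var C 1)) | exact: (c_var C 2)].
- split=> //; pose C (z : bool * bitseq * bool) :=
    [:: enc_seq enc_bool (z.1.1 :: z.1.2); enc_bool z.2].
  by apply: c_and; [exact: (c_hd (c_var C 0)) | exact: (c_var C 1)].
pose m (u : nat * bool) := esize [:: enc_seq enc_bool (nat_bits u.1); enc_bool u.2].
have [k hk] : polyb m (fun u => 4 * (m u + 1) + 4).
  apply/polyb_add/polyb_const/polyb_mul/polyb_add/polyb_const/polyb_id.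
  exact: polyb_const.
exists k => u pre s eq_l; set b := foldl _ _ _; cbv zeta; apply: leq_trans (hk u).
have lt : bits_val s + b < 2 ^ (size s).+1.
  by have := bits_val_lt s; rewrite expnS; case: (b); lia.
have := tsize_enc_nat lt; rewrite /= /esize /= /m /esize /= eq_l.
have := tsize_enc_cat enc_bool pre s; have := tsize_enc_size enc_bool s.
have := tsize_gt0 (enc_seq enc_bool pre).
by case: (b); rewrite /=; lia.
Qed.

Lemma c_succ (T : Type) (cx : T -> seq tree) (m : T -> nat) :
  computable cx (fun z => enc_nat (m z)) -> computable cx (fun z => enc_nat (m z).+1).
Proof.
move=> hm; apply: (@eq_computable _ _ (fun z => enc_nat (m z + true))).
  by move=> z; rewrite addn1.
exact: (c_app2 add_carry hm (c_true cx)).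
Qed.

(** Ripple-carry addition: on the way down the bits of the first number, the parameter holds the
    unread part of the second and the carry, updated by the majority function. [add_carry] finishes
    where the bits of the first number end. *)
Lemma add_bin : computable (fun y : nat * nat => [:: enc_nat y.1; enc_nat y.2])
  (fun y => enc_nat (y.1 + y.2)).
Proof.
pose T := (nat * bool)%type.
apply: (@c_call _ _ (fun y : nat * nat => [:: enc_nat y.1; enc_nat y.2; enc_bool false])
  [:: fun y : nat * nat => enc_nat y.1; fun y : nat * nat => enc_nat y.2;
      fun=> enc_bool false]) => //.
  by split; [exact: (c_var _ 0) | split; [exact: (c_var _ 1) | split; [exact: c_false|]]].
apply: (@eq_computable _ _ (fun y : nat * nat =>
    enc_nat (bits_val (nat_bits y.1) + y.2 + false))).
  by move=> y; rewrite nat_bitsK addn0.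
apply: (@c_rec bool T (nat * nat) enc_bool (fun a => [:: enc_nat a.1; enc_bool a.2])
  (fun l a => enc_nat (bits_val l + a.1 + a.2))
  (fun x a => (a.1./2, x && odd a.1 || x && a.2 || odd a.1 && a.2))
  [:: fun w => enc_nat w.2.1./2;
      fun w => enc_bool (w.1.1 && odd w.2.1 || w.1.1 && w.2.2 || odd w.2.1 && w.2.2)]
  (fun y => nat_bits y.1) (fun y => (y.2, false)) 2) => //.
- by apply: (c_app2 add_carry); [exact: (c_var _ 1) | exact: (c_var _ 2)].
- apply: (@eq_computable _ _ (fun z : bool * bitseq * T =>
     enc_nat ((z.1.1 (+) odd z.2.1 (+) z.2.2) + (bits_val z.1.2 + z.2.1./2 +
       (z.1.1 && odd z.2.1 || z.1.1 && z.2.2 || odd z.2.1 && z.2.2)).*2))).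
    move=> [[x s] [n c]] /=; congr enc_nat; have := odd_double_half n.
    by case: x c (odd n) => [] [] []; lia.
  apply: c_bcons; last exact: (c_var _ 0).
  pose C (z : bool * bitseq * T) :=
    [:: enc_nat (bits_val z.1.2 + z.2.1./2 +
       (z.1.1 && odd z.2.1 || z.1.1 && z.2.2 || odd z.2.1 && z.2.2));
     enc_seq enc_bool (z.1.1 :: z.1.2); enc_nat z.2.1; enc_bool z.2.2].
  apply: c_addb; last exact: (c_var C 3).
  by apply: c_addb; [exact: (c_hd (c_var C 1)) | apply: c_odd; exact: (c_var C 2)].
- pose C (z : bool * bitseq * T) :=
    [:: enc_seq enc_bool (z.1.1 :: z.1.2); enc_nat z.2.1; enc_bool z.2.2].
  have hx : computable C (fun w => enc_bool w.1.1) by exact: (c_hd (c_var C 0)).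
  have hn : computable C (fun w => enc_nat w.2.1) by exact: (c_var C 1).
  have hc : computable C (fun w => enc_bool w.2.2) by exact: (c_var C 2).
  split; first exact: c_half hn.
  by split=> //; apply: c_or; [apply: c_or|]; apply: c_and => //; apply: c_odd hn.
pose m (u : nat * nat) :=
  esize [:: enc_seq enc_bool (nat_bits u.1); enc_nat u.2; enc_bool false].
have [k hk] : polyb m (fun u => 8 * (m u + 1) + 12).
  apply/polyb_add/polyb_const/polyb_mul/polyb_add/polyb_const/polyb_id.
  exact: polyb_const.
exists k => u pre s eq_l; set b := foldl _ _ _; cbv zeta; apply: leq_trans (hk u).
have le_b : b.1 <= u.2.
  rewrite {}/b; move: (u.2) (false); elim: (pre) => //= x p' IH n c.
  by apply: leq_trans (IH _ _) _; lia.
set M := m u.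
have sizeM : M = tsize (enc_seq enc_bool (nat_bits u.1)) + tsize (enc_nat u.2) + 1.
  by rewrite /M /m /esize /=; lia.
have ltb : b.1 < 2 ^ M.
  apply: leq_ltn_trans le_b _; apply: leq_trans (enc_nat_lt _) _.
  by rewrite leq_exp2l //; lia.
have les : size s < M.
  rewrite sizeM eq_l; have := tsize_enc_cat enc_bool pre s.
  by have := tsize_enc_size enc_bool s; have := tsize_gt0 (enc_seq enc_bool pre); lia.
have ltF : bits_val s + b.1 + b.2 < 2 ^ M.+1.
  have := bits_val_lt s; have : 2 ^ (size s).+1 <= 2 ^ M by rewrite leq_exp2l.
  by rewrite !expnS; case: (b.2); lia.
have := tsize_enc_nat ltF; have := tsize_enc_nat ltb; rewrite /esize /=.
by case: (b.2); rewrite /=; lia.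
Qed.

Lemma c_add (T : Type) (cx : T -> seq tree) (m n : T -> nat) :
  computable cx (fun z => enc_nat (m z)) -> computable cx (fun z => enc_nat (n z)) ->
  computable cx (fun z => enc_nat (m z + n z)).
Proof. exact: (c_app2 add_bin). Qed.

Lemma mul_bin : computable (fun y : nat * nat => [:: enc_nat y.1; enc_nat y.2])
  (fun y => enc_nat (y.1 * y.2)).
Proof.
apply: (@eq_computable _ _ (fun y : nat * nat => enc_nat (bits_val (nat_bits y.1) * y.2))).
  by move=> y; rewrite nat_bitsK.
apply: (@c_para _ _ bool enc_bool (fun y : nat * nat => nat_bits y.1) 2 _ _
  (fun y l => enc_nat (bits_val l * y.2))
  (fun y => 4 * (tsize (enc_nat y.1) + tsize (enc_nat y.2)) + 1)) => //.
- exact: (c_var _ 0).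
- by apply: c_nat0.
- apply: (@eq_computable _ _ (fun w : bool * bitseq * (nat * nat) =>
    enc_nat ((if w.1.1 then w.2.2 else 0) + (bits_val w.1.2 * w.2.2).*2))).
    by move=> [[[] s] [m n]] /=; congr enc_nat; rewrite ?mulnDl; lia.
  apply: c_add.
    by apply: c_ifb; [exact: (c_var _ 1) | exact: (c_var _ 4) | exact: c_nat0].
  by apply: c_double; exact: (c_var _ 0).
- apply/polyb_add/polyb_const/polyb_mul/polyb_add; first exact: polyb_const.
    by have [] := c_var (fun y : nat * nat => [:: enc_nat y.1; enc_nat y.2]) 0.
  by have [] := c_var (fun y : nat * nat => [:: enc_nat y.1; enc_nat y.2]) 1.
move=> [m n] pre suf /= eq_l; rewrite addn1; apply: tsize_enc_nat.
case: (posnP n) => [->|n_gt0]; first by rewrite muln0 expn_gt0.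
have n_lt := enc_nat_lt n.
rewrite expnD; apply: ltn_mul => //; apply: leq_trans (bits_val_lt _) _.
rewrite leq_exp2l // /enc_nat eq_l.
have := tsize_enc_cat enc_bool pre suf; have := tsize_enc_size enc_bool suf.
by have := tsize_gt0 (enc_seq enc_bool pre); lia.
Qed.

(** The predecessor of an even number depends on whether its half is 0, and that of an odd number is
    twice its half. So the value and the predecessor of the remaining bits are computed together,
    and the second component is kept. *)
Lemma pred_bin : computable (fun n => [:: enc_nat n]) (fun n => enc_nat n.-1).
Proof.
apply: (@eq_computable _ _ (fun n => ttl (enc_pair enc_nat enc_nat
    (bits_val (nat_bits n), (bits_val (nat_bits n)).-1)))).
  by move=> n; rewrite nat_bitsK.
apply: c_tl.
apply: (@c_para _ _ bool enc_bool nat_bits 1 _ _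
  (fun _ l => enc_pair enc_nat enc_nat (bits_val l, (bits_val l).-1))
  (fun n => 8 * tsize (enc_nat n) + 3)) => //.
- exact: (c_var _ 0).
- by apply: c_cons; apply: c_nat0.
- pose C (w : bool * bitseq * nat) := [:: enc_pair enc_nat enc_nat (bits_val w.1.2,
    (bits_val w.1.2).-1);
     enc_bool w.1.1; enc_seq enc_bool w.1.2; enc_nat w.2].
  have hv : computable C (fun w => enc_nat (bits_val w.1.2)).
    exact: (c_hd (c_var C 0)).
  have hp : computable C (fun w => enc_nat (bits_val w.1.2).-1).
    exact: (c_tl (c_var C 0)).
  have hb : computable C (fun w => enc_bool w.1.1) by exact: (c_var C 1).
  apply: c_cons; first exact: c_bcons hb hv.
  apply: (@eq_computable _ _ (fun w : bool * bitseq * nat => enc_nat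
    (if w.1.1 then (bits_val w.1.2).*2
     else (0 < bits_val w.1.2) + (bits_val w.1.2).-1.*2))).
    by move=> [[[] s] n] /=; congr enc_nat; lia.
  by apply: c_ifb => //; [apply: c_double | apply: c_bcons => //; apply: c_pos].
- apply/polyb_add/polyb_const/polyb_mul; first exact: polyb_const.
  by have [] := c_var (fun n => [:: enc_nat n]) 0.
move=> n pre suf eq_l /=; set M := tsize (enc_nat n).
have les : size suf < M.
  rewrite /M /enc_nat eq_l; have := tsize_enc_cat enc_bool pre suf.
  by have := tsize_enc_size enc_bool suf; have := tsize_gt0 (enc_seq enc_bool pre); lia.
have ltv : bits_val suf < 2 ^ M.
  by apply: leq_trans (bits_val_lt _) _; rewrite leq_exp2l // ltnW.
have := tsize_enc_nat ltv; have := tsize_enc_nat (leq_ltn_trans (leq_pred _) ltv).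
by lia.
Qed.

Lemma c_mul (T : Type) (cx : T -> seq tree) (m n : T -> nat) :
  computable cx (fun z => enc_nat (m z)) -> computable cx (fun z => enc_nat (n z)) ->
  computable cx (fun z => enc_nat (m z * n z)).
Proof. exact: (c_app2 mul_bin). Qed.

Lemma c_pred (T : Type) (cx : T -> seq tree) (m : T -> nat) :
  computable cx (fun z => enc_nat (m z)) -> computable cx (fun z => enc_nat (m z).-1).
Proof. exact: (c_app1 pred_bin). Qed.

(** * Unit augmentations in a residual network *)

(* ((tail, head), (capacity bits still to be read, most significant first,
   (residual capacity, flow))); nodes 0 to 3 are the terminals. *)
Definition arc : Type := ((nat * nat) * (bitseq * (nat * nat)))%type.
Definition tail (e : arc) : nat := e.1.1.
Definition head (e : arc) : nat := e.1.2.
Definition fw (e : arc) : nat := e.2.2.1.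
Definition bw (e : arc) : nat := e.2.2.2.

Definition push_fw (e : arc) : arc := (e.1, (e.2.1, ((fw e).-1, (bw e).+1))).
Definition push_bw (e : arc) : arc := (e.1, (e.2.1, ((fw e).+1, (bw e).-1))).

Definition fw_from (x y : nat) (e : arc) : bool := [&& tail e == x, head e == y & 0 < fw e].
Definition bw_from (x y : nat) (e : arc) : bool := [&& tail e == y, head e == x & 0 < bw e].

(** Several arcs may join [x] and [y]; stopping at the first one with residual capacity moves a
    single unit. *)
Fixpoint push1 (x y : nat) (E : seq arc) : seq arc :=
  if E is e :: E' then
    if fw_from x y e then push_fw e :: E'
    else if bw_from x y e then push_bw e :: E'
    else e :: push1 x y E'
  else [::].

(* [L] lists pairs (node, predecessor), latest first; the terminals below [k]
   are the starting points of the search. *)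
Definition reached (k : nat) (L : seq (nat * nat)) (y : nat) : bool :=
  (y < k) || has (fun p => p.1 == y) L.

Definition relax (k x y : nat) (L : seq (nat * nat)) :=
  if reached k L x && ~~ reached k L y then (y, x) :: L else L.

Definition relax_fw (k : nat) (L : seq (nat * nat)) (e : arc) :=
  if 0 < fw e then relax k (tail e) (head e) L else L.

Definition relax_bw (k : nat) (L : seq (nat * nat)) (e : arc) :=
  if 0 < bw e then relax k (head e) (tail e) L else L.

Definition relax_arc (k : nat) (L : seq (nat * nat)) (e : arc) :=
  relax_bw k (relax_fw k L e) e.

Definition round (k : nat) (E : seq arc) (L : seq (nat * nat)) := foldl (relax_arc k) L E.

(** Rounds over all arcs in the style of Bellman and Ford; the length of [fuel] is the number of
    rounds. *)
Definition search (k : nat) (fuel E : seq arc) : seq (nat * nat) :=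
  foldl (fun L _ => round k E L) [::] fuel.

(* The first component is 0 as long as no target has been met, and the
   successor of the current node afterwards. *)
Definition aug_step (st : nat * seq arc) (p : nat * nat) : nat * seq arc :=
  if (if st.1 == 0 then p.1 < 4 else st.1 == p.1.+1)
  then (p.2.+1, push1 p.2 p.1 st.2) else st.

(** As nodes are listed latest first, the predecessor of a node stands further down the list, and
    one pass traces a whole path backwards. It ends by itself at a start terminal, which is never
    listed. *)
Definition augment (k : nat) (fuel E : seq arc) : seq arc :=
  (foldl aug_step (0, E) (search k fuel E)).2.

Definition improve (fuel E : seq arc) : seq arc :=
  augment 3 fuel (augment 2 fuel (augment 1 fuel E)).

(** The next capacity bit goes to the residual part [fw], so the doubled flow remains feasible. *)
Definition double_arc (e : arc) : arc :=
  (e.1, (behead e.2.1, (seq.head false e.2.1 + (fw e).*2, (bw e).*2))).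

Definition phase (fuel E : seq arc) : seq arc :=
  foldl (fun E _ => improve fuel E) [seq double_arc e | e <- E] fuel.

Definition max_flow (K : bitseq) (fuel E : seq arc) : seq arc :=
  foldl (fun E _ => phase fuel E) E K.

Lemma foldl_iter (A B : Type) (f : A -> A) (a : A) (l : seq B) :
  foldl (fun a _ => f a) a l = iter (size l) f a.
Proof. by elim: l a => //= _ l IH a; rewrite IH -iterSr. Qed.

Section Network.
Local Open Scope ring_scope.

Definition net_arc (e : arc) (v : nat) : int :=
  (bw e)%:Z * ((head e == v : nat)%:Z - (tail e == v : nat)%:Z).

Definition net (E : seq arc) (v : nat) : int := \sum_(e <- E) net_arc e v.

(** The invariant of pushing: two flows are flows in the same network when their profiles agree. *)
Definition profile (E : seq arc) := [seq (e.1, e.2.1, (fw e + bw e)%N) | e <- E].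

Definition resid (E : seq arc) (x y : nat) : bool :=
  has (fun e => fw_from x y e || bw_from x y e) E.

Lemma push1_profile x y E : profile (push1 x y E) = profile E.
Proof.
elim: E => //= -[[t h] [bs [f b]]] E IH.
case: ifP => [/and3P[_ _ f_gt0]|_] /=.
  by congr cons; rewrite /push_fw /fw /bw /= in f_gt0 *; congr (_, _); lia.
case: ifP => [/and3P[_ _ b_gt0]|_] /=; last by rewrite IH.
by congr cons; rewrite /push_bw /fw /bw /= in b_gt0 *; congr (_, _); lia.
Qed.

Lemma net_push1 x y E v : resid E x y ->
  net (push1 x y E) v = net E v + (v == y : nat)%:Z - (v == x : nat)%:Z.
Proof.
rewrite /net; elim: E => //= -[[t h] [bs [f b]]] E IH.
case: ifP => [/and3P[/eqP <- /eqP <- f_gt0] _|_ /=].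
  rewrite !big_cons /net_arc /tail /head /bw /= ![v == _]eq_sym intS; ring.
case: ifP => [/and3P[/eqP <- /eqP <- b_gt0] _|_ /= /IH IH'].
  rewrite !big_cons /net_arc /tail /head /bw /= ![v == _]eq_sym.
  by rewrite /bw /= in b_gt0; case: (b) b_gt0 => //= n _; rewrite intS; ring.
by rewrite !big_cons IH'; ring.
Qed.

(** A push changes a single arc, with both ends among [x] and [y]; residual arcs leaving a third
    node do not notice it. *)
Lemma resid_push1 x y E x' y' : x' != x -> x' != y ->
  resid (push1 x y E) x' y' = resid E x' y'.
Proof.
move=> xx xy; elim: E => //= -[[t h] [bs [f b]]] E IH.
have nx : x == x' = false by rewrite eq_sym (negPf xx).
have ny : y == x' = false by rewrite eq_sym (negPf xy).
have noE e : tail e \in [:: x; y] -> head e \in [:: x; y] ->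
    fw_from x' y' e || bw_from x' y' e = false.
  by rewrite !inE /fw_from /bw_from => /orP[]/eqP-> /orP[]/eqP->;
    rewrite ?nx ?ny /= ?andbF.
case: ifP => [/and3P[/eqP tE /eqP hE _]|_] /=.
  by rewrite /tail /head /= in tE hE; rewrite !noE /tail /head /= ?tE ?hE ?inE ?eqxx ?orbT.
case: ifP => [/and3P[/eqP tE /eqP hE _]|_] /=.
  by rewrite /tail /head /= in tE hE; rewrite !noE /tail /head /= ?tE ?hE ?inE ?eqxx ?orbT.
by rewrite IH.
Qed.

(** Listed nodes are distinct and predecessors are older, so predecessor chains are simple residual
    paths leading back to a terminal below [k]. *)
Fixpoint search_tree (k : nat) (E : seq arc) (L : seq (nat * nat)) : bool :=
  if L is (y, x) :: L' then
    [&& resid E x y, reached k L' x, ~~ reached k L' y & search_tree k E L']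
  else true.

Lemma reached_cons k p L y : reached k (p :: L) y = (p.1 == y) || reached k L y.
Proof. by rewrite /reached /= orbCA. Qed.

(** Walks back from [v] along a path found in [E], while earlier pushes have turned [E] into [E1].
    Residual arcs out of reached nodes other than [v] must still agree. The invariant survives the
    push from [x] to [v], because [v] is not reached by the rest of the list, so only arcs out of
    the next current node [x] become doubtful. *)
Lemma aug_path k E E1 L v : search_tree k E L -> reached k L v ->
  (forall x y, reached k L x -> x != v -> resid E1 x y = resid E x y) ->
  exists2 a, (a < k)%N & forall u, net (foldl aug_step (v.+1, E1) L).2 u =
    net E1 u + (u == v : nat)%:Z - (u == a : nat)%:Z.
Proof.
elim: L v E1 => [|[y x] L IH] v E1 /=.
  by move=> _; rewrite /reached /= orbF => lt _; exists v => // u; lia.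
move=> /and4P[res_xy reach_x unreach_y tree_L] reach_v agree.
rewrite /aug_step /= eqSS; case: eqP => [eq_vy|/eqP neq_vy]; last first.
  apply: IH => // [|x' y' reach' neq'].
    by move: reach_v; rewrite reached_cons /= eq_sym (negPf neq_vy).
  by apply: agree => //; rewrite reached_cons reach' orbT.
rewrite -/(aug_step) -eq_vy in res_xy unreach_y *.
have neq_xv : x != v by apply: contraNneq unreach_y => <-.
have res1 : resid E1 x v by rewrite agree // reached_cons reach_x orbT.
have [x' y' reach' neq'|a lt_a net_a] := IH x (push1 x v E1) tree_L reach_x.
  have neq'v : x' != v by apply: contraNneq unreach_y => <-.
  by rewrite resid_push1 // agree // reached_cons reach' orbT.
by exists a => // u; rewrite net_a net_push1 //; lia.
Qed.

Lemma aug_search k E L : search_tree k E L -> k != 0%N ->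
  (forall y, (y < 4)%N -> reached k L y -> (y < k)%N) /\ (foldl aug_step (0%N, E) L).2 = E \/
  exists a b, [/\ (a < k)%N, (k <= b < 4)%N & forall u,
    net (foldl aug_step (0%N, E) L).2 u = net E u + (u == b : nat)%:Z - (u == a : nat)%:Z].
Proof.
move=> + k_gt0; elim: L => [|[y x] L IH] /=.
  by move=> _; left; split=> // y _; rewrite /reached orbF.
move=> /and4P[res_xy reach_x unreach_y tree_L]; rewrite /aug_step /= -/aug_step.
case: ltnP => [lt_y4|le_4y]; last first.
  case: (IH tree_L) => [[hL ->]|]; [left; split=> // u lt_u|by right].
  by rewrite reached_cons /= => /orP[/eqP eq_yu|]; [lia | apply: hL].
right; have neq_xy : x != y by apply: contraNneq unreach_y => <-.
have [x' y' reach' neq'|a lt_a net_a] := aug_path (E1 := push1 x y E) tree_L reach_x.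
  by rewrite resid_push1 //; apply: contraNneq unreach_y => <-.
exists a, y; split=> //; last by move=> u; rewrite net_a net_push1 //; lia.
by rewrite lt_y4 andbT leqNgt; apply: contra unreach_y => lt; rewrite /reached lt.
Qed.

Lemma relax_tree k x y E L : search_tree k E L -> resid E x y -> search_tree k E (relax k x y L).
Proof. by move=> tree_L res; rewrite /relax; case: ifP => //= /andP[-> ->]; rewrite res tree_L. Qed.

Lemma relax_arc_tree k e E L : e \in E -> search_tree k E L -> search_tree k E (relax_arc k L e).
Proof.
move=> eE tree_L; rewrite /relax_arc /relax_bw /relax_fw.
have tree1 : search_tree k E (if 0 < fw e then relax k (tail e) (head e) L else L)%N.
  case: ifP => // f_gt0; apply: relax_tree => //.
  by apply/hasP; exists e; rewrite // /fw_from !eqxx f_gt0.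
case: ifP => // b_gt0; apply: relax_tree => //.
by apply/hasP; exists e; rewrite // /bw_from !eqxx b_gt0 orbT.
Qed.

Lemma search_treeP k fuel E : search_tree k E (search k fuel E).
Proof.
rewrite /search; elim: fuel [::] (isT : search_tree k E [::]) => //= _ fuel IH L tree_L.
apply: IH; rewrite /round.
suff main E' : {subset E' <= E} -> search_tree k E (foldl (relax_arc k) L E') by exact: main.
elim: E' L tree_L => //= e E' IH L tree_L sub.
apply: IH => [|x xE']; last by apply: sub; rewrite inE xE' orbT.
by apply: relax_arc_tree => //; apply: sub; rewrite inE eqxx.
Qed.

Lemma relax_size k x y L : (size L <= size (relax k x y L))%N /\
  ((size (relax k x y L) <= size L)%N -> relax k x y L = L /\ (reached k L x -> reached k L y)).
Proof.
rewrite /relax; case: ifP => [_|/negP h] /=; split=> //; first by lia.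
by move=> _; split=> // hx; apply: contraT => hy; case: h; rewrite hx.
Qed.

(** No residual arc, in either direction along [e], leaves [R]. *)
Definition closed_at (R : pred nat) (e : arc) : Prop :=
  ((0 < fw e)%N -> R (tail e) -> R (head e)) /\ ((0 < bw e)%N -> R (head e) -> R (tail e)).

Lemma relax_arc_size k L e : (size L <= size (relax_arc k L e))%N /\
  ((size (relax_arc k L e) <= size L)%N -> relax_arc k L e = L /\ closed_at (reached k L) e).
Proof.
have [le1 eq1] : (size L <= size (relax_fw k L e))%N /\
    ((size (relax_fw k L e) <= size L)%N -> relax_fw k L e = L /\
      ((0 < fw e)%N -> reached k L (tail e) -> reached k L (head e))).
  rewrite /relax_fw; case: ifP => _; last by split.
  by have [-> h] := relax_size k (tail e) (head e) L; split=> // /h[-> ?].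
have [le2 eq2] : let L1 := relax_fw k L e in (size L1 <= size (relax_bw k L1 e))%N /\
    ((size (relax_bw k L1 e) <= size L1)%N -> relax_bw k L1 e = L1 /\
      ((0 < bw e)%N -> reached k L1 (head e) -> reached k L1 (tail e))).
  rewrite /relax_bw; case: ifP => _; last by split.
  by have [-> h] := relax_size k (head e) (tail e) (relax_fw k L e); split=> // /h[-> ?].
rewrite /relax_arc; split; first exact: leq_trans le1 le2.
move=> le; have [|e1 c1] := eq1; first by lia.
have [|e2 c2] := eq2; first by lia.
by rewrite e2 e1 in c2 *; split.
Qed.

(** The list never shrinks, so a round that does not lengthen it has relaxed every arc without
    effect, which is closedness. *)
Lemma round_size k E L : (size L <= size (round k E L))%N /\
  ((size (round k E L) <= size L)%N ->
    round k E L = L /\ forall e, e \in E -> closed_at (reached k L) e).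
Proof.
rewrite /round; elim: E L => [|e E IH] L //=.
have [le1 eq1] := relax_arc_size k L e; have [le2 eq2] := IH (relax_arc k L e).
split; first exact: leq_trans le1 le2.
move=> le; have [|e1 c1] := eq1; first by lia.
have [|e2 c2] := eq2; first by lia.
rewrite e1 in e2 c2; rewrite e1 e2; split=> // e'.
by rewrite inE => /orP[/eqP->|/c2].
Qed.

(** The listed nodes are distinct, and each is an end of some arc. *)
Lemma tree_size k E L : search_tree k E L -> (size L <= (size E).*2)%N.
Proof.
move=> tree_L; pose N := [seq tail e | e <- E] ++ [seq head e | e <- E].
have -> : (size E).*2 = size N by rewrite size_cat !size_map addnn.
rewrite -(size_map fst); apply: uniq_leq_size.
  elim: L tree_L => //= -[y x] L IH /and4P[_ _ unreach_y /IH->]; rewrite andbT /=.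
  apply: contra unreach_y => /mapP[p pL ->]; apply/orP; right.
  by apply/hasP; exists p.
move=> v /mapP[p pL ->] {v}.
elim: L tree_L pL => //= -[y x] L IH /and4P[/hasP[e eE res] _ _ /IH {}IH].
rewrite inE => /orP[/eqP->|/IH //] /=; rewrite mem_cat.
case/orP: res => /and3P[/eqP tE /eqP hE _]; apply/orP; [right | left].
  by rewrite -hE map_f.
by rewrite -tE map_f.
Qed.

Lemma search_closed k fuel E : ((size E).*2 < size fuel)%N || (E == [::]) ->
  forall e, e \in E -> closed_at (reached k (search k fuel E)) e.
Proof.
case/orP=> [le_fuel|/eqP-> //].
(* Every round either finds the reached set closed or lists another node, and by [tree_size] the
   second case cannot occur [size fuel] times. *)
suff main n : (forall e, e \in E -> closed_at (reached k (iter n (round k E) [::])) e) \/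
    (n <= size (iter n (round k E) [::]))%N.
  have eq_iter : search k fuel E = iter (size fuel) (round k E) [::].
    exact: foldl_iter.
  case: (main (size fuel)); rewrite -eq_iter // => le.
  have := leq_ltn_trans (leq_trans le (tree_size (search_treeP k fuel E))) le_fuel.
  by rewrite ltnn.
elim: n => [|n IH]; first by right.
have [le eq] := round_size k E (iter n (round k E) [::]).
case: (leqP (size (iter n.+1 (round k E) [::])) (size (iter n (round k E) [::]))) =>
  [/eq[e1 c1]|lt].
  by left; rewrite iterS e1.
case: IH => [c|le_n]; last by right; rewrite /= in lt *; lia.
left; rewrite iterS.
suff -> : round k E (iter n (round k E) [::]) = iter n (round k E) [::] by [].
move: {lt le eq} (iter _ _ _) c => L c; rewrite /round.
elim: (E) c => //= e E' IH c; rewrite (_ : relax_arc k L e = L).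
  by apply: IH => e' he'; apply: c; rewrite inE he' orbT.
have [c1 c2] := c e (mem_head _ _).
have rel x y : (reached k L x -> reached k L y) -> relax k x y L = L.
  by move=> h; rewrite /relax; case: ifP => // /andP[/h->].
have e1 : relax_fw k L e = L by rewrite /relax_fw; case: ifP => // /c1/rel.
by rewrite /relax_arc e1 /relax_bw; case: ifP => // /c2/rel.
Qed.
End Network.

(** * Optimality and scaling *)

Section MaxFlow.
Local Open Scope ring_scope.
Implicit Types (E : seq arc) (S : pred nat).

Definition conserved E : Prop := forall v, (4 <= v)%N -> net E v = 0.

(** For conserved flows in the pricing network, k = 1, 2, 3 give the throughput of the fixed
    vertices of A, the total flow and the throughput of the fixed vertices of B. *)
Definition upflow (k : nat) E : int := - \sum_(v < k) net E v.

Definition separates (k : nat) S : Prop := forall v, (v < 4)%N -> S v = (v < k)%N.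

Definition cut_closed (k : nat) E : Prop :=
  exists2 S, separates k S & forall e, e \in E -> closed_at S e.

Definition cut_cap E S : nat :=
  (\sum_(e <- E | S (tail e) && ~~ S (head e)) (fw e + bw e))%N.

(** Summation by parts: conservation removes the inner nodes, so only the four terminals remain.
    With the indicator of a set as [g], the left side measures the flow across a cut. *)
Lemma potential E (g : nat -> int) : conserved E ->
  \sum_(e <- E) (bw e)%:Z * (g (head e) - g (tail e)) = \sum_(v < 4) g v * net E v.
Proof.
move=> consE.
(* A common bound on the node numbers turns the sum over nodes into a finite one, which can be
   exchanged with the sum over arcs. *)
have [n ge_n4 lt_n] : exists2 n, (4 <= n)%N & forall e, e \in E -> (tail e < n)%N && (head e < n)%N.
  elim: (E) => [|e E' [n ge_n4 lt_n]]; first by exists 4%N.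
  exists (n + tail e + head e).+1; first by lia.
  move=> e'; rewrite inE => /orP[/eqP->|/lt_n /andP[]]; lia.
have -> : \sum_(v < 4) g v * net E v = \sum_(v < n) g v * net E v.
  rewrite -!(big_mkord xpredT (fun v => g v * net E v)) (big_cat_nat (leq0n 4) ge_n4) //=.
  rewrite [X in _ = _ + X]big_nat [X in _ = _ + X]big1 ?addr0 // => v /andP[le4v _].
  by rewrite consE // mulr0.
under [RHS]eq_bigr do rewrite /net mulr_sumr.
rewrite exchange_big /= big_seq [RHS]big_seq; apply: eq_bigr => e /lt_n /andP[lt_t lt_h].
have delta (u : nat) : (u < n)%N -> \sum_(v < n) g v * (u == v : nat)%:Z = g u.
  move=> lt_u; rewrite (bigD1 (Ordinal lt_u)) //= eqxx mulr1 big1 ?addr0 // => v.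
  by rewrite -val_eqE /= eq_sym => /negPf->; rewrite mulr0.
rewrite /net_arc -{1}(delta _ lt_h) -{1}(delta _ lt_t) -sumrB mulr_sumr.
by apply: eq_bigr => v _; ring.
Qed.

Lemma upflow_pot k E S : (k < 4)%N -> conserved E -> separates k S ->
  upflow k E = \sum_(e <- E) (bw e)%:Z * ((S (tail e) : nat)%:Z - (S (head e) : nat)%:Z).
Proof.
move=> lt_k4 consE sepS.
have -> : \sum_(e <- E) (bw e)%:Z * ((S (tail e) : nat)%:Z - (S (head e) : nat)%:Z) =
    - \sum_(e <- E) (bw e)%:Z * ((S (head e) : nat)%:Z - (S (tail e) : nat)%:Z).
  by rewrite -sumrN; apply: eq_bigr => e _; ring.
rewrite (potential (fun v => (S v : nat)%:Z)) // /upflow; congr (- _).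
rewrite -(big_mkord xpredT (fun v => net E v)).
rewrite -(big_mkord xpredT (fun v => (S v : nat)%:Z * net E v)) (big_cat_nat (leq0n k)
  (ltnW lt_k4)) //=.
rewrite [X in _ = _ + X]big_nat [X in _ = _ + X]big1 ?addr0 => [|v /andP[le_kv lt_v4]]; last first.
  by rewrite sepS // ltnNge le_kv mul0r.
by rewrite [RHS]big_nat big_nat; apply: eq_bigr => v /andP[_ lt_vk];
  rewrite sepS ?lt_vk ?mul1r //; lia.
Qed.

Lemma upflow_le_cut k E S : (k < 4)%N -> conserved E -> separates k S ->
  upflow k E <= (cut_cap E S)%:Z.
Proof.
move=> lt_k4 consE sepS; rewrite (upflow_pot lt_k4 consE sepS) /cut_cap.
rewrite (big_morph Posz PoszD (erefl _)) [leRHS]big_mkcond /=.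
by apply: ler_sum => e _; case: (S (tail e)); case: (S (head e)) => /=; lia.
Qed.

(** Closedness is complementary slackness: arcs leaving [S] have no residual capacity left, and arcs
    entering it carry no flow. *)
Lemma upflow_eq_cut k E S : (k < 4)%N -> conserved E -> separates k S ->
  (forall e, e \in E -> closed_at S e) -> upflow k E = (cut_cap E S)%:Z.
Proof.
move=> lt_k4 consE sepS closedS; rewrite (upflow_pot lt_k4 consE sepS) /cut_cap.
rewrite (big_morph Posz PoszD (erefl _)) [RHS]big_mkcond /=.
rewrite big_seq [RHS]big_seq; apply: eq_bigr => e /closedS [hf hb].
case: (S (tail e)) hf hb; case: (S (head e)) => /= hf hb; [lia| | |lia].
  by case: (fw e) hf => [|n /(_ isT isT)] //; lia.
by case: (bw e) hb => [|n /(_ isT isT)] //; lia.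
Qed.

Lemma cut_cap_profile E E' S : profile E = profile E' -> cut_cap E S = cut_cap E' S.
Proof.
rewrite /cut_cap => eqE.
suff cutE E0 : (\sum_(e <- E0 | S (tail e) && ~~ S (head e)) (fw e + bw e) =
    \sum_(x <- profile E0 | S x.1.1.1 && ~~ S x.1.1.2) x.2)%N by rewrite !cutE eqE.
by rewrite big_map.
Qed.

Lemma size_profile E E' : profile E = profile E' -> size E = size E'.
Proof. by move=> /(congr1 size); rewrite !size_map. Qed.

Lemma aug_profile c E L : profile (foldl aug_step (c, E) L).2 = profile E.
Proof.
elim: L c E => //= p L IH c E; rewrite /aug_step /=; case: ifP => _; rewrite IH //.
exact: push1_profile.
Qed.

Definition enough (fuel E : seq arc) : bool := ((size E).*2 < size fuel)%N || (E == [::]).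

Lemma enough_profile fuel E E' : profile E = profile E' -> enough fuel E' -> enough fuel E.
Proof. by move=> /size_profile eq_s; rewrite /enough -!size_eq0 eq_s. Qed.

(** A unit sent from terminal [a] to terminal [b] changes the [j]-th upflow by [a < j] - [b < j]. As
    a < k <= b, this is never negative and equals 1 for j = k: the three objectives do not
    conflict. *)
Lemma augmentP k fuel E (E' := augment k fuel E) : (0 < k < 4)%N -> enough fuel E -> conserved E ->
  [/\ profile E' = profile E, conserved E',
      forall j, (0 < j < 4)%N -> upflow j E <= upflow j E' &
      upflow k E < upflow k E' \/ E' = E /\ cut_closed k E].
Proof.
move=> /andP[k_gt0 lt_k4] fuelE consE; rewrite {}/E' /augment; set L := search k fuel E.
have k_neq0 : k != 0%N by rewrite -lt0n.
have profE := aug_profile 0 E L.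
have [[levels eqE]|[a [b [lt_ak /andP[le_kb lt_b4] netE]]]] :=
    aug_search (search_treeP k fuel E) k_neq0; rewrite -/L in profE *.
  rewrite eqE; split=> //; right; split=> //; exists (reached k L); last exact: search_closed.
  move=> v lt_v4; apply/idP/idP; last by rewrite /reached => ->.
  exact: levels.
have upE j : (j < 4)%N -> upflow j (foldl aug_step (0%N, E) L).2 =
    upflow j E + ((a < j)%N : nat)%:Z - ((b < j)%N : nat)%:Z.
  move=> lt_j4; rewrite /upflow.
  under eq_bigr do rewrite netE.
  rewrite !big_split /= sumrN.
  have delta (u : nat) : \sum_(v < j) ((v : nat) == u : nat)%:Z = ((u < j)%N : nat)%:Z.
    case: ltnP => [lt_u|le_ju].
      rewrite (bigD1 (Ordinal lt_u)) //= eqxx big1 ?addr0 // => v.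
      by rewrite -val_eqE /= => /negPf->.
    by rewrite big1 // => v _; rewrite [_ == _](_ : _ = false) //; have := ltn_ord v; lia.
  by rewrite !delta; ring.
split=> //.
- move=> v le4v; rewrite netE consE //.
  have -> : (v == b) = false by lia.
  by have -> : (v == a) = false by lia.
- by move=> j /andP[_ lt_j4]; rewrite upE //; lia.
by left; rewrite upE // lt_ak; lia.
Qed.

(** An integer measure of progress: no objective ever drops, so each effective augmentation raises
    the sum. *)
Definition total_upflow E : int := upflow 1 E + upflow 2 E + upflow 3 E.

Definition optimal E : Prop := forall k, (0 < k < 4)%N -> cut_closed k E.

Lemma improveP fuel E (E' := improve fuel E) : enough fuel E -> conserved E ->
  [/\ profile E' = profile E, conserved E' &
      total_upflow E < total_upflow E' \/ E' = E /\ optimal E].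
Proof.
move=> fuelE consE; rewrite {}/E' /improve.
have [//|//|//|p1 c1 u1 i1] := @augmentP 1 fuel E.
have [//||//|p2 c2 u2 i2] := @augmentP 2 fuel (augment 1 fuel E).
  exact: enough_profile fuelE.
have [//||//|p3 c3 u3 i3] := @augmentP 3 fuel (augment 2 fuel (augment 1 fuel E)).
  by apply: enough_profile fuelE; rewrite p2.
split=> //; first by rewrite p3 p2.
have [[a1 a2] a3] := (u1 1%N isT, u1 2%N isT, u1 3%N isT).
have [[b1 b2] b3] := (u2 1%N isT, u2 2%N isT, u2 3%N isT).
have [[d1 d2] d3] := (u3 1%N isT, u3 2%N isT, u3 3%N isT).
rewrite /total_upflow.
case: i1 => [i1|[e1 o1]]; first by left; lia.
case: i2 => [i2|[e2 o2]]; first by left; lia.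
case: i3 => [i3|[e3 o3]]; first by left; lia.
right; rewrite e3 e2 e1; split=> //.
rewrite e1 in o2; rewrite e2 e1 in o3.
by case=> [|[|[|[|k]]]].
Qed.

Lemma optimal_le E E' : conserved E -> conserved E' -> profile E = profile E' ->
  optimal E -> total_upflow E' <= total_upflow E.
Proof.
move=> consE consE' eq_p opt.
have le k : (0 < k < 4)%N -> upflow k E' <= upflow k E.
  move=> /andP[k_gt0 lt_k4]; have [|S sepS clS] := opt k; first by rewrite k_gt0.
  rewrite (upflow_eq_cut lt_k4 consE sepS clS) (cut_cap_profile _ eq_p).
  exact: upflow_le_cut.
by have := (le 1%N isT, le 2%N isT, le 3%N isT); rewrite /total_upflow => -[[]]; lia.
Qed.
Lemma iter_improve fuel E n : enough fuel E -> conserved E ->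
  let E' := iter n (improve fuel) E in
  [/\ profile E' = profile E, conserved E' &
      total_upflow E + n%:Z <= total_upflow E' \/ optimal E'].
Proof.
move=> fuelE consE; elim: n => [|n [pn cn in_]] /=; first by split=> //; left; lia.
have [||p c i] := @improveP fuel (iter n (improve fuel) E) => //.
  exact: enough_profile fuelE.
split=> //; first by rewrite p.
case: in_ => [le|opt]; case: i => [lt|[eq opt']]; rewrite ?eq; [left; lia|by right| |by right].
(* An optimal flow cannot be improved further, its total being maximal among the flows of its
   profile. *)
exfalso; have := optimal_le cn c (esym p) opt; lia.
Qed.
End MaxFlow.

(** * Bit scaling *)

Section Scaling.
Local Open Scope ring_scope.
Implicit Types (E : seq arc) (S : pred nat).

Lemma net_double E v : net [seq double_arc e | e <- E] v = 2 * net E v.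
Proof.
rewrite /net big_map mulr_sumr; apply: eq_bigr => e _.
by rewrite /net_arc /double_arc /head /tail /bw /= -muln2; lia.
Qed.

Lemma upflow_double k E : upflow k [seq double_arc e | e <- E] = 2 * upflow k E.
Proof.
by rewrite /upflow mulrN mulr_sumr; congr (- _); apply: eq_bigr => v _; rewrite net_double.
Qed.

Lemma cut_cap_double E S :
  (cut_cap [seq double_arc e | e <- E] S <= 2 * cut_cap E S + size E)%N.
Proof.
rewrite /cut_cap big_map big_mkcond [X in (2 * X)%N]big_mkcond big_distrr /= -sum1_size.
rewrite -big_split /=; apply: leq_sum => e _.
rewrite /double_arc /head /tail /fw /bw /=.
by case: ifP => _ //; case: (seq.head _ _); rewrite -!muln2; lia.
Qed.

(** For each [k], the old optimum supplies a cut matched by the old flow. After doubling, the flow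
    value is twice its old capacity, while the appended bits raise its capacity by at most one per
    arc. The three objectives thus gain at most [3 * size E] in total, which is the length of
    [fuel]. *)
Lemma phaseP fuel E (E' := phase fuel E) : size fuel = (3 * size E)%N ->
  conserved E -> optimal E ->
  [/\ profile E' = profile [seq double_arc e | e <- E], conserved E' & optimal E'].
Proof.
move=> size_f consE optE; rewrite {}/E' /phase.
set E1 := [seq _ | e <- E].
have cons1 : conserved E1 by move=> v /consE; rewrite net_double => ->; rewrite mulr0.
have fuel1 : enough fuel E1.
  by rewrite /enough -size_eq0 size_map size_f; lia.
rewrite foldl_iter.
have [p c [le|//]] := iter_improve (size fuel) fuel1 cons1; split=> //.
move: p c le; move: (iter _ _ _) => E2 p c le.
have fuel2 : enough fuel E2 by apply: enough_profile fuel1.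
have bound E3 : conserved E3 -> profile E3 = profile E1 ->
    total_upflow E3 <= total_upflow E1 + (size fuel)%:Z.
  move=> c3 p3.
  have le3 k : (0 < k < 4)%N -> upflow k E3 <= 2 * upflow k E + (size E)%:Z.
    move=> /andP[k_gt0 lt_k4]; have [|S sepS clS] := optE k; first by rewrite k_gt0.
    rewrite (upflow_eq_cut lt_k4 consE sepS clS).
    apply: (le_trans (upflow_le_cut lt_k4 c3 sepS)); rewrite (cut_cap_profile S p3).
    by have := cut_cap_double E S; rewrite -/E1; lia.
  have [[l1 l2] l3] := (le3 1%N isT, le3 2%N isT, le3 3%N isT).
  by rewrite /total_upflow !upflow_double size_f; lia.
(* The whole possible gain has been realized. One more improvement would exceed the bound, so it
   must be idle, which certifies optimality. *)
have [p' c' [lt|[_ //]]] := improveP fuel2 c.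
by have le' := bound _ c' (etrans p' p); exfalso; lia.
Qed.

(** Each phase appends one bit to every capacity, so the final capacities are the Horner values of
    the bit lists. *)
Lemma max_flowP (K : bitseq) (fuel E E' : seq arc) : E' = max_flow K fuel E ->
  size fuel = (3 * size E)%N -> (forall e, e \in E -> size e.2.1 = size K) ->
  conserved E -> optimal E ->
  [/\ [seq (e.1, (fw e + bw e)%N) | e <- E'] =
      [seq (e.1, foldl (fun v (b : bool) => (b + v.*2)%N) (fw e + bw e)%N e.2.1) | e <- E],
      conserved E' & optimal E'].
Proof.
move=> ->; rewrite /max_flow; elim: K E => /= [|_ K IH] E size_f size_b consE optE.
  split=> //; apply/eq_in_map => e /size_b/size0nil ->; by [].
have [p c o] := phaseP size_f consE optE.
have size_p := size_profile p; rewrite size_map in size_p.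
have [|e|//|//|-> ? ?] := IH (phase fuel E); first by rewrite size_p.
  move=> /(map_f (fun e => (e.1, e.2.1, (fw e + bw e)%N))); rewrite -/(profile _) p.
  move=> /mapP[_ /mapP[e0 /size_b e0E ->] [_ -> _]] /=.
  by rewrite size_behead e0E.
split=> //.
have -> : [seq (e.1, foldl (fun v (b : bool) => (b + v.*2)%N) (fw e + bw e)%N e.2.1) |
    e <- phase fuel E] =
  [seq (x.1.1, foldl (fun v (b : bool) => (b + v.*2)%N) x.2 x.1.2) | x <- profile (phase fuel E)].
  by rewrite -map_comp.
rewrite p -!map_comp; apply/eq_in_map => e /size_b /=.
case: e => [a [[|b bs] [f g]]] //= _; rewrite /fw /bw /= doubleD addnA.
by [].
Qed.

(** Scaling starts from capacities 0, where every set of nodes is closed. *)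
Lemma zero_flow E : (forall e, e \in E -> fw e = 0%N /\ bw e = 0%N) -> conserved E /\ optimal E.
Proof.
move=> E0; split=> [v _|k k_lt].
  by rewrite /net big1_seq // => e /andP[_ /E0[_ b0]]; rewrite /net_arc b0 mul0r.
by exists (fun v => (v < k)%N) => // e /E0[f0 b0]; rewrite /closed_at f0 b0.
Qed.
End Scaling.

(** * Prices from a flow *)

Section Follower.
Local Open Scope ring_scope.
Variables (R : realType) (I : instance) (p : vertex I -> R).

(** There are finitely many covers, and the inner minimizer shows that the range of the maximization
    is nonempty. *)
Lemma follower_coverP : min_weight_cover p (follower_cover p) /\
  forall C, min_weight_cover p C -> revenue_of p C <= revenue p.
Proof.
have coverT : vertex_cover [set: vertex I].
  by apply/forallP => i; apply/forallP => j; rewrite !inE implybT.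
have [C0 cover0 min0] := @arg_minP _ _ _ setT (@vertex_cover I) (weight p) coverT.
have start : min_weight_cover p
    [arg min_(C < setT | vertex_cover C) weight p C]%O.
  case: arg_minP => //= C cC minC; rewrite /min_weight_cover cC /=.
  by apply/forallP => D; apply/implyP; apply: minC.
rewrite /revenue /follower_cover.
by case: (@arg_maxP _ _ _ _ (min_weight_cover p) (revenue_of p) start).
Qed.

Lemma weightE C : weight p C = \sum_(v in C | ~~ priceable v) ratr (cost v) + revenue_of p C.
Proof. by []. Qed.
End Follower.

(** * Revenue bounds from duality *)

Section Duality.
Local Open Scope ring_scope.
Variables (I : instance) (D F : nat) (f C : vertex I -> nat).
Hypothesis D_gt0 : (0 < D)%N.
Hypothesis costE : forall v : vertex I, ~~ priceable v -> cost v = (C v)%:R / D%:R.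
Hypothesis f_le : forall v : vertex I, ~~ priceable v -> (f v <= C v)%N.
Hypothesis f_cover : forall X : {set vertex I}, vertex_cover X -> (F <= \sum_(v in X) f v)%N.

(** Complementary slackness: under the prices [f], and up to the factor [D], such a cover attains
    the lower bound [F] on the weight of all covers. *)
Definition tight_cover (X : {set vertex I}) : Prop :=
  [/\ vertex_cover X, \sum_(v in X) f v = F & {in X, forall v, ~~ priceable v -> f v = C v}]%N.

Variables XA X0 XB : {set vertex I}.
Hypotheses (tightA : tight_cover XA) (tight0 : tight_cover X0) (tightB : tight_cover XB).
Hypothesis X0_fixed : {in X0, forall v, ~~ priceable v}.
Hypothesis XA_left : forall i, priceable (inl i : vertex I) -> (0 < f (inl i))%N -> inl i \in XA.
Hypothesis XB_right : forall j, priceable (inr j : vertex I) -> (0 < f (inr j))%N -> inr j \in XB.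

Variables (R : realType) (q : vertex I -> R).
Let p (v : vertex I) : R := ratr ((f v)%:R / D%:R).

Lemma revenue_flow : valid_prices q -> revenue q / 2 <= revenue p.
Proof.
move=> q_ge0.
have D0 : (0 : R) < D%:R by rewrite ltr0n.
have pE v : p v = (f v)%:R / D%:R by rewrite /p fmorph_div !rmorph_nat.
have costRE v : ~~ priceable v -> ratr (cost v) = (C v)%:R / D%:R :> R.
  by move=> fv; rewrite costE // fmorph_div !rmorph_nat.
have ratio_sum (X : {set vertex I}) (P : pred (vertex I)) (g : vertex I -> nat) :
    \sum_(v in X | P v) (g v)%:R / D%:R = (\sum_(v in X | P v) g v)%:R / D%:R :> R.
  by rewrite natr_sum mulr_suml.
have fixedE (X : {set vertex I}) : \sum_(v in X | ~~ priceable v) ratr (cost v) =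
    (\sum_(v in X | ~~ priceable v) C v)%:R / D%:R :> R.
  by rewrite -ratio_sum; apply: eq_bigr => v /andP[_ /costRE].
have revE (X : {set vertex I}) : revenue_of p X = (\sum_(v in X | priceable v) f v)%:R / D%:R :> R.
  by rewrite -ratio_sum; apply: eq_bigr => v _; rewrite pE.
have splitf (X : {set vertex I}) : (\sum_(v in X) f v =
    \sum_(v in X | ~~ priceable v) f v + \sum_(v in X | priceable v) f v)%N.
  by rewrite (bigID (fun v => ~~ priceable v)) /=; under [X in (_ + X)%N]eq_bigl do rewrite negbK.
have le_fC (X : {set vertex I}) : (\sum_(v in X | ~~ priceable v) f v <=
    \sum_(v in X | ~~ priceable v) C v)%N.
  by apply: leq_sum => v /andP[_ /f_le].
(* On a tight cover the weight is the flow through it, hence [F]; on any other cover the weight is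
   at least the flow through it, hence at least [F]. *)
have tight_min X : tight_cover X -> min_weight_cover p X.
  move=> [cX sumX eqX]; rewrite /min_weight_cover cX; apply/forallP => Y; apply/implyP => cY.
  rewrite !weightE !fixedE !revE -!mulrDl ler_pM2r ?invr_gt0 // -!natrD ler_nat.
  have -> : (\sum_(v in X | ~~ priceable v) C v = \sum_(v in X | ~~ priceable v) f v)%N.
    by apply: eq_bigr => v /andP[vX fv]; rewrite eqX.
  by rewrite -splitf sumX; apply: leq_trans (f_cover cY) _; rewrite splitf leq_add2r.
have [_ maxp] := follower_coverP p.
have revA := maxp _ (tight_min _ tightA); have revB := maxp _ (tight_min _ tightB).
have [minq _] := follower_coverP q.
(* The answer to [q] weighs at most as much as [X0], whose weight does not depend on prices. *)
have /andP[cq /forallP/(_ X0)/implyP] := minq; have [c0 sum0 eq0] := tight0 => /(_ c0).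
rewrite -/(revenue_of _ _) !weightE -/(revenue q).
have -> : revenue_of q X0 = 0.
  by rewrite /revenue_of big1 // => v /andP[/X0_fixed/negPf->].
rewrite addr0 !fixedE.
have -> : (\sum_(v in X0 | ~~ priceable v) C v = F)%N.
  rewrite -sum0 big_mkcondr /=; apply: eq_bigr => v vX0.
  by rewrite X0_fixed // eq0 // X0_fixed.
set Xq := follower_cover q in cq *.
move: revA revB; rewrite !revE.
set PA := (\sum_(v in XA | _) _)%N; set PB := (\sum_(v in XB | _) _)%N => revA revB le_q.
(* The flow through [Xq] is at least [F]. Its fixed part is at most the fixed costs; its priceable
   part is at most [PA + PB], since a priceable vertex with positive flow lies in [XA] if it is on
   the left and in [XB] if it is on the right. *)
have leF : (F <= \sum_(v in Xq | ~~ priceable v) C v + (PA + PB))%N.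
  apply: leq_trans (f_cover cq) _; rewrite splitf leq_add ?le_fC //.
  apply: (@leq_trans (\sum_(v : vertex I | priceable v) f v)).
    by rewrite [leqRHS](bigID (fun v => v \in Xq)) /= (eq_bigl _ _ (fun v => andbC _ _)) leq_addr.
  rewrite /PA /PB [\sum_(v in XA | _) _]big_mkcondl [\sum_(v in XB | _)
    _]big_mkcondl /= -big_split /=.
  apply: leq_sum => v prv; case: (posnP (f v)) => [->//|f_gt0].
  by case: v prv f_gt0 => [i /XA_left/[apply]->|j /XB_right/[apply]->]; rewrite ?leq_addr ?leq_addl.
set Cq := (\sum_(v in Xq | _) _)%N in le_q leF.
have: F%:R / D%:R <= Cq%:R / D%:R + PA%:R / D%:R + PB%:R / D%:R :> R.
  by rewrite -!mulrDl -!natrD ler_pM2r ?invr_gt0 // ler_nat -addnA.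
rewrite -/(revenue q) in le_q.
move: le_q revA revB; rewrite -/(revenue q).
move: (revenue q) (revenue p) (F%:R / D%:R) (Cq%:R / D%:R) (PA%:R / D%:R) (PB%:R / D%:R).
by move=> rq rp x0 x1 x2 x3; lra.
Qed.
End Duality.

(** * Cuts of the pricing network as vertex covers *)

Section PricingNetwork.
Local Open Scope ring_scope.
Variables (I : instance) (C : vertex I -> nat) (big : nat).
Variables (ea : 'I_(nA I) -> arc) (eb : 'I_(nB I) -> arc) (EE : seq arc).

Definition nodeA (i : 'I_(nA I)) : nat := 4 + i.
Definition nodeB (j : 'I_(nB I)) : nat := 4 + nA I + j.

Let E := [seq ea i | i <- enum 'I_(nA I)] ++ [seq eb j | j <- enum 'I_(nB I)] ++ EE.

Hypothesis eaE : forall i, (ea i).1 = (priceable (inl i : vertex I) : nat, nodeA i).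
Hypothesis ebE : forall j, (eb j).1 = (nodeB j, if priceable (inr j : vertex I) then 2 else 3).
Hypothesis ea_cap : forall i, (fw (ea i) + bw (ea i))%N =
  if priceable (inl i : vertex I) then big else C (inl i).
Hypothesis eb_cap : forall j, (fw (eb j) + bw (eb j))%N =
  if priceable (inr j : vertex I) then big else C (inr j).
Hypothesis EE_adj : forall e, e \in EE ->
  exists i j, [/\ adj i j, e.1 = (nodeA i, nodeB j) & (fw e + bw e)%N = big].
Hypothesis adj_EE : forall i j, adj i j -> exists2 e, e \in EE & e.1 = (nodeA i, nodeB j).
Hypothesis big_gt : (\sum_(v : vertex I | ~~ priceable v) C v < big)%N.
Hypotheses (consE : conserved E) (optE : optimal E).
Hypothesis fixed_cover : exists2 X : {set vertex I},
  vertex_cover X & {in X, forall v, ~~ priceable v}.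

Definition flow (v : vertex I) : nat :=
  match v with inl i => bw (ea i) | inr j => bw (eb j) end.

(** The classical correspondence, due to Kőnig, between cuts and vertex covers of a bipartite
    graph. *)
Let side (S : pred nat) : {set vertex I} :=
  [set v : vertex I | match v with inl i => ~~ S (nodeA i) | inr j => S (nodeB j) end].

Lemma mem_ea i : ea i \in E.
Proof. by rewrite mem_cat map_f ?mem_enum. Qed.

Lemma mem_eb j : eb j \in E.
Proof. by rewrite !mem_cat orbA orbC orbA [_ || (_ \in map eb _)]orbC map_f ?mem_enum. Qed.

Lemma mem_EE e : e \in EE -> e \in E.
Proof. by move=> eE; rewrite !mem_cat eE !orbT. Qed.

Lemma flow_le v : ~~ priceable v -> (flow v <= C v)%N.
Proof.
by case: v => [i|j] fv; [have := ea_cap i | have := eb_cap j]; rewrite (negPf fv) /flow => <-;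
  rewrite leq_addl.
Qed.

Lemma sum_E (G : arc -> int) : \sum_(e <- E) G e =
  \sum_i G (ea i) + \sum_j G (eb j) + \sum_(e <- EE) G e.
Proof. by rewrite /E !big_cat !big_map -!big_enum /= addrA. Qed.

Lemma sum_vertex (X : {set vertex I}) (g : vertex I -> nat) : (\sum_(v in X) g v =
  \sum_(i | inl i \in X) g (inl i) + \sum_(j | inr j \in X) g (inr j))%N.
Proof. by rewrite big_sumType. Qed.

(* Only the levels 0 and 1 lie in [S], so the terminal arcs leaving or entering
   a vertex of [side S] are exactly those crossing from [S] to its complement. *)
Lemma upflow_side (S : pred nat) : S 0%N -> S 1%N -> ~~ S 2%N -> ~~ S 3%N ->
  (\sum_(v in side S) flow v)%:Z = upflow 2 E +
  \sum_(e <- EE) (bw e)%:Z * ((S (head e) : nat)%:Z - (S (tail e) : nat)%:Z).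
Proof.
move=> S0 S1 /negPf S2 /negPf S3.
have := potential (fun v => (S v : nat)%:Z) consE.
rewrite sum_E !big_ord_recl big_ord0 /= S0 S1 S2 S3 /= => pot.
have -> : upflow 2 E = - (1 * net E 0 + 1 * net E 1).
  by rewrite /upflow !big_ord_recl big_ord0 /= !mul1r addr0.
move: pot; rewrite /bump /= !mul0r !addr0 => <-.
rewrite sum_vertex PoszD !(big_morph Posz PoszD (erefl _)).
have -> : \sum_(i | inl i \in side S) (flow (inl i))%:Z = - (\sum_i (bw (ea i))%:Z *
    ((S (head (ea i)) : nat)%:Z - (S (tail (ea i)) : nat)%:Z)).
  rewrite -sumrN big_mkcond; apply: eq_bigr => i _; rewrite inE /head /tail eaE /=.
  by case: priceable; rewrite /= ?S0 ?S1; case: (S (nodeA i)) => /=; ring.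
have -> : \sum_(j | inr j \in side S) (flow (inr j))%:Z = - (\sum_j (bw (eb j))%:Z *
    ((S (head (eb j)) : nat)%:Z - (S (tail (eb j)) : nat)%:Z)).
  rewrite -sumrN big_mkcond; apply: eq_bigr => j _; rewrite inE /head /tail ebE /=.
  by case: priceable; rewrite /= ?S2 ?S3; case: (S (nodeB j)) => /=; ring.
ring.
Qed.

(** Weak duality: the cut is chosen so that [side S] is [X]. Since [X] covers every edge, no arc
    between A and B leaves [S], and the correction term in [upflow_side] is nonnegative. *)
Lemma cover_upflow X : vertex_cover X -> upflow 2 E <= (\sum_(v in X) flow v)%:Z.
Proof.
move=> /forallP coverX.
pose S (n : nat) := [|| (n < 2)%N, [exists i, (n == nodeA i) && (inl i \notin X)] |
  [exists j, (n == nodeB j) && (inr j \in X)]].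
have SA i : S (nodeA i) = (inl i \notin X).
  rewrite /S /nodeA /=; apply/orP/idP => [[]|iX].
  - by case/existsP => i' /andP[/eqP eq_n]; have -> // : i = i' by apply: val_inj;
      rewrite /= /nodeA /nodeB in eq_n *; lia.
  - by case/existsP => j /andP[/eqP]; rewrite /nodeB; have := ltn_ord i; lia.
  by left; apply/existsP; exists i; rewrite eqxx.
have SB j : S (nodeB j) = (inr j \in X).
  rewrite /S /nodeB /=; apply/orP/idP => [[]|iX].
  - by case/existsP => i /andP[/eqP eq_n _]; have lt_i := ltn_ord i; rewrite /nodeA in eq_n;
      exfalso; lia.
  - by case/existsP => j' /andP[/eqP eq_n]; have -> // : j = j' by apply: val_inj;
      rewrite /= /nodeA /nodeB in eq_n *; lia.
  by right; apply/existsP; exists j; rewrite eqxx.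
have Slevel n : (2 <= n < 4)%N -> ~~ S n.
  move=> lt_n; apply/negP => /or3P[|/existsP[i /andP[/eqP eq_n _]]|/existsP[j /andP[/eqP eq_n _]]].
  - lia.
  - by rewrite eq_n /nodeA in lt_n; lia.
  by rewrite eq_n /nodeB in lt_n; lia.
have -> : X = side S.
  by apply/setP => -[i|j]; rewrite inE ?SA ?negbK ?SB.
rewrite upflow_side //; try by apply: Slevel.
rewrite lerDl big_seq; apply: sumr_ge0 => e /EE_adj[i [j [adj_ij eE _]]].
rewrite /head /tail eE SA SB /=; have /forallP/(_ j)/implyP/(_ adj_ij) := coverX i.
by case: (inl i \in X); case: (inr j \in X) => //=; lia.
Qed.

Lemma head_level e : e \in E -> (head e != 0%N) && (head e != 1%N).
Proof.
rewrite !mem_cat => /or3P[/mapP[i _ ->]|/mapP[j _ ->]|/EE_adj[i [j [_ eE _]]]].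
- by rewrite /head eaE.
- by rewrite /head ebE; case: ifP.
by rewrite /head eE.
Qed.

Lemma tail_level e : e \in E -> tail e != 2%N.
Proof.
rewrite !mem_cat => /or3P[/mapP[i _ ->]|/mapP[j _ ->]|/EE_adj[i [j [_ eE _]]]].
- by rewrite /tail eaE; case: priceable.
- by rewrite /tail ebE.
by rewrite /tail eE.
Qed.

(** No arc enters terminal 1 and none leaves terminal 2, so the upflow cannot decrease from k = 1 to
    k = 2 nor increase from k = 2 to k = 3. *)
Lemma upflow_le2 k : (0 < k < 4)%N -> upflow k E <= upflow 2 E.
Proof.
have net1 : net E 1 <= 0.
  rewrite /net big_seq; apply: sumr_le0 => e /head_level/andP[_ /negPf h1].
  by rewrite /net_arc h1 /=; case: (_ == _) => /=; lia.
have net2 : 0 <= net E 2.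
  rewrite /net big_seq; apply: sumr_ge0 => e /tail_level/negPf t2.
  by rewrite /net_arc t2 /=; case: (_ == _) => /=; lia.
rewrite /upflow -!(big_mkord xpredT (net E)).
by case: k => [|[|[|[|k]]]] // _; rewrite unlock /= ?addr0; lia.
Qed.

(** The assumed cover without priceable vertices caps the flow by the sum of the fixed costs; this
    makes [big] an effective infinity. *)
Lemma upflow_lt_big k : (0 < k < 4)%N -> upflow k E < big%:Z.
Proof.
move=> lt_k; have [X coverX fixedX] := fixed_cover.
apply: le_lt_trans (upflow_le2 lt_k) _; apply: le_lt_trans (cover_upflow coverX) _.
rewrite ltz_nat; apply: leq_ltn_trans big_gt.
rewrite [leqRHS](bigID (fun v => v \in X)) /=; apply: leq_trans (leq_addr _ _).
rewrite [leqRHS](eq_bigl (fun v => v \in X)) => [|v]; last first.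
  by case: (boolP (v \in X)) => [/fixedX->|]; rewrite ?andbF.
by apply: leq_sum => v /fixedX/flow_le.
Qed.

Section Cut.
Variables (k : nat) (S : pred nat).
Hypothesis k_bound : (0 < k < 4)%N.
Hypothesis sepS : separates k S.
Hypothesis closedS : forall e, e \in E -> closed_at S e.

(* An arc of capacity [big] leaving [S] would make the cut too expensive. *)
Lemma big_stays e : e \in E -> (fw e + bw e)%N = big -> S (tail e) -> S (head e).
Proof.
move=> eE e_big S_t; apply: contraT => S_h.
have := upflow_lt_big k_bound; have /andP[_ lt_k4] := k_bound.
rewrite (upflow_eq_cut lt_k4 consE sepS closedS) ltz_nat ltnNge => /negP[].
by rewrite -e_big /cut_cap (big_rem e) //= S_t S_h leq_addr.
Qed.

Definition cut_cover : {set vertex I} := side S.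

Lemma cut_cover_cover : vertex_cover cut_cover.
Proof.
apply/forallP => i; apply/forallP => j; apply/implyP => adj_ij; rewrite !inE.
have [e eEE eE] := adj_EE adj_ij.
have e_big : (fw e + bw e)%N = big by have [i' [j' []]] := EE_adj eEE.
have := big_stays (mem_EE eEE) e_big; rewrite /tail /head eE /=.
by case: (S _) => // /(_ isT)->.
Qed.

(** Arcs between A and B do not leave [S], by their capacity, and carry no flow into it, by
    closedness; so the correction term vanishes, and the value is the total flow whatever [k] is. *)
Lemma cut_cover_sum : (\sum_(v in cut_cover) flow v)%:Z = upflow 2 E.
Proof.
(* The cover does not depend on where the terminals lie; moving them to the position for k = 2 makes
   [upflow_side] applicable. *)
pose S' n := if (n < 4)%N then (n < 2)%N else S n.
have -> : cut_cover = side S' by apply/setP => -[i|j]; rewrite !inE.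
rewrite upflow_side // big_seq big1 ?addr0 // => e eEE.
have [i [j [_ eE e_big]]] := EE_adj eEE.
have := big_stays (mem_EE eEE) e_big; have [_] := closedS (mem_EE eEE).
rewrite /S' /tail /head eE /=.
case: (S (nodeA i)) => h1 h2; first by rewrite h2 //=; ring.
case: (S (nodeB j)) h1 {h2} => h1; last by rewrite /=; ring.
by case: (bw e) h1 => [|n /(_ isT isT)] //=; rewrite mul0r.
Qed.

(** As 0 < k < 4, terminal 0 lies inside [S] and terminal 3 outside. The terminal arc of a fixed
    vertex of the cover therefore leaves [S], and by closedness it is saturated. *)
Lemma cut_cover_sat v : v \in cut_cover -> ~~ priceable v -> flow v = C v.
Proof.
have /andP[k_gt0 lt_k4] := k_bound.
case: v => [i|j]; rewrite inE => memS fv /=.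
  have [h _] := closedS (mem_ea i); have := ea_cap i; rewrite (negPf fv) => <-.
  move: h; rewrite /tail /head eaE (negPf fv) /= sepS // k_gt0 (negPf memS).
  by case: (fw (ea i)) => // n /(_ isT isT).
have [h _] := closedS (mem_eb j); have := eb_cap j; rewrite (negPf fv) => <-.
move: h; rewrite /tail /head ebE (negPf fv) /= memS sepS //.
have -> : (3 < k)%N = false by lia.
by case: (fw (eb j)) => // n /(_ isT isT).
Qed.

(** For k > 1, terminal 1 lies in [S], and its arcs of capacity [big] keep their heads in [S]. With
    the mirror statement [cut_cover_right], k = 2 yields a cover free of priceable vertices. *)
Lemma cut_cover_left i : (1 < k)%N -> priceable (inl i : vertex I) -> inl i \notin cut_cover.
Proof.
move=> k_gt1 pr; rewrite inE negbK.
have e_big : (fw (ea i) + bw (ea i))%N = big by rewrite ea_cap pr.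
have := big_stays (mem_ea i) e_big; rewrite /tail /head eaE pr /= sepS // k_gt1.
exact.
Qed.

Lemma cut_cover_right j : (k < 3)%N -> priceable (inr j : vertex I) -> inr j \notin cut_cover.
Proof.
move=> k_lt3 pr; rewrite inE.
have e_big : (fw (eb j) + bw (eb j))%N = big by rewrite eb_cap pr.
have := big_stays (mem_eb j) e_big; rewrite /tail /head ebE pr /= (sepS (isT : (2 < 4)%N)).
have -> : (2 < k)%N = false by lia.
by case: (S _) => // /(_ isT).
Qed.
End Cut.

Lemma tight_cut_cover k S F : (0 < k < 4)%N -> separates k S ->
  (forall e, e \in E -> closed_at S e) -> upflow 2 E = F%:Z ->
  tight_cover F flow C (cut_cover S).
Proof.
move=> lt_k sepS clS upF; split; first exact: (cut_cover_cover lt_k sepS clS).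
  by apply/eqP; rewrite -eqz_nat (cut_cover_sum lt_k sepS clS) upF.
by move=> v; apply: (cut_cover_sat lt_k sepS clS).
Qed.

Lemma network_revenue (D : nat) (R : realType) (q : vertex I -> R) : (0 < D)%N ->
  (forall v : vertex I, ~~ priceable v -> cost v = (C v)%:R / D%:R) ->
  valid_prices q ->
  revenue q / 2 <= revenue (fun v => ratr ((flow v)%:R / D%:R) : R).
Proof.
move=> D_gt0 costE q_ge0.
have [SA sepA clA] := optE (isT : (0 < 1 < 4)%N).
have [S0 sep0 cl0] := optE (isT : (0 < 2 < 4)%N).
have [SB sepB clB] := optE (isT : (0 < 3 < 4)%N).
have upF := upflow_eq_cut (isT : (2 < 4)%N) consE sep0 cl0.
apply: (@revenue_flow I D (cut_cap E S0) flow C D_gt0 costE flow_le _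
  (cut_cover SA) (cut_cover S0) (cut_cover SB)) => //.
- by move=> X /cover_upflow; rewrite upF lez_nat.
- exact: tight_cut_cover sepA clA upF.
- exact: tight_cut_cover sep0 cl0 upF.
- exact: tight_cut_cover sepB clB upF.
- move=> [i|j] mem; apply: contraL mem => pr.
    exact: (@cut_cover_left 2).
  exact: (@cut_cover_right 2).
(* For k = 1, terminal 1 is outside the cut; positive flow gives a residual arc back to it, so the
   vertex is outside as well and belongs to the cover. *)
- move=> i pr pos; rewrite inE; have [_ h] := clA _ (mem_ea i).
  apply/negP => S_i; move: (h pos).
  by rewrite /tail /head eaE pr /= (sepA 1%N isT) => /(_ S_i).
(* For k = 3, terminal 2 is inside the cut, and the residual arc back from it pulls the vertex
   inside, hence into the cover. *)
- move=> j pr pos; rewrite inE; have [_ h] := clB _ (mem_eb j).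
  by move: (h pos); rewrite /tail /head ebE pr /= (sepB 2%N isT) => /(_ isT).
Qed.
End PricingNetwork.

(** * The algorithm on instances *)

Definition indexed (X : Type) (b : nat) (l : seq X) : seq (nat * X) := zip (iota b (size l)) l.

Definition wterm : Type := ((nat * nat) * option (nat * nat))%type.
Definition sterm : Type := ((nat * nat) * (bool * nat))%type.

Definition levelA (o : option (nat * nat)) : nat := if o is Some _ then 0 else 1.
Definition levelB (o : option (nat * nat)) : nat := if o is Some _ then 3 else 2.

Definition terms (va vb : seq (option (nat * nat))) : seq wterm :=
  [seq ((levelA x.2, x.1), x.2) | x <- indexed 4 va] ++
  [seq ((x.1, levelB x.2), x.2) | x <- indexed (4 + size va) vb].

Definition pairs (na : nat) (rows : seq (seq bool)) : seq (nat * nat) :=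
  flatten [seq [seq (r.1, c.1) | c <- [seq c <- indexed (4 + na) r.2 | c.2]]
          | r <- indexed 4 rows].

Definition mul_term (d : nat) (y : sterm) : sterm := (y.1, (y.2.1, d * y.2.2)).

(** Clears denominators with their product, which avoids division and gcd: a new denominator
    multiplies all numerators scaled so far, and the new numerator is multiplied by the product so
    far. The flag [false] marks an uncapacitated arc. *)
Definition scale_step (t : wterm) (st : seq sterm * nat) : seq sterm * nat :=
  if t.2 is Some nd
  then ((t.1, (true, nd.1 * st.2)) :: [seq mul_term nd.2 y | y <- st.1], nd.2 * st.2)
  else ((t.1, (false, 0)) :: st.1, st.2).

Definition scale (ts : seq wterm) : seq sterm * nat := foldr scale_step ([::], 1) ts.

Definition total (sc : seq sterm) : nat := foldr (fun y s => y.2.2 + s) 0 sc.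

(** Reverses the bits, as scaling reads the most significant one first; the default [false] pads
    with leading zeros to the length of [K]. *)
Definition msb_step (st : bitseq * bitseq) (_ : bool) : bitseq * bitseq :=
  (behead st.1, seq.head false st.1 :: st.2).

Definition msb (K : bitseq) (n : nat) : bitseq := (foldl msb_step (nat_bits n, [::]) K).2.

Definition ones (K : bitseq) : bitseq := [seq true | _ <- K].

Definition term_arc (K : bitseq) (y : sterm) : arc :=
  (y.1, (if y.2.1 then msb K y.2.2 else ones K, (0, 0))).

Definition pair_arc (K : bitseq) (p : nat * nat) : arc := (p, (ones K, (0, 0))).

Definition network (K : bitseq) (sc : seq sterm) (ps : seq (nat * nat)) : seq arc :=
  [seq term_arc K y | y <- sc] ++ [seq pair_arc K p | p <- ps].

(** The successor matters: with it, the number whose digits are all 1 strictly exceeds the sum of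
    the fixed costs. *)
Definition digits (sc : seq sterm) : bitseq := nat_bits (total sc).+1.

(** Three copies of [E] count the unit augmentations of a phase, one per arc and objective; they
    also suffice as fuel for each search. *)
Definition run_network (K : bitseq) (E : seq arc) : seq arc := max_flow K (E ++ E ++ E) E.

Definition final_flow (va vb : seq (option (nat * nat))) (rows : seq (seq bool)) : seq arc :=
  let sc := (scale (terms va vb)).1 in
  run_network (digits sc) (network (digits sc) sc (pairs (size va) rows)).

(** Selects the arcs with a terminal at the end [f]; pushing never reorders arcs, so the prices come
    out in the order of the vertices. *)
Definition read (f : arc -> nat) (D : nat) (E : seq arc) : seq (nat * nat) :=
  [seq (bw e, D) | e <- [seq e <- E | f e <= 3]].

(** A copy of instances without dependent types, [None] standing for a priceable vertex; it is
    encoded by the same tree, as [enc_input_instance] shows. *)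
Definition instance_data : Type :=
  ((seq (option (nat * nat)) * seq (option (nat * nat))) * seq (seq bool))%type.

Definition solve (x : instance_data) :
    seq (nat * nat) * seq (nat * nat) :=
  let D := (scale (terms x.1.1 x.1.2)).2 in
  let E := final_flow x.1.1 x.1.2 x.2 in
  (read tail D E, read head D E).

Definition bits_msb_val (v : nat) (l : bitseq) : nat :=
  foldl (fun v (b : bool) => b + v.*2) v l.

Lemma size_msb K n : size (msb K n) = size K.
Proof.
rewrite /msb; suff main (l : bitseq) acc : size (foldl msb_step (l, acc) K).2 = size acc + size K.
  by rewrite main.
by elim: K l acc => [|b K IH] l acc /=; rewrite ?addn0 // IH /=; lia.
Qed.

Lemma msbK K n : size (nat_bits n) <= size K -> bits_msb_val 0 (msb K n) = n.
Proof.
move=> le_nK; rewrite -[RHS]nat_bitsK /msb.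
suff main (l : bitseq) acc : size l <= size K ->
    bits_msb_val 0 (foldl msb_step (l, acc) K).2 = bits_msb_val (bits_val l) acc by exact: main.
elim: K l acc {le_nK} => [|c K IH] [|b l] acc //= le_lK; first by rewrite IH.
by rewrite IH.
Qed.

Lemma onesK K : bits_msb_val 0 (ones K) = (2 ^ size K).-1.
Proof.
suff main v : (bits_msb_val v (ones K)).+1 = v.+1 * 2 ^ size K.
  by have := main 0; rewrite mul1n => <-.
elim: K v => [|b K IH] v /=; first by rewrite expn0 muln1.
by rewrite IH expnS mulnA; congr (_ * _); lia.
Qed.

Lemma size_nat_bits_le m n : m <= n -> size (nat_bits m) <= size (nat_bits n).
Proof.
move=> le_mn; rewrite !size_map !size_iota.
by apply: up_log_min => //; apply: leq_ltn_trans le_mn _; apply: up_logP.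
Qed.

Lemma digits_gt sc : total sc < (2 ^ size (digits sc)).-1.
Proof.
rewrite /digits size_map size_iota.
by have := @up_logP 2 (total sc).+2 isT; lia.
Qed.

Lemma scaleP ts (D := (scale ts).2) :
  (forall t nd, t \in ts -> t.2 = Some nd -> 0 < nd.2) ->
  [/\ 0 < D, forall t nd, t \in ts -> t.2 = Some nd -> nd.2 %| D &
     (scale ts).1 = [seq (t.1, if t.2 is Some nd then (true, nd.1 * (D %/ nd.2))
                               else (false, 0)) | t <- ts]].
Proof.
rewrite {}/D; elim: ts => [|[x o] ts IH] //= pos.
have [|D_gt0 dvdD eqS] := IH; first by move=> t nd tts; apply: pos; rewrite inE tts orbT.
rewrite /scale_step /= -/(scale ts) eqS; set D := (scale ts).2 in D_gt0 dvdD *.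
case: o pos => [[n d]|] pos /=; last first.
  by split=> // t nd; rewrite inE => /orP[/eqP->|tts] //; apply: dvdD.
have d_gt0 : 0 < d by apply: (pos _ (n, d) (mem_head _ _)).
split.
- by rewrite muln_gt0 d_gt0.
- move=> t nd; rewrite inE => /orP[/eqP-> [<-]|tts tE] /=; first exact: dvdn_mulr.
  by apply: dvdn_mull; apply: dvdD tE.
congr cons; first by rewrite mulKn.
rewrite -map_comp; apply/eq_in_map => t tts /=; congr (_, _); rewrite /=.
case tE: t.2 => [[m e]|] /=; last by rewrite muln0.
(* The old denominator divides the old product, so the quotient is exact and scales with the new
   factor. *)
by congr (_, _); rewrite mulnCA muln_divA ?(dvdD _ _ tts tE).
Qed.

Lemma indexed_ord (X : Type) n b (g : 'I_n -> X) :
  indexed b [seq g i | i <- enum 'I_n] = [seq (b + i, g i) | i : 'I_n <- enum 'I_n].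
Proof.
rewrite /indexed; have -> : iota b (size [seq g i | i <- enum 'I_n])
  = [seq b + val i | i <- enum 'I_n].
  by rewrite size_map size_enum_ord -{1}(addn0 b) iotaDl -val_enum_ord -map_comp.
by elim: (enum 'I_n) => //= i s ->.
Qed.

(** The final network is known only through the ends and capacities of its arcs, in order; this
    recovers from such a list the arc belonging to each vertex. *)
Lemma split_map (A B : Type) (a0 : A) (h : A -> B) n (g : 'I_n -> B) E s :
  [seq h e | e <- E] = [seq g i | i <- enum 'I_n] ++ s ->
  exists (ea : 'I_n -> A) EE, [/\ E = [seq ea i | i <- enum 'I_n] ++ EE,
    forall i, h (ea i) = g i & [seq h e | e <- EE] = s].
Proof.
move=> eqE; have size_E : n <= size E.
  by rewrite -(size_map h) eqE size_cat size_map size_enum_ord leq_addr.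
exists (fun i => nth a0 E i), (drop n E); split.
- have -> : [seq nth a0 E i | i : 'I_n <- enum 'I_n] = take n E.
    by rewrite (map_comp (nth a0 E) val) val_enum_ord map_nth_iota0.
  by rewrite cat_take_drop.
- move=> i; have lt_i := ltn_ord i.
  rewrite -(nth_map a0 (h a0)) ?(leq_trans lt_i) // eqE nth_cat size_map size_enum_ord lt_i.
  by rewrite (nth_map i) ?size_enum_ord // nth_ord_enum.
by rewrite map_drop eqE drop_size_cat // size_map size_enum_ord.
Qed.

Section InstanceInput.
Local Open Scope ring_scope.
Variable I : instance.

Definition vopt (v : vertex I) : option (nat * nat) :=
  if priceable v then None else Some (absz (numq (cost v)), absz (denq (cost v))).

Definition input : instance_data :=
  (([seq vopt (inl i) | i <- enum 'I_(nA I)], [seq vopt (inr j) | j <- enum 'I_(nB I)]),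
   [seq [seq adj i j | j <- enum 'I_(nB I)] | i <- enum 'I_(nA I)]).

Let ts := terms input.1.1 input.1.2.
Let D := (scale ts).2.
Let sc := (scale ts).1.

Definition int_cost (v : vertex I) : nat := (absz (numq (cost v)) * (D %/ absz (denq (cost v))))%N.

Lemma termsE : ts =
  [seq ((levelA (vopt (inl i)), nodeA i), vopt (inl i)) | i <- enum 'I_(nA I)] ++
  [seq ((nodeB j, levelB (vopt (inr j))), vopt (inr j)) | j <- enum 'I_(nB I)].
Proof.
by rewrite /ts /terms /= size_map size_enum_ord !indexed_ord -!map_comp.
Qed.

Lemma vopt_den v nd : vopt v = Some nd -> (0 < nd.2)%N.
Proof. by rewrite /vopt; case: ifP => // _ [<-] /=; rewrite absz_gt0 denq_neq0. Qed.

Lemma mem_terms t : t \in ts -> exists v, t.2 = vopt v.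
Proof. by rewrite termsE mem_cat => /orP[] /mapP[i _ ->]; eexists. Qed.

Lemma scale_input : [/\ (0 < D)%N,
    forall v : vertex I, ~~ priceable v -> (absz (denq (cost v)) %| D)%N &
    sc = [seq (t.1, if t.2 is Some nd then (true, nd.1 * (D %/ nd.2))%N else (false,
      0%N)) | t <- ts]].
Proof.
have [|D_gt0 dvdD eqD] := @scaleP ts.
  by move=> t nd /mem_terms[v ->]; apply: vopt_den.
split=> //.
move=> v fv; have vE : vopt v = Some (absz (numq (cost v)), absz (denq (cost v))).
  by rewrite /vopt (negPf fv).
suff [t tts tE] : exists2 t, t \in ts & t.2 = vopt v.
  by have := dvdD _ _ tts (etrans tE vE).
case: v {fv vE} => [i|j]; [exists ((levelA (vopt (inl i)), nodeA i), vopt (inl i))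
  | exists ((nodeB j, levelB (vopt (inr j))), vopt (inr j))] => //; rewrite termsE mem_cat;
  apply/orP; [left | right]; apply/mapP; eexists => //; rewrite ?mem_enum //.
Qed.

Lemma int_costE v : (forall v : vertex I, ~~ priceable v -> 0 <= cost v) -> ~~ priceable v ->
  cost v = (int_cost v)%:R / D%:R.
Proof.
move=> cost_ge0 fv; have [D_gt0 dvdD _] := scale_input.
have dvd := dvdD v fv; have num_ge0 : 0 <= numq (cost v) by rewrite numq_ge0 cost_ge0.
have d0 : (absz (denq (cost v)))%:R != 0 :> rat.
  by rewrite pnatr_eq0 -lt0n absz_gt0 denq_neq0.
have D0 : D%:R != 0 :> rat by rewrite pnatr_eq0 -lt0n.
have -> : cost v = (absz (numq (cost v)))%:R / (absz (denq (cost v)))%:R.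
  rewrite -[LHS]divq_num_den -{1}(gez0_abs num_ge0) -{1}(gez0_abs (denq_ge0 (cost v))).
  by [].
rewrite /int_cost natrM.
have -> : (D %/ absz (denq (cost v)))%:R = D%:R / (absz (denq (cost v)))%:R :> rat.
  by apply: (canRL (mulfK d0)); rewrite -natrM divnK.
by field; rewrite d0 D0.
Qed.
End InstanceInput.

Lemma run_networkP K sc ps (E := run_network K (network K sc ps)) :
  (forall y : sterm, y \in sc -> y.2.1 -> size (nat_bits y.2.2) <= size K) ->
  [/\ [seq (e.1, fw e + bw e) | e <- E] =
      [seq (y.1, if y.2.1 then y.2.2 else (2 ^ size K).-1) | y <- sc] ++
      [seq (p, (2 ^ size K).-1) | p <- ps], conserved E & optimal E].
Proof.
move=> le_K; have zero : forall e, e \in network K sc ps -> fw e = 0 /\ bw e = 0.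
  by move=> e; rewrite mem_cat => /orP[]/mapP[y _ ->].
have [cons0 opt0] := zero_flow zero.
have [|e||| -> ? ?] := max_flowP (erefl E) => //.
- by rewrite !size_cat; lia.
- rewrite mem_cat => /orP[]/mapP[y _ ->] /=; last exact: size_map.
  by case: ifP => _; [apply: size_msb | apply: size_map].
split=> //; rewrite map_cat -!map_comp; congr cat; last first.
  by apply: eq_map => p /=; rewrite -[foldl _ _ _]/(bits_msb_val 0 (ones K)) onesK.
apply/eq_in_map => y /le_K; rewrite /term_arc /= /fw /bw /=.
case: ifP => _ le_y; congr (_, _); first by apply: msbK; apply: le_y.
exact: onesK.
Qed.

Lemma mem_total (sc : seq sterm) y : y \in sc -> y.2.2 <= total sc.
Proof.
elim: sc => //= z sc IH; rewrite inE => /orP[/eqP->|/IH le]; first exact: leq_addr.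
exact: leq_trans le (leq_addl _ _).
Qed.

Lemma network_caps sc ps (K := digits sc) (E := run_network K (network K sc ps)) :
  [/\ [seq (e.1, fw e + bw e) | e <- E] =
      [seq (y.1, if y.2.1 then y.2.2 else (2 ^ size K).-1) | y <- sc] ++
      [seq (p, (2 ^ size K).-1) | p <- ps], conserved E & optimal E].
Proof.
apply: run_networkP => y /mem_total le_y _.
by apply: size_nat_bits_le; apply: leqW.
Qed.

Section SolveInput.
Local Open Scope ring_scope.
Variable I : instance.
Hypothesis wfI : well_formed I.

Let x := input I.
Let D := (scale (terms x.1.1 x.1.2)).2.
Let sc := (scale (terms x.1.1 x.1.2)).1.
Let ps := pairs (size x.1.1) x.2.
Let big := (2 ^ size (digits sc)).-1.
Let C := @int_cost I.

Lemma scE : sc =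
  [seq ((priceable (inl i : vertex I) : nat, nodeA i),
        if priceable (inl i : vertex I) then (false, 0%N) else (true,
          C (inl i))) | i <- enum 'I_(nA I)] ++
  [seq ((nodeB j, if priceable (inr j : vertex I) then 2%N else 3%N),
        if priceable (inr j : vertex I) then (false, 0%N) else (true,
          C (inr j))) | j <- enum 'I_(nB I)].
Proof.
have [_ _ eqS] := scale_input I; rewrite [sc]eqS /C /int_cost.
move: (scale _).2 => D0; rewrite termsE map_cat -!map_comp.
by congr cat; apply: eq_map => i /=; rewrite /vopt; case: priceable.
Qed.

Lemma totalE : total sc = (\sum_(v : vertex I | ~~ priceable v) C v)%N.
Proof.
have -> : total sc = (\sum_(y <- sc) y.2.2)%N.
  by elim: (sc) => [|y s IH] /=; rewrite ?big_nil // big_cons IH.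
rewrite scE big_cat !big_map big_sumType /=.
rewrite [X in _ = (X + _)%N]big_mkcond [X in _ = (_ + X)%N]big_mkcond -!big_enum /=.
by congr (_ + _)%N; apply: eq_bigr => i _; case: priceable.
Qed.

Lemma mem_pairs p : p \in ps -> exists i j, adj (i : 'I_(nA I)) j /\ p = (nodeA i, nodeB j).
Proof.
rewrite /ps /pairs /= size_map size_enum_ord indexed_ord.
case/flattenP => s /mapP[_ /mapP[i _ ->] ->] /mapP[c]; rewrite /= indexed_ord mem_filter.
by move=> /andP[c2 /mapP[j _ eq_c]] ->; exists i, j; rewrite eq_c in c2 *.
Qed.

Lemma pairs_mem (i : 'I_(nA I)) j : adj i j -> (nodeA i, nodeB j) \in ps.
Proof.
move=> adj_ij; rewrite /ps /pairs /= size_map size_enum_ord indexed_ord.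
pose row := [seq adj i j | j <- enum 'I_(nB I)].
apply/flattenP; exists [seq (nodeA i, c.1) | c <- [seq c <- indexed (4 + nA I) row | c.2]].
  apply/mapP; exists (nodeA i, row) => //; apply/mapP; exists i; rewrite ?mem_enum //.
rewrite /row indexed_ord; apply/mapP; exists (nodeB j, true) => //.
by rewrite mem_filter /=; apply/mapP; exists j; rewrite ?mem_enum ?adj_ij.
Qed.

Lemma solve_input : exists fl : vertex I -> nat,
  solve x = ([seq (fl (inl i), D) | i <- enum 'I_(nA I)], [seq (fl (inr j),
    D) | j <- enum 'I_(nB I)]) /\
  forall (R : realType) (q : vertex I -> R), valid_prices q ->
    revenue q / 2 <= revenue (fun v => ratr ((fl v)%:R / D%:R) : R).
Proof.
have [cost_ge0 fixed_cover] := wfI.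
have [caps consE optE] := network_caps sc ps.
rewrite -/(final_flow x.1.1 x.1.2 x.2) in caps consE optE.
rewrite -/big in caps.
have scmap : [seq (y.1, if y.2.1 then y.2.2 else big) | y <- sc] =
  [seq ((priceable (inl i : vertex I) : nat, nodeA i),
        if priceable (inl i : vertex I) then big else C (inl i)) | i <- enum 'I_(nA I)] ++
  [seq ((nodeB j, if priceable (inr j : vertex I) then 2%N else 3%N),
        if priceable (inr j : vertex I) then big else C (inr j)) | j <- enum 'I_(nB I)].
  by rewrite scE map_cat; congr cat; rewrite -map_comp; apply: eq_map => i /=; case: priceable.
rewrite scmap -catA in caps.
pose e0 : arc := ((0, 0), ([::], (0, 0)))%N.
have [ea [E1 [eqE eaE caps1]]] := split_map e0 caps.
have [eb [EE [eqE1 ebE caps2]]] := split_map e0 caps1.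
rewrite eqE1 in eqE.
have ea1 i : (ea i).1 = (priceable (inl i : vertex I) : nat, nodeA i) by have [] := eaE i.
have eb1 j : (eb j).1 = (nodeB j, if priceable (inr j : vertex I) then 2%N else 3%N).
  by have [] := ebE j.
have EE1 e : e \in EE -> exists (i : 'I_(nA I)) (j : 'I_(nB I)),
    [/\ adj i j, e.1 = (nodeA i, nodeB j) & (fw e + bw e)%N = big].
  move=> /(map_f (fun e => (e.1, (fw e + bw e)%N))); rewrite caps2 => /mapP[p /mem_pairs].
  by move=> [i [j [adj_ij ->]]] [-> ->]; exists i, j.
exists (flow ea eb); split.
  rewrite /solve -/D eqE /read !filter_cat !map_cat.
  have tA : [seq e <- [seq ea i | i <- enum 'I_(nA I)] | (tail e <= 3)%N] = [seq ea i | i <- enum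
    'I_(nA I)].
    by apply/all_filterP/allP => _ /mapP[i _ ->]; rewrite /tail ea1; case: priceable.
  have hA : [seq e <- [seq ea i | i <- enum 'I_(nA I)] | (head e <= 3)%N] = [::].
    apply/eqP; rewrite -[_ == _]negbK -has_filter; apply/negP => /hasP[_ /mapP[i _ ->]].
    by rewrite /head ea1.
  have tB : [seq e <- [seq eb j | j <- enum 'I_(nB I)] | (tail e <= 3)%N] = [::].
    apply/eqP; rewrite -[_ == _]negbK -has_filter; apply/negP => /hasP[_ /mapP[i _ ->]].
    by rewrite /tail eb1.
  have hB : [seq e <- [seq eb j | j <- enum 'I_(nB I)] | (head e <= 3)%N] = [seq eb j | j <- enum
    'I_(nB I)].
    by apply/all_filterP/allP => _ /mapP[i _ ->]; rewrite /head eb1; case: priceable.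
  have tE : [seq e <- EE | (tail e <= 3)%N] = [::].
    apply/eqP; rewrite -[_ == _]negbK -has_filter; apply/negP => /hasP[e /EE1[i [j [_ eE _]]]].
    by rewrite /tail eE.
  have hE : [seq e <- EE | (head e <= 3)%N] = [::].
    apply/eqP; rewrite -[_ == _]negbK -has_filter; apply/negP => /hasP[e /EE1[i [j [_ eE _]]]].
    by rewrite /head eE.
  by rewrite tA tB tE hA hB hE /= !cats0 -!map_comp.
move=> R q q_ge0; have [D_gt0 _ _] := scale_input I.
rewrite eqE in consE optE.
apply: (@network_revenue I C big ea eb EE) => //.
- by move=> i; have [] := eaE i.
- by move=> j; have [] := ebE j.
- move=> i j /pairs_mem memp.
  have : ((nodeA i, nodeB j), big) \in [seq (e.1, (fw e + bw e)%N) | e <- EE].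
    by rewrite caps2; apply/mapP; exists (nodeA i, nodeB j).
  by move=> /mapP[e eEE [eE _]]; exists e.
- by rewrite -totalE; apply: digits_gt.
- by move=> v fv; apply: int_costE.
Qed.
End SolveInput.

(** * The algorithm runs in polynomial time *)

Definition enc_node2 : nat * nat -> tree := enc_pair enc_una enc_una.
Definition enc_bits : bitseq -> tree := enc_seq enc_bool.
Definition enc_arc : arc -> tree :=
  enc_pair enc_node2 (enc_pair enc_bits (enc_pair enc_nat enc_nat)).
Definition enc_net : seq arc -> tree := enc_seq enc_arc.
Definition enc_search : seq (nat * nat) -> tree := enc_seq enc_node2.

Section SearchComputable.
Variable k : nat.

Lemma computable_reached : computable (fun y : nat * seq (nat * nat) =>
  [:: enc_pair enc_una enc_search y])
  (fun y => enc_bool (reached k y.2 y.1)).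
Proof.
apply: c_or.
  apply: (c_una_leq _ (c_una_const _ k)); apply: c_unaS; exact: (c_hd (c_var _ 0)).
apply: (@c_has _ _ _ enc_node2 (fun y => y.2) 1 _ _ (fun y p => p.1 == y.1)) => //.
  exact: (c_tl (c_var _ 0)).
by apply: c_una_eq; [exact: (c_hd (c_var _ 0)) | exact: (c_hd (c_var _ 1))].
Qed.

Lemma computable_relax : computable
  (fun y : (nat * nat) * seq (nat * nat) => [:: enc_pair enc_node2 enc_search y])
  (fun y => enc_search (relax k y.1.1 y.1.2 y.2)).
Proof.
set cx := (X in computable X _).
have hx : computable cx (fun y => enc_una y.1.1) by exact: (c_hd (c_hd (c_var _ 0))).
have hy : computable cx (fun y => enc_una y.1.2) by exact: (c_tl (c_hd (c_var _ 0))).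
have hL : computable cx (fun y => enc_search y.2) by exact: (c_tl (c_var _ 0)).
apply: c_ifb => //; last by apply: (c_cons (c_cons hy hx) hL).
apply: c_and.
  exact: (c_app1 (a := fun y => (y.1.1, y.2)) computable_reached (c_cons hx hL)).
by apply: c_not; exact: (c_app1 (a := fun y => (y.1.2, y.2)) computable_reached (c_cons hy hL)).
Qed.

Lemma computable_relax_arc : computable
  (fun y : seq (nat * nat) * arc => [:: enc_pair enc_search enc_arc y])
  (fun y => enc_search (relax_arc k y.1 y.2)).
Proof.
have fw_c : computable (fun y : seq (nat * nat) * arc => [:: enc_pair enc_search enc_arc y])
    (fun y => enc_search (relax_fw k y.1 y.2)).
  set cx := (X in computable X _).
  have hL : computable cx (fun y => enc_search y.1) by exact: (c_hd (c_var _ 0)).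
  apply: c_ifb => //; first by apply: c_pos; exact: (c_hd (c_tl (c_tl (c_tl (c_var _ 0))))).
  apply: (c_app1 (a := fun y => ((tail y.2, head y.2), y.1)) computable_relax).
  by apply: c_cons hL; exact: (c_hd (c_tl (c_var _ 0))).
have bw_c : computable (fun y : seq (nat * nat) * arc => [:: enc_pair enc_search enc_arc y])
    (fun y => enc_search (relax_bw k y.1 y.2)).
  set cx := (X in computable X _).
  have hL : computable cx (fun y => enc_search y.1) by exact: (c_hd (c_var _ 0)).
  apply: c_ifb => //; first by apply: c_pos; exact: (c_tl (c_tl (c_tl (c_tl (c_var _ 0))))).
  apply: (c_app1 (a := fun y => ((head y.2, tail y.2), y.1)) computable_relax).
  apply: c_cons hL; apply: c_cons; first exact: (c_tl (c_hd (c_tl (c_var _ 0)))).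
  exact: (c_hd (c_hd (c_tl (c_var _ 0)))).
apply: (c_app1 (a := fun y => (relax_fw k y.1 y.2, y.2)) bw_c).
by apply: c_cons fw_c _; exact: (c_tl (c_var _ 0)).
Qed.

Lemma relax_tsize x y L :
  tsize (enc_search (relax k x y L)) <= tsize (enc_search L) + tsize (enc_node2 (x, y)) + 1.
Proof. by rewrite /relax; case: ifP => _ /=; lia. Qed.

(** Each arc contributes at most two pairs, both made of its ends, so a round adds to the size
    instead of multiplying it. *)
Lemma round_tsize E L : tsize (enc_search (round k E L)) <= tsize (enc_search L)
  + 2 * tsize (enc_net E).
Proof.
rewrite /round; elim: E L => [|e E IH] L; first by rewrite /=; lia.
have -> : tsize (enc_net (e :: E)) = (tsize (enc_arc e) + tsize (enc_net E)).+1 by [].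
apply: leq_trans (IH _) _; rewrite /relax_arc.
have le1 : tsize (enc_search (relax_fw k L e)) <= tsize (enc_search L) + tsize (enc_node2 e.1) + 1.
  rewrite /relax_fw; case: ifP => _; last by lia.
  apply: leq_trans (relax_tsize _ _ _) _.
  by rewrite /enc_node2 /enc_pair /head /tail /=; lia.
have le2 : tsize (enc_search (relax_bw k (relax_fw k L e) e)) <=
    tsize (enc_search (relax_fw k L e)) + tsize (enc_node2 e.1) + 1.
  rewrite /relax_bw; case: ifP => _; last by lia.
  apply: leq_trans (relax_tsize _ _ _) _.
  by rewrite /enc_node2 /enc_pair /head /tail /=; lia.
have : tsize (enc_node2 e.1) < tsize (enc_arc e) by rewrite /enc_arc /enc_pair /=; lia.
lia.
Qed.

Lemma computable_round : computable
  (fun y : seq arc * seq (nat * nat) => [:: enc_pair enc_net enc_search y])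
  (fun y => enc_search (round k y.1 y.2)).
Proof.
set cx := (X in computable X _).
have hE : computable cx (fun y => enc_net y.1) by exact: (c_hd (c_var _ 0)).
have hL : computable cx (fun y => enc_search y.2) by exact: (c_tl (c_var _ 0)).
apply: (@c_foldl _ _ arc enc_arc (fun y => y.1) 1 _ hE _ enc_search (fun _ => relax_arc k)
  (fun y => y.2) (fun y => tsize (enc_search y.2) + 2 * tsize (enc_net y.1))) => //.
- apply: (c_app1 (a := fun w : arc * seq (nat * nat) * (seq arc * seq (nat * nat)) =>
    (w.1.2, w.1.1)) computable_relax_arc).
  by apply: c_cons; [exact: (c_var _ 1) | exact: (c_var _ 0)].
- apply/polyb_add/polyb_mul; [by have [] := hL | exact: polyb_const | by have [] := hE].
move=> [E L] pre suf /= eqE; apply: leq_trans (round_tsize pre L) _.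
by rewrite leq_add2l leq_mul2l eqE; apply/orP; right; apply: tsize_enc_prefix.
Qed.

Lemma search_tsize (fuel E : seq arc) :
  tsize (enc_search (search k fuel E)) <= 1 + size fuel * (2 * tsize (enc_net E)).
Proof.
rewrite /search foldl_iter; elim: (size fuel) => // n IH.
apply: leq_trans (round_tsize _ _) (leq_trans (leq_add IH (leqnn _)) _).
by rewrite mulSn; lia.
Qed.

Lemma computable_search : computable
  (fun y : seq arc * seq arc => [:: enc_pair enc_net enc_net y])
  (fun y => enc_search (search k y.1 y.2)).
Proof.
set cx := (X in computable X _).
have hF : computable cx (fun y => enc_net y.1) by exact: (c_hd (c_var _ 0)).
have hE : computable cx (fun y => enc_net y.2) by exact: (c_tl (c_var _ 0)).
apply: (@c_foldl _ _ arc enc_arc (fun y => y.1) 1 _ hF _ enc_search (fun y L _ => round k y.2 L)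
  (fun=> [::]) (fun y => 1 + tsize (enc_net y.1) * (2 * tsize (enc_net y.2)))) => //.
- exact: c_nil.
- apply: (c_app1 (a := fun w : arc * seq (nat * nat) * (seq arc * seq arc) =>
    (w.2.2, w.1.2)) computable_round).
  by apply: c_cons; [exact: (c_tl (c_var _ 2)) | exact: (c_var _ 1)].
- apply/polyb_add; first exact: polyb_const.
  apply/polyb_mul; first by have [] := hF.
  by apply/polyb_mul; [exact: polyb_const | have [] := hE].
move=> [F E] pre suf /= eqF; apply: leq_trans (search_tsize pre E) _.
rewrite leq_add2l leq_mul2r; apply/orP; right; rewrite eqF ltnW //.
by apply: leq_trans (tsize_enc_size enc_arc pre) _; apply: tsize_enc_prefix.
Qed.
End SearchComputable.

(** * Size of the arcs during the flow computation *)

Lemma tsize_enc_arc e : tsize (enc_arc e) = tsize (enc_node2 e.1) + tsize (enc_bits e.2.1) +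
  tsize (enc_nat (fw e)) + tsize (enc_nat (bw e)) + 3.
Proof. by rewrite /enc_arc /enc_pair /fw /bw /=; lia. Qed.

Lemma tsize_enc_cons (X : Type) (ex : X -> tree) x s :
  tsize (enc_seq ex (x :: s)) = (tsize (ex x) + tsize (enc_seq ex s)).+1.
Proof. by []. Qed.

Definition arc_digits (e : arc) : nat := tsize (enc_nat (fw e)) + tsize (enc_nat (bw e)).

Lemma cap_lt e : fw e + bw e < 2 ^ arc_digits e.
Proof.
have lt_f := enc_nat_lt (fw e); have lt_b := enc_nat_lt (bw e).
have pos n : 2 <= 2 ^ tsize (enc_nat n) by rewrite -{1}(expn1 2) leq_exp2l ?tsize_gt0.
rewrite /arc_digits expnD; move: lt_f lt_b (pos (fw e)) (pos (bw e)).
by move: (2 ^ tsize (enc_nat (fw e))) (2 ^ tsize (enc_nat (bw e))) => x y; nia.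
Qed.

(* [j] counts the doublings that separate [e'] from [e]. *)
Definition grown (j : nat) (e e' : arc) : bool :=
  [&& e'.1 == e.1, tsize (enc_bits e'.2.1) <= tsize (enc_bits e.2.1)
    & fw e' + bw e' < 2 ^ (arc_digits e + j)].

(** The 8 stands for two binary numbers at four tree nodes per digit; 13 is a generous constant for
    the rest. *)
Lemma grown_tsize j e e' : grown j e e' -> tsize (enc_arc e') <= (13 + 8 * j) * tsize (enc_arc e).
Proof.
move=> /and3P[/eqP eq1 le_bits lt_cap].
have le_f := tsize_enc_nat (leq_ltn_trans (leq_addr _ _) lt_cap).
have le_b := tsize_enc_nat (leq_ltn_trans (leq_addl _ _) lt_cap).
rewrite !tsize_enc_arc eq1; rewrite /arc_digits in le_f le_b; nia.
Qed.

Lemma grown_refl E : all2 (grown 0) E E.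
Proof. by elim: E => //= e E ->; rewrite /grown eqxx leqnn addn0 cap_lt. Qed.

Lemma grown_profile j E E1 E2 : profile E1 = profile E2 ->
  all2 (grown j) E E1 -> all2 (grown j) E E2.
Proof.
elim: E E1 E2 => [|e E IH] [|e1 E1] [|e2 E2] // [eq1 eq2 eq_cap /IH {}IH] /=.
by move=> /andP[g /IH->]; move: g; rewrite /grown eq1 eq2 eq_cap => ->.
Qed.

Lemma grown_double j E E' : all2 (grown j) E E' ->
  all2 (grown j.+1) E [seq double_arc e | e <- E'].
Proof.
elim: E E' => [|e E IH] [|e' E'] //= /andP[/and3P[/eqP eq1 le_bits lt_cap] /IH->].
rewrite andbT; apply/and3P; split; first by rewrite /= eq1.
  apply: leq_trans le_bits; rewrite /double_arc /=; case: (e'.2.1) => //= b s.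
  by rewrite leqW // leq_addl.
rewrite addnS expnS /double_arc /fw /bw /= -/(fw e') -/(bw e').
by case: (seq.head _ _); rewrite -!muln2; lia.
Qed.

Lemma grown_tsize_net j E E' : all2 (grown j) E E' ->
  tsize (enc_net E') <= (13 + 8 * j) * tsize (enc_net E).
Proof.
elim: E E' => [|e E IH] [|e' E'] //.
move=> /andP[/grown_tsize le1 /IH le2].
rewrite /enc_net !tsize_enc_cons -!/(enc_net _) mulnS mulnDr; have := leq_add le1 le2; lia.
Qed.

(** Pushes only shift a fixed capacity between [fw] and [bw], so any number of augmentations costs
    one constant factor in size. *)
Lemma profile_tsize E E' : profile E' = profile E -> tsize (enc_net E') <= 13 * tsize (enc_net E).
Proof.
by move=> eq_p; have := grown_tsize_net (grown_profile (esym eq_p) (grown_refl E));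
  rewrite muln0 addn0.
Qed.

Lemma improve_profile fuel E : profile (improve fuel E) = profile E.
Proof. by rewrite /improve /augment !aug_profile. Qed.

Lemma iter_improve_profile (fuel E : seq arc) n : profile (iter n (improve fuel) E) = profile E.
Proof. by elim: n => //= n IH; rewrite improve_profile. Qed.

(** Only the doubling that opens a phase lets an arc grow, and there is one phase per digit in
    [K]. *)
Lemma max_flow_grown (K : bitseq) fuel E : all2 (grown (size K)) E (max_flow K fuel E).
Proof.
rewrite /max_flow foldl_iter; elim: (size K) => [|n IH] /=; first exact: grown_refl.
rewrite /phase foldl_iter; apply: grown_profile (esym (iter_improve_profile _ _ _)) _.
exact: grown_double.
Qed.

Definition push_args : (nat * nat) * seq arc -> tree := enc_pair enc_node2 enc_net.

Lemma computable_push1 : computable (fun y => [:: push_args y]) (fun y =>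
  enc_net (push1 y.1.1 y.1.2 y.2)).
Proof.
set cx := (X in computable X _).
have hE : computable cx (fun y => enc_net y.2) by exact: (c_tl (c_var _ 0)).
apply: (@c_para _ _ arc enc_arc (fun y => y.2) 1 _ hE
  (fun y E => enc_net (push1 y.1.1 y.1.2 E)) (fun y => 13 * tsize (enc_net y.2))) => //.
- exact: c_nil.
- pose C (w : arc * seq arc * ((nat * nat) * seq arc)) :=
    [:: enc_net (push1 w.2.1.1 w.2.1.2 w.1.2); enc_arc w.1.1; enc_net w.1.2; push_args w.2].
  have hr : computable C (fun w => enc_net (push1 w.2.1.1 w.2.1.2 w.1.2)) by exact: (c_var _ 0).
  have he : computable C (fun w => enc_arc w.1.1) by exact: (c_var _ 1).
  have hs : computable C (fun w => enc_net w.1.2) by exact: (c_var _ 2).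
  have hx : computable C (fun w => enc_una w.2.1.1) by exact: (c_hd (c_hd (c_var _ 3))).
  have hy : computable C (fun w => enc_una w.2.1.2) by exact: (c_tl (c_hd (c_var _ 3))).
  have ht : computable C (fun w => enc_una (tail w.1.1)) by exact: (c_hd (c_hd he)).
  have hh : computable C (fun w => enc_una (head w.1.1)) by exact: (c_tl (c_hd he)).
  have hf : computable C (fun w => enc_nat (fw w.1.1)) by exact: (c_hd (c_tl (c_tl he))).
  have hb : computable C (fun w => enc_nat (bw w.1.1)) by exact: (c_tl (c_tl (c_tl he))).
  have hn : computable C (fun w => enc_node2 w.1.1.1) by exact: (c_hd he).
  have hB : computable C (fun w => enc_bits w.1.1.2.1) by exact: (c_hd (c_tl he)).
  apply: (@eq_computable _ _ (fun w : arc * seq arc * ((nat * nat) * seq arc) => enc_net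
     (if fw_from w.2.1.1 w.2.1.2 w.1.1 then push_fw w.1.1 :: w.1.2
      else if bw_from w.2.1.1 w.2.1.2 w.1.1 then push_bw w.1.1 :: w.1.2
      else w.1.1 :: push1 w.2.1.1 w.2.1.2 w.1.2))) => //.
  apply: c_ifb; [| | apply: c_ifb].
  + by apply: c_and; [apply: c_una_eq | apply: c_and; [apply: c_una_eq | apply: c_pos]].
  + by apply: c_cons hs; apply: c_cons hn (c_cons hB (c_cons (c_pred hf) (c_succ hb))).
  + by apply: c_and; [apply: c_una_eq | apply: c_and; [apply: c_una_eq | apply: c_pos]].
  + by apply: c_cons hs; apply: c_cons hn (c_cons hB (c_cons (c_succ hf) (c_pred hb))).
  by apply: c_cons he hr.
- by apply: polyb_mul; [exact: polyb_const | have [] := hE].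
move=> [p E] pre suf /= eqE.
apply: leq_trans (profile_tsize (push1_profile _ _ _)) _.
by rewrite leq_mul2l eqE; apply: tsize_enc_suffix.
Qed.

Definition enc_state : nat * seq arc -> tree := enc_pair enc_una enc_net.

Lemma computable_aug_step : computable
  (fun y : (nat * seq arc) * (nat * nat) => [:: enc_pair enc_state enc_node2 y])
  (fun y => enc_state (aug_step y.1 y.2)).
Proof.
set cx := (X in computable X _).
have hst : computable cx (fun y => enc_state y.1) by exact: (c_hd (c_var _ 0)).
have hc : computable cx (fun y => enc_una y.1.1) by exact: (c_hd hst).
have hE : computable cx (fun y => enc_net y.1.2) by exact: (c_tl hst).
have h1 : computable cx (fun y => enc_una y.2.1) by exact: (c_hd (c_tl (c_var _ 0))).
have h2 : computable cx (fun y => enc_una y.2.2) by exact: (c_tl (c_tl (c_var _ 0))).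
apply: c_ifb => //.
  apply: c_ifb.
  - by apply: (c_una_eq hc (c_una_const _ 0)).
  - by apply: (c_una_leq (c_unaS h1) (c_una_const _ 4)).
  by apply: (c_una_eq hc (c_unaS h1)).
apply: c_cons; first exact: c_unaS.
exact: (c_app1 (a := fun y => ((y.2.2, y.2.1), y.1.2)) computable_push1 (c_cons (c_cons h2 h1) hE)).
Qed.

(** The first component is replaced only by successors of nodes occurring in [L], whose unary codes
    are already counted there. *)
Lemma aug_state_tsize c E L :
  tsize (enc_una (foldl aug_step (c, E) L).1) <= tsize (enc_una c) + tsize (enc_search L) + 2.
Proof.
elim: L c E => [|p L IH] c E; first by rewrite /=; lia.
rewrite /enc_search tsize_enc_cons /= /aug_step; case: ifP => _.
  apply: leq_trans (IH _ _) _; rewrite -/(enc_search L) /enc_node2 /enc_pair /= !tsize_una; lia.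
by apply: leq_trans (IH _ _) _; rewrite -/(enc_search L); lia.
Qed.

Lemma computable_augment k : computable
  (fun y : seq arc * seq arc => [:: enc_pair enc_net enc_net y])
  (fun y => enc_net (augment k y.1 y.2)).
Proof.
set cx := (X in computable X _).
have hE : computable cx (fun y => enc_net y.2) by exact: (c_tl (c_var _ 0)).
have hL := computable_search k; rewrite -/cx in hL.
suff h : computable cx (fun y => enc_state (foldl aug_step (0,
  y.2) (search k y.1 y.2))) by exact: (c_tl h).
apply: (@c_foldl _ _ (nat * nat) enc_node2 (fun y => search k y.1 y.2) 1 _ hL _ enc_state
  (fun _ => aug_step) (fun y => (0, y.2))
  (fun y => tsize (enc_search (search k y.1 y.2)) + 13 * tsize (enc_net y.2) + 4)) => //.
- by apply: c_cons hE; exact: (c_una_const _ 0).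
- apply: (c_app1 (a := fun w : (nat * nat) * (nat * seq arc) * (seq arc * seq arc) =>
    (w.1.2, w.1.1)) computable_aug_step).
  by apply: c_cons; [exact: (c_var _ 1) | exact: (c_var _ 0)].
- apply/polyb_add/polyb_const/polyb_add; first by have [] := hL.
  by apply/polyb_mul; [exact: polyb_const | have [] := hE].
move=> [F E] pre suf eqL.
have le1 := aug_state_tsize 0 E pre; have le2 := profile_tsize (aug_profile 0 E pre).
have le3 := tsize_enc_prefix enc_node2 pre suf; rewrite -eqL in le3.
by rewrite /enc_state /enc_pair /= in le1 le2 le3 *; rewrite /enc_search in le1 *; lia.
Qed.

Definition enc_fuel : seq arc * seq arc -> tree := enc_pair enc_net enc_net.

Lemma computable_improve : computable (fun y => [:: enc_fuel y]) (fun y =>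
  enc_net (improve y.1 y.2)).
Proof.
have hF : computable (fun y => [:: enc_fuel y]) (fun y => enc_net y.1) by exact: (c_hd (c_var _ 0)).
have h1 := computable_augment 1.
have h2 := c_app1 (a := fun y => (y.1, augment 1 y.1 y.2)) (computable_augment 2) (c_cons hF h1).
exact: (c_app1 (a := fun y => (y.1, augment 2 y.1 (augment 1 y.1 y.2))) (computable_augment 3)
  (c_cons hF h2)).
Qed.

Lemma computable_double_arc : computable (fun e => [:: enc_arc e]) (fun e =>
  enc_arc (double_arc e)).
Proof.
have he : computable (fun e => [:: enc_arc e]) enc_arc by exact: (c_var _ 0).
apply: c_cons; first exact: (c_hd he).
apply: c_cons.
  apply: eq_computable (c_tl (c_hd (c_tl he))) => -[a [[|b s] p]] //.
apply: c_cons; last by apply: c_double; exact: (c_tl (c_tl (c_tl he))).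
apply: c_bcons; last exact: (c_hd (c_tl (c_tl he))).
by apply: eq_computable (c_hd (c_hd (c_tl he))) => -[a [[|b s] p]].
Qed.

Lemma computable_phase : computable (fun y => [:: enc_fuel y]) (fun y => enc_net (phase y.1 y.2)).
Proof.
set cx := (X in computable X _).
have hF : computable cx (fun y => enc_net y.1) by exact: (c_hd (c_var _ 0)).
have hE : computable cx (fun y => enc_net y.2) by exact: (c_tl (c_var _ 0)).
have hD : computable cx (fun y => enc_net [seq double_arc e | e <- y.2]).
  apply: (@c_map _ _ arc enc_arc (fun y => y.2) 1 _ hE _ enc_arc (fun _ => double_arc)) => //.
  by apply: (c_app1 (a := fun w : arc * _ => w.1) computable_double_arc); exact: (c_var _ 0).
apply: (@c_foldl _ _ arc enc_arc (fun y => y.1) 1 _ hF _ enc_net (fun y E _ => improve y.1 E)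
  (fun y => [seq double_arc e | e <- y.2])
  (fun y => 13 * tsize (enc_net [seq double_arc e | e <- y.2]))) => //.
- apply: (c_app1 (a := fun w : arc * seq arc * (seq arc * seq arc) =>
    (w.2.1, w.1.2)) computable_improve).
  by apply: c_cons; [exact: (c_hd (c_var _ 2)) | exact: (c_var _ 1)].
- by apply/polyb_mul; [exact: polyb_const | have [] := hD].
move=> [F E] pre suf _ /=; apply: profile_tsize.
by rewrite foldl_iter iter_improve_profile.
Qed.

Definition enc_flow_args : bitseq * (seq arc * seq arc) -> tree := enc_pair enc_bits enc_fuel.

Lemma computable_max_flow : computable (fun y => [:: enc_flow_args y])
  (fun y => enc_net (max_flow y.1 y.2.1 y.2.2)).
Proof.
set cx := (X in computable X _).
have hK : computable cx (fun y => enc_bits y.1) by exact: (c_hd (c_var _ 0)).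
have hE : computable cx (fun y => enc_net y.2.2) by exact: (c_tl (c_tl (c_var _ 0))).
apply: (@c_foldl _ _ bool enc_bool (fun y => y.1) 1 _ hK _ enc_net (fun y E _ => phase y.2.1 E)
  (fun y => y.2.2) (fun y => (13 + 8 * tsize (enc_bits y.1)) * tsize (enc_net y.2.2))) => //.
- apply: (c_app1 (a := fun w : bool * seq arc * (bitseq * (seq arc * seq arc)) =>
    (w.2.2.1, w.1.2)) computable_phase).
  by apply: c_cons; [exact: (c_hd (c_tl (c_var _ 2))) | exact: (c_var _ 1)].
- apply/polyb_mul; last by have [] := hE.
  apply/polyb_add; first exact: polyb_const.
  by apply/polyb_mul; [exact: polyb_const | have [] := hK].
move=> [K [F E]] pre suf /= ->.
apply: leq_trans (grown_tsize_net (max_flow_grown pre F E)) _.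
rewrite leq_mul2r leq_add2l leq_mul2l ltnW ?orbT //.
by apply: leq_trans (tsize_enc_size enc_bool pre) _; apply: tsize_enc_prefix.
Qed.

(** * Building the network from the input *)

Lemma c_index (X : Type) (ex : X -> tree) : computable
  (fun y : seq X * nat => [:: enc_seq ex y.1; enc_una y.2])
  (fun y => enc_seq (enc_pair enc_una ex) (indexed y.2 y.1)).
Proof.
apply: (@c_rec X nat (seq X * nat) ex (fun b => [:: enc_una b])
  (fun l b => enc_seq (enc_pair enc_una ex) (indexed b l)) (fun _ b => b.+1)
  [:: fun w => enc_una w.2.+1] (fun y => y.1) (fun y => y.2) 1) => //.
- exact: c_nil.
- pose C (z : X * seq X * nat) := [:: enc_seq (enc_pair enc_una ex) (indexed z.2.+1 z.1.2);
    enc_seq ex (z.1.1 :: z.1.2); enc_una z.2].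
  apply: c_cons; last exact: (c_var C 0).
  by apply: c_cons; [exact: (c_var C 2) | exact: (c_hd (c_var C 1))].
- by split=> //; apply: c_unaS; exact: (c_var _ 1).
pose m (u : seq X * nat) := esize [:: enc_seq ex u.1; enc_una u.2].
have [k hk] : polyb m (fun u => (m u + 1) * (2 * m u + 3) + (2 * m u + 2)).
  have pm := polyb_id m.
  apply/polyb_add/polyb_add/polyb_const; apply/polyb_mul => //;
    try apply/polyb_add/polyb_const => //.
  - by apply/polyb_mul => //; apply/polyb_const.
  - exact: polyb_const.
exists k => u pre s eq_l; set b := foldl _ _ _; cbv zeta; apply: leq_trans (hk u).
have -> : b = u.2 + size pre by rewrite /b foldl_iter; elim: (size pre) => [|n IH];
  rewrite ?addn0 //= IH addnS.
have eq_m : m u = tsize (enc_seq ex u.1) + tsize (enc_una u.2) by rewrite /m /esize /=; lia.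
have le_b : u.2 + size pre + size s <= m u.
  have := tsize_enc_size ex u.1; rewrite eq_l size_cat -eq_l eq_m tsize_una; lia.
have idx (l : seq X) c : tsize (enc_seq (enc_pair enc_una ex) (indexed c l)) <=
    tsize (enc_seq ex l) + size l * (2 * (c + size l) + 2).
  elim: l c => //= x l IH c; have := IH c.+1; rewrite /indexed /= /enc_pair /=.
  by rewrite tsize_una mulSn addSnnS; lia.
apply: leq_trans (leq_add (idx _ _) (leqnn _)) _.
have le_s : tsize (enc_seq ex s) <= m u.
  by rewrite eq_m eq_l; apply: leq_trans (tsize_enc_suffix ex pre s) (leq_addr _ _).
have : size s * (2 * (u.2 + size pre + size s) + 2) <= m u * (2 * m u + 3).
  by apply: leq_mul; lia.
by rewrite /esize /= tsize_una mulnDl mul1n; lia.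
Qed.

Definition enc_vopt (o : option (nat * nat)) : tree := if o is Some x then enc_frac x else Nil.
Definition enc_wterm : wterm -> tree := enc_pair enc_node2 enc_vopt.
Definition enc_sterm : sterm -> tree := enc_pair enc_node2 (enc_pair enc_bool enc_nat).

Lemma c_some (T : Type) (cx : T -> seq tree) (o : T -> option (nat * nat)) :
  computable cx (fun z => enc_vopt (o z)) -> computable cx (fun z => enc_bool (isSome (o z))).
Proof.
move=> ho; apply: eq_computable (c_if ho (c_true cx) (c_false cx)) => z.
by case: (o z).
Qed.

Lemma c_size (T : Type) (cx : T -> seq tree) (X : Type) (ex : X -> tree) (l : T -> seq X) m :
  (forall z, size (cx z) = m) -> computable cx (fun z => enc_seq ex (l z)) ->
  computable cx (fun z => enc_una (size (l z))).
Proof.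
move=> hm hl; apply: (@eq_computable _ _ (fun z => enc_seq (fun _ : unit =>
  Nil) [seq tt | _ <- l z])).
  by move=> z; rewrite /enc_una; elim: (l z) => //= x s ->.
apply: (@c_map _ _ X ex l m hm hl unit (fun=> Nil) (fun _ _ => tt)).
exact: c_nil.
Qed.

Definition enc_input : instance_data -> tree :=
  enc_pair (enc_pair (enc_seq enc_vopt) (enc_seq enc_vopt)) (enc_seq (enc_seq enc_bool)).

Definition input_env (x : instance_data) : seq tree := [:: enc_input x].

Lemma computable_terms : computable input_env (fun x => enc_seq enc_wterm (terms x.1.1 x.1.2)).
Proof.
have hA : computable input_env (fun x => enc_seq enc_vopt x.1.1)
  by exact: (c_hd (c_hd (c_var _ 0))).
have hB : computable input_env (fun x => enc_seq enc_vopt x.1.2)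
  by exact: (c_tl (c_hd (c_var _ 0))).
have hIA := c_app2 (a := fun x => x.1.1) (b :=
  fun=> 4) (c_index enc_vopt) hA (c_una_const input_env 4).
have hsz : computable input_env (fun x => enc_una (4 + size x.1.1)).
  by do 4!apply: c_unaS; apply: (c_size (m := 1)) hA.
have hIB := c_app2 (a := fun x => x.1.2) (c_index enc_vopt) hB hsz.
apply: (@c_cat _ _ _ enc_wterm _ 1) => //.
  apply: (@c_map _ _ _ _ _ 1 _ hIA _ enc_wterm (fun _ x => ((levelA x.2, x.1), x.2))) => //.
  set C := (X in computable X _).
  have ho : computable C (fun w => enc_vopt w.1.2) by exact: (c_tl (c_var _ 0)).
  apply: (c_cons _ ho); apply: c_cons; last exact: (c_hd (c_var _ 0)).
  apply: (@eq_computable _ _ (fun w => enc_una (if isSome w.1.2 then 0 else 1))).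
    by move=> [[n [x|]] ?].
  by apply: c_ifb; [apply: c_some | exact: c_una_const | exact: c_una_const].
apply: (@c_map _ _ _ _ _ 1 _ hIB _ enc_wterm (fun _ x => ((x.1, levelB x.2), x.2))) => //.
set C := (X in computable X _).
have ho : computable C (fun w => enc_vopt w.1.2) by exact: (c_tl (c_var _ 0)).
apply: (c_cons _ ho); apply: c_cons; first exact: (c_hd (c_var _ 0)).
apply: (@eq_computable _ _ (fun w => enc_una (if isSome w.1.2 then 3 else 2))).
  by move=> [[n [x|]] ?].
by apply: c_ifb; [apply: c_some | exact: c_una_const | exact: c_una_const].
Qed.

Lemma tsize_flatten (X : Type) (ex : X -> tree) (ss : seq (seq X)) :
  tsize (enc_seq ex (flatten ss)) <= tsize (enc_seq (enc_seq ex) ss).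
Proof.
by elim: ss => //= s ss IH; have := tsize_enc_cat ex s (flatten ss); lia.
Qed.

Lemma c_flatten (T : Type) (cx : T -> seq tree) (X : Type) (ex : X -> tree)
  (l : T -> seq (seq X)) m :
  (forall z, size (cx z) = m) -> computable cx (fun z => enc_seq (enc_seq ex) (l z)) ->
  computable cx (fun z => enc_seq ex (flatten (l z))).
Proof.
move=> hm hl; have [pl _] := hl.
apply: (@c_para _ _ _ (enc_seq ex) l m hm hl (fun _ s => enc_seq ex (flatten s)) _ _ _ pl).
- exact: c_nil.
- apply: (@c_cat _ _ _ ex (fun w : seq X * seq (seq X) * T => w.1.1) m.+3) => //.
  + by move=> w /=; rewrite hm.
  + exact: (c_var _ 1).
  exact: (c_var _ 0).
move=> z pre suf /= ->; apply: leq_trans (tsize_flatten _ _) _.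
exact: tsize_enc_suffix.
Qed.

Lemma computable_pairs : computable input_env (fun x => enc_seq enc_node2 (pairs (size x.1.1) x.2)).
Proof.
have hA : computable input_env (fun x => enc_seq enc_vopt x.1.1)
  by exact: (c_hd (c_hd (c_var _ 0))).
have hR : computable input_env (fun x => enc_seq (enc_seq enc_bool) x.2)
  by exact: (c_tl (c_var _ 0)).
have hI := c_app2 (a := fun x => x.2) (b := fun=> 4) (c_index (enc_seq enc_bool))
  hR (c_una_const input_env 4).
apply: (@c_flatten _ _ _ enc_node2 _ 1) => //.
apply: (@c_map _ _ _ _ _ 1 _ hI _ (enc_seq enc_node2)
  (fun x r => [seq (r.1, c.1) | c <- [seq c <- indexed (4 + size x.1.1) r.2 | c.2]])) => //.
set C := (X in computable X _).
have hr : computable C (fun w => enc_seq enc_bool w.1.2) by exact: (c_tl (c_var _ 0)).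
have hAC : computable C (fun w => enc_seq enc_vopt w.2.1.1) by exact: (c_hd (c_hd (c_var _ 1))).
have hsz : computable C (fun w => enc_una (4 + size w.2.1.1)).
  by do 4!apply: c_unaS; apply: (c_size (m := 2)) hAC.
have hIr := c_app2 (a := fun w => w.1.2) (c_index enc_bool) hr hsz.
have hfil : computable C (fun w => enc_seq (enc_pair enc_una enc_bool)
    [seq c <- indexed (4 + size w.2.1.1) w.1.2 | c.2]).
  apply: (@c_filter _ _ _ _ _ 2 _ hIr (fun _ c => c.2)) => //.
  exact: (c_tl (c_var _ 0)).
apply: (@c_map _ _ _ _ _ 2 _ hfil _ enc_node2 (fun w c => (w.1.1, c.1))) => //.
by apply: c_cons; [exact: (c_hd (c_var _ 1)) | exact: (c_hd (c_var _ 0))].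
Qed.

Definition enc_scaled : seq sterm * nat -> tree := enc_pair (enc_seq enc_sterm) enc_nat.

Lemma computable_mul_term : computable (fun y : nat * sterm => [:: enc_pair enc_nat enc_sterm y])
  (fun y => enc_sterm (mul_term y.1 y.2)).
Proof.
set C := (X in computable X _).
have hd : computable C (fun y => enc_nat y.1) by exact: (c_hd (c_var _ 0)).
have hy : computable C (fun y => enc_sterm y.2) by exact: (c_tl (c_var _ 0)).
apply: c_cons; first exact: (c_hd hy).
apply: c_cons; first exact: (c_hd (c_tl hy)).
by apply: c_mul hd _; exact: (c_tl (c_tl hy)).
Qed.

Lemma computable_scale_step : computable
  (fun y : wterm * (seq sterm * nat) => [:: enc_pair enc_wterm enc_scaled y])
  (fun y => enc_scaled (scale_step y.1 y.2)).
Proof.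
set C := (X in computable X _).
have ht : computable C (fun y => enc_node2 y.1.1) by exact: (c_hd (c_hd (c_var _ 0))).
have ho : computable C (fun y => enc_vopt y.1.2) by exact: (c_tl (c_hd (c_var _ 0))).
have hl : computable C (fun y => enc_seq enc_sterm y.2.1) by exact: (c_hd (c_tl (c_var _ 0))).
have hD : computable C (fun y => enc_nat y.2.2) by exact: (c_tl (c_tl (c_var _ 0))).
pose nd (y : wterm * (seq sterm * nat)) := odflt (0, 0) y.1.2.
have nat0 : enc_nat 0 = Nil by rewrite /enc_nat nat_bits0.
have hn : computable C (fun y => enc_nat (nd y).1).
  by apply: eq_computable (c_hd ho) => y; rewrite /nd; case: y.1.2 => //=; rewrite nat0.
have hd : computable C (fun y => enc_nat (nd y).2).
  by apply: eq_computable (c_tl ho) => y; rewrite /nd; case: y.1.2 => //=; rewrite nat0.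
apply: (@eq_computable _ _ (fun y => enc_scaled (if isSome y.1.2
  then ((y.1.1, (true, (nd y).1 * y.2.2)) :: [seq mul_term (nd y).2 x | x <- y.2.1],
    (nd y).2 * y.2.2)
  else ((y.1.1, (false, 0)) :: y.2.1, y.2.2)))).
  by move=> [[x [d|]] [l D]].
apply: c_ifb; first exact: c_some.
  apply: c_cons; last exact: c_mul.
  apply: c_cons.
    by apply: (c_cons ht); apply: c_cons; [exact: c_true | exact: c_mul].
  apply: (@c_map _ _ _ enc_sterm _ 1 _ hl _ enc_sterm (fun y => mul_term (nd y).2)) => //.
  apply: (c_app1 (a := fun w : sterm * (wterm * (seq sterm * nat)) =>
    ((nd w.2).2, w.1)) computable_mul_term).
  apply: c_cons; last exact: (c_var _ 0).
  apply: (@c_app1 _ _ _ (enc_pair enc_wterm enc_scaled) (fun y => enc_nat (nd y).2)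
    (fun w : sterm * (wterm * (seq sterm * nat)) => w.2)) hd _.
  exact: (c_var _ 1).
apply: (c_cons _ hD); apply: (c_cons _ hl).
by apply: (c_cons ht); apply: c_cons; [exact: c_false | exact: c_nat0].
Qed.

(** Multiplying numbers adds their sizes, and each fraction enters every product at most once,
    through its numerator or its denominator; so the size of the input list bounds the number of
    digits. *)
Lemma scale_bounds (s : seq wterm) (B := tsize (enc_seq enc_wterm s)) :
  [/\ (scale s).2 < 2 ^ B, all (fun y => y.2.2 < 2 ^ B) (scale s).1 &
      map fst (scale s).1 = map fst s].
Proof.
rewrite {}/B; elim: s => [|[x o] s [ltD ltn eq_fst]]; first by rewrite /= expn1.
rewrite tsize_enc_cons -addSn; set A := (tsize _).+1.
rewrite [scale _]/(scale_step (x, o) (scale s)) /scale_step /=.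
set B := tsize (enc_seq enc_wterm s) in ltD ltn *.
have le_pow : 2 ^ B <= 2 ^ (A + B) by rewrite leq_exp2l ?leq_addl.
case: o @A le_pow => [[n d]|] A le_pow /=; last first.
  split; [exact: leq_trans le_pow | | by rewrite eq_fst].
  by rewrite expn_gt0 /=; apply: sub_all ltn => y lty; apply: leq_trans le_pow.
have leA : tsize (enc_nat n) + tsize (enc_nat d) <= A.
  by rewrite /A /enc_wterm /enc_pair /=; lia.
have big m e : m < 2 ^ tsize (enc_nat e) -> tsize (enc_nat e) <= A -> forall j,
  j < 2 ^ B -> m * j < 2 ^ (A + B).
  move=> lt_m le_e j lt_j; rewrite expnD; apply: leq_trans (_ : 2 ^ tsize (enc_nat e) * 2 ^ B <= _).
    exact: ltn_mul.
  by rewrite leq_mul2r leq_exp2l ?le_e ?orbT.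
split.
- by apply: (big d d) => //; [exact: enc_nat_lt | lia].
- rewrite (big n n) ?enc_nat_lt //=; last by lia.
  rewrite all_map; apply: sub_all ltn => y lty /=.
  by apply: (big d d) => //; [exact: enc_nat_lt | lia].
by rewrite -map_comp /= -eq_fst.
Qed.

Lemma tsize_sterms B (l : seq sterm) : all (fun y => y.2.2 < 2 ^ B) l ->
  tsize (enc_seq enc_sterm l) <= tsize (enc_search (map fst l)) + size l * (4 * B + 6).
Proof.
elim: l => //= y l IH /andP[/tsize_enc_nat lt_y /IH le].
rewrite -/(enc_search _) in le *; rewrite /enc_sterm /enc_pair /= -/(enc_seq enc_sterm l) mulSn.
by move: lt_y le; rewrite /enc_sterm /enc_pair; case: y.2.1 => /=; lia.
Qed.

Lemma tsize_wterms (s : seq wterm) : tsize (enc_search (map fst s)) <= tsize (enc_seq enc_wterm s).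
Proof.
elim: s => //= t s IH; rewrite -/(enc_search _) -/(enc_seq _ _).
by rewrite /enc_wterm /enc_pair /= in IH *; lia.
Qed.

Lemma computable_scale : computable input_env (fun x => enc_scaled (scale (terms x.1.1 x.1.2))).
Proof.
pose B (x : instance_data) := tsize (enc_seq enc_wterm (terms x.1.1 x.1.2)).
apply: (@c_para _ input_env _ enc_wterm (fun x =>
  terms x.1.1 x.1.2) 1 _ computable_terms (fun _ s => enc_scaled (scale s))
  (fun x => B x + B x * (4 * B x + 6) + 4 * B x + 2)) => //.
- by apply: c_cons; [exact: c_nil | exact: c_nat1].
- apply: (c_app1 (a := fun w => (w.1.1, scale w.1.2)) computable_scale_step).
  by apply: c_cons; [exact: (c_var _ 1) | exact: (c_var _ 0)].
- have [pB _] := computable_terms.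
  have pc c := polyb_const (esize \o input_env) c.
  by do ![apply: polyb_add => //; try exact: pc]; apply: polyb_mul => //;
     try apply: polyb_add => //; try apply: polyb_mul => //; exact: pc.
move=> x pre suf eq_t; have [ltD ltn eq_fst] := scale_bounds suf.
have le_suf : tsize (enc_seq enc_wterm suf) <= B x by rewrite /B eq_t; apply: tsize_enc_suffix.
have le1 := tsize_enc_nat ltD; have le2 := tsize_sterms ltn; rewrite eq_fst in le2.
have le3 := tsize_wterms suf.
have : size (scale suf).1 * (4 * tsize (enc_seq enc_wterm suf) + 6) <= B x * (4 * B x + 6).
  apply: leq_mul; last by lia.
  rewrite -(size_map fst) eq_fst size_map; apply: leq_trans le_suf.
  exact/ltnW/tsize_enc_size.
by rewrite /enc_scaled /enc_pair /=; lia.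
Qed.

Lemma total_lt (sc : seq sterm) : total sc < 2 ^ tsize (enc_seq enc_sterm sc).
Proof.
elim: sc => // y s IH; rewrite tsize_enc_cons expnS expnD [total _]/=.
have lt_y : y.2.2 < 2 ^ tsize (enc_sterm y).
  apply: leq_trans (enc_nat_lt _) _; rewrite leq_exp2l //.
  by rewrite /enc_sterm /enc_pair /=; lia.
move: IH lt_y; move: (2 ^ tsize (enc_sterm y)) (2 ^ tsize (enc_seq _ _)) => a b; nia.
Qed.

Lemma computable_total : computable (fun l => [:: enc_seq enc_sterm l]) (fun l =>
  enc_nat (total l)).
Proof.
have hl : computable (fun l => [:: enc_seq enc_sterm l]) (enc_seq enc_sterm) by exact: (c_var _ 0).
apply: (@c_para _ _ _ enc_sterm id 1 _ hl (fun _ s => enc_nat (total s))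
  (fun l => 4 * tsize (enc_seq enc_sterm l) + 1)) => //.
- exact: c_nat0.
- apply: c_add; last exact: (c_var _ 0).
  exact: (c_tl (c_tl (c_var _ 1))).
- apply/polyb_add/polyb_const/polyb_mul; first exact: polyb_const.
  by have [] := hl.
move=> l pre suf /= ->; have := tsize_enc_nat (total_lt suf).
by have := tsize_enc_suffix enc_sterm pre suf; lia.
Qed.

Lemma computable_msb : computable (fun y : bitseq * nat => [:: enc_pair enc_bits enc_nat y])
  (fun y => enc_bits (msb y.1 y.2)).
Proof.
set C := (X in computable X _).
have hK : computable C (fun y => enc_bits y.1) by exact: (c_hd (c_var _ 0)).
have hn : computable C (fun y => enc_nat y.2) by exact: (c_tl (c_var _ 0)).
suff h : computable C (fun y => enc_pair enc_bits enc_bits (foldl msb_step (nat_bits y.2,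
  [::]) y.1)).
  exact: (c_tl h).
apply: (@c_foldl _ _ _ enc_bool (fun y => y.1) 1 _ hK _ (enc_pair enc_bits enc_bits)
  (fun _ => msb_step) (fun y => (nat_bits y.2, [::]))
  (fun y => tsize (enc_nat y.2) + 4 * tsize (enc_bits y.1) + 2)) => //.
- by apply: (c_cons hn); exact: c_nil.
- apply: (@eq_computable _ _ (fun w : bool * (bitseq * bitseq) * (bitseq * nat) =>
    Cons (ttl (enc_bits w.1.2.1)) (Cons (thd (enc_bits w.1.2.1)) (enc_bits w.1.2.2)))).
    by move=> [[b [[|c s] acc]] y].
  pose C' (w : bool * (bitseq * bitseq) * (bitseq * nat)) :=
    [:: enc_bool w.1.1; enc_pair enc_bits enc_bits w.1.2; enc_pair enc_bits enc_nat w.2].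
  have h1 : computable C' (fun w => enc_bits w.1.2.1) by exact: (c_hd (c_var _ 1)).
  have h2 : computable C' (fun w => enc_bits w.1.2.2) by exact: (c_tl (c_var _ 1)).
  exact: (c_cons (c_tl h1) (c_cons (c_hd h1) h2)).
- apply/polyb_add/polyb_const/polyb_add; first by have [] := hn.
  by apply: polyb_mul; [exact: polyb_const | have [] := hK].
move=> [K n] pre suf /= ->.
have := tsize_enc_prefix enc_bool pre suf; have := tsize_enc_size enc_bool pre.
suff main (l acc : bitseq) : tsize (enc_pair enc_bits enc_bits (foldl msb_step (l, acc) pre)) <=
    (tsize (enc_bits l) + tsize (enc_bits acc)).+1 + 4 * size pre.
  move=> lt_s le_p; apply: leq_trans (main _ _) _.
  by rewrite [tsize (enc_bits [::])]/= -/(enc_nat n) /enc_bits /enc_nat; lia.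
elim: pre l acc => [|b s IH] l acc; first by rewrite muln0 addn0.
apply: leq_trans (IH _ _) _; rewrite /enc_bits.
by case: l => [|c l]; rewrite /= ?tsize_enc_cons; try case: c; rewrite /=; lia.
Qed.

Lemma c_ones (T : Type) (cx : T -> seq tree) (K : T -> bitseq) m :
  (forall z, size (cx z) = m) -> computable cx (fun z => enc_bits (K z)) ->
  computable cx (fun z => enc_bits (ones (K z))).
Proof.
move=> hm hK; apply: (@c_map _ _ _ enc_bool K m hm hK _ enc_bool (fun _ _ => true)).
exact: c_true.
Qed.

Lemma computable_zero_arc (T : Type) (cx : T -> seq tree) (p : T -> nat * nat) (bs : T -> bitseq) :
  computable cx (fun z => enc_node2 (p z)) -> computable cx (fun z => enc_bits (bs z)) ->
  computable cx (fun z => enc_arc (p z, (bs z, (0, 0)))).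
Proof.
by move=> hp hb; apply: (c_cons hp (c_cons hb (c_cons _ _))); exact: c_nat0.
Qed.

Lemma computable_term_arc : computable (fun y : bitseq * sterm =>
  [:: enc_pair enc_bits enc_sterm y])
  (fun y => enc_arc (term_arc y.1 y.2)).
Proof.
set C := (X in computable X _).
have hK : computable C (fun y => enc_bits y.1) by exact: (c_hd (c_var _ 0)).
have hy : computable C (fun y => enc_sterm y.2) by exact: (c_tl (c_var _ 0)).
apply: computable_zero_arc; first exact: (c_hd hy).
apply: c_ifb; first exact: (c_hd (c_tl hy)).
  exact: (c_app1 (a := fun y => (y.1, y.2.2.2)) computable_msb (c_cons hK (c_tl (c_tl hy)))).
exact: (@c_ones _ _ _ 1).
Qed.

Section Solve.
Let sc (x : instance_data) := (scale (terms x.1.1 x.1.2)).1.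
Let K (x : instance_data) := digits (sc x).

Lemma computable_digits : computable input_env (fun x => enc_bits (K x)).
Proof. exact: (c_succ (c_app1 (a := sc) computable_total (c_hd computable_scale))). Qed.

Let net0 (x : instance_data) := network (K x) (sc x) (pairs (size x.1.1) x.2).

Lemma computable_network : computable input_env (fun x => enc_net (net0 x)).
Proof.
apply: (@c_cat _ _ _ enc_arc _ 1) => //.
  apply: (@c_map _ _ _ enc_sterm sc 1 _ (c_hd computable_scale) _ enc_arc (fun x y =>
    term_arc (K x) y)) => //.
  apply: (c_app1 (a := fun w : sterm * instance_data => (K w.2, w.1)) computable_term_arc).
  apply: c_cons; last exact: (c_var _ 0).
  by apply: (@c_app1 _ _ _ enc_input (fun x => enc_bits (K x))
    (fun w : sterm * instance_data => w.2)) computable_digits _; exact: (c_var _ 1).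
apply: (@c_map _ _ _ enc_node2 _ 1 _ computable_pairs _ enc_arc (fun x p => pair_arc (K x) p)) =>
  //.
apply: computable_zero_arc; first exact: (c_var _ 0).
apply: (@c_ones _ _ _ 2) => //.
by apply: (@c_app1 _ _ _ enc_input (fun x => enc_bits (K x))
  (fun w : (nat * nat) * instance_data => w.2)) computable_digits _; exact: (c_var _ 1).
Qed.

Lemma computable_final_flow : computable input_env (fun x => enc_net (final_flow x.1.1 x.1.2 x.2)).
Proof.
have hN := computable_network.
have hF : computable input_env (fun x => enc_net (net0 x ++ net0 x ++ net0 x)).
  by do 2![apply: (@c_cat _ _ _ enc_arc _ 1) => //].
exact: (c_app1 (a := fun x => (K x, (net0 x ++ net0 x ++ net0 x, net0 x))) computable_max_flow
  (c_cons computable_digits (c_cons hF hN))).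
Qed.

Lemma computable_read (f : arc -> nat) : computable (fun e => [:: enc_arc e]) (fun e =>
  enc_una (f e)) ->
  computable input_env (fun x => enc_seq enc_frac
    (read f (scale (terms x.1.1 x.1.2)).2 (final_flow x.1.1 x.1.2 x.2))).
Proof.
move=> hf.
have hfil : computable input_env (fun x => enc_net [seq e <- final_flow x.1.1 x.1.2 x.2 | f e <=
  3]).
  apply: (@c_filter _ _ _ enc_arc _ 1 _ computable_final_flow (fun _ e => f e <= 3)) => //.
  apply: c_una_leq; last exact: c_una_const.
  by apply: (c_app1 (a := fun w : arc * instance_data => w.1) hf); exact: (c_var _ 0).
apply: (@c_map _ _ _ enc_arc _ 1 _ hfil _ enc_frac
  (fun x e => (bw e, (scale (terms x.1.1 x.1.2)).2))) => //.
apply: c_cons; first exact: (c_tl (c_tl (c_tl (c_var _ 0)))).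
apply: (@c_app1 _ _ _ enc_input (fun x => enc_nat (scale (terms x.1.1 x.1.2)).2)
  (fun w : arc * instance_data => w.2) (c_tl computable_scale)).
exact: (c_var _ 1).
Qed.

Lemma computable_solve : computable input_env
  (fun x => enc_pair (enc_seq enc_frac) (enc_seq enc_frac) (solve x)).
Proof.
apply: c_cons; apply: computable_read; first exact: (c_hd (c_hd (c_var _ 0))).
exact: (c_tl (c_hd (c_var _ 0))).
Qed.
End Solve.

Lemma enc_seq_map (X Y : Type) (e : Y -> tree) (f : X -> Y) s :
  enc_seq e [seq f x | x <- s] = enc_seq (fun x => e (f x)) s.
Proof. by elim: s => //= x s ->. Qed.

Lemma enc_seq_eq (X : Type) (e e' : X -> tree) s : (forall x, e x = e' x) ->
  enc_seq e s = enc_seq e' s.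
Proof. by move=> eq_e; elim: s => //= x s ->; rewrite eq_e. Qed.

Lemma enc_input_instance I : enc_input (input I) = enc_instance I.
Proof.
have vE (v : vertex I) : enc_vopt (vopt v) = enc_vertex v.
  by rewrite /enc_vopt /vopt /enc_vertex; case: priceable.
rewrite /enc_input /enc_pair /=; congr (Cons (Cons _ _) _).
- by rewrite enc_seq_map; apply: enc_seq_eq => i; apply: vE.
- by rewrite enc_seq_map; apply: enc_seq_eq => j; apply: vE.
by rewrite enc_seq_map; apply: enc_seq_eq => i; rewrite enc_seq_map.
Qed.

(** The constant [3 ^ k] absorbs the 2 in [polyb], as every tree has size at least 1. *)
Lemma computable_program (X : Type) (ex F : X -> tree) : computable (fun x => [:: ex x]) F ->
  exists (alg : program) (k : nat), forall x, exists t,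
    run alg (ex x) (F x) t /\ t + tsize (F x) <= 3 ^ k * tsize (ex x) ^ k.
Proof.
(* The prefix of length 1 is reserved for [e] itself, which becomes function 0, the entry point. *)
move=> [pF hF]; have [Q [e [b [pb hQ]]]] := hF 1.
have [k hk] := polyb_add pb pF.
exists (e :: Q), k => x; have [t ev le_t] := hQ [:: e] [::] erefl x.
exists t; split; first by rewrite cats0 in ev; exact: ev.
apply: leq_trans (_ : b x + tsize (F x) <= _); first by rewrite leq_add2r.
apply: leq_trans (hk x) _; rewrite -expnMn; apply: leq_expr.
by rewrite /= /esize /= addn0; have := tsize_gt0 (ex x); lia.
Qed.

Local Open Scope ring_scope.

Theorem theorem4p5 :
  exists alg : program,
    polynomial_time alg /\
    forall I : instance, well_formed I ->
      exists p : vertex I -> rat,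
        outputs_prices alg p /\
        forall R : realType,
          valid_prices (fun v => ratr (p v) : R) /\
          forall q : vertex I -> R, valid_prices q ->
            revenue q / 2 <= revenue (fun v => ratr (p v) : R).
Proof.
have [alg [k halg]] := computable_program computable_solve.
exists alg; split.
  exists (3 ^ k)%N, k => I _; have [t [ev le_t]] := halg (input I).
  by rewrite enc_input_instance in ev le_t; exists (enc_pair (enc_seq enc_frac)
    (enc_seq enc_frac) (solve (input I))), t.
move=> I wfI; have [fl [eq_solve opt]] := solve_input wfI.
have [D_gt0 _ _] := scale_input I; set D := (scale _).2 in eq_solve opt D_gt0.
exists (fun v => (fl v)%:R / D%:R); split.
  have [t [ev _]] := halg (input I); exists (fun v => (fl v, D)), t; split=> //.
  move: ev; rewrite enc_input_instance eq_solve /enc_pair [_.1]/= [_.2]/=.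
  by rewrite (enc_seq_map _ (fun i => (fl (inl i), D))) (enc_seq_map _ (fun j => (fl (inr j), D))).
move=> R; split=> [v _|q]; last exact: opt.
by rewrite ler0q divr_ge0 ?ler0n.
Qed.
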